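(* Let $f\in C^2(\mathbb{R})$ have uniformly bounded second derivative, satisfy $f(0)=0$, $f'(0)=0$, and assume that there is a number $c_1>0$ such that $f''\ge c_1$ on $\mathbb{R}$. Let $\varphi\in L^1(\mathbb{R}^n)$ satisfy $\varphi\ge 0$ in $\mathbb{R}^n$, $\int_{\mathbb{R}^n}\varphi=1$, $\int_{\mathbb{R}^n}y\,\varphi(y)\,dy=0$ and $\int_{\mathbb{R}^n}|y|^2\varphi(y)\,dy<\infty$, and for $\varepsilon>0$ let $\varphi_\varepsilon(x)=\varepsilon^{-n}\varphi(x/\varepsilon)$ and $u_\varepsilon=u*\varphi_\varepsilon$. If for $u\in L^2(\mathbb{R}^n)$ $$\liminf_{\varepsilon\to0}\frac1{\varepsilon^2}\int_{\mathbb{R}^n}\bigl[f(u(x))-f(u_\varepsilon(x))\bigr]\,dx<\infty,$$ then $u\in W^{1,2}(\mathbb{R}^n)$. In particular, $$\lim_{\varepsilon\to0}\frac1{\varepsilon^2}\int_{\mathbb{R}^n}\bigl[f(u)-f(u_\varepsilon)\bigr]\,dx=\frac12\int_{\mathbb{R}^n}f''(u(x))\,\nabla u(x)\cdot A(\varphi)\nabla u(x)\,dx,\qquad A(\varphi)=\int_{\mathbb{R}^n}(y\otimes y)\,\varphi(y)\,dy,$$ and, if $\varphi$ is rotationally symmetric, i.e. $\varphi(x)=\tilde\varphi(|x|)$ for some $\tilde\varphi:[0,\infty)\to[0,\infty)$, also $$\lim_{\varepsilon\to0}\frac1{\varepsilon^2}\int_{\mathbb{R}^n}\bigl[f(u)-f(u_\varepsilon)\bigr]\,dx=\frac12\,a(\varphi)\int_{\mathbb{R}^n}f''(u(x))\,|\nabla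 u(x)|^2\,dx,\qquad a(\varphi)=\omega_n\int_0^\infty r^{n+1}\tilde\varphi(r)\,dr.$$
   Context: Functions $u$ are real-valued. The convolution is $u_\varepsilon(x)=(u*\varphi_\varepsilon)(x)=\int_{\mathbb{R}^n}u(x-y)\varphi_\varepsilon(y)\,dy$. For $a,b\in\mathbb{R}^n$, $a\otimes b$ denotes the tensor product, i.e. the $n\times n$ matrix with entries $a_ib_j$. $\omega_n=|B_1(0)|$ is the volume of the unit ball in $\mathbb{R}^n$. *)

(* Defs.v *)
From HB Require Import structures.
From mathcomp Require Import all_boot all_order all_algebra.
From mathcomp Require Import all_classical all_reals all_analysis.

Set Implicit Arguments.
Unset Strict Implicit.
Unset Printing Implicit Defensive.

Import Order.TTheory GRing.Theory Num.Theory.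
Import numFieldNormedType.Exports.

Local Open Scope classical_set_scope.
Local Open Scope ring_scope.

(* R^n is the type 'rV[R]_n. Its library topology and derivatives are the usual
   ones, but its library norm `|x| is the sup norm; the Euclidean norm is
   [enorm] below. *)

Definition measure_rV_display : measure_display -> measure_display.
Proof. exact. Qed.

(* The product sigma-algebra on row vectors, built like the library's one on
   n.-tuple T. For T = R it is the Borel sigma-algebra. Since every Lebesgue
   measurable function agrees a.e. with a Borel one, measurability with respect
   to it is no restriction on classes of functions such as those of L^p. *)
Section measurable_rV.
Context d (T : measurableType d) (n : nat).

Definition rV_coord (i : 'I_n) (x : 'rV[T]_n) : T := x ord0 i.

Let rV_set0 : g_sigma_preimage rV_coord set0.
Proof. exact: sigma_algebra0. Qed.

Let rV_setC A : g_sigma_preimage rV_coord A -> g_sigma_preimage rV_coord (~` A).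
Proof. exact: sigma_algebraC. Qed.

Let rV_bigcup (F : (set 'rV[T]_n)^nat) :
  (forall i, g_sigma_preimage rV_coord (F i)) ->
  g_sigma_preimage rV_coord (\bigcup_i F i).
Proof. exact: sigma_algebra_bigcup. Qed.

HB.instance Definition _ := @isMeasurable.Build (measure_rV_display d)
  'rV[T]_n (g_sigma_preimage rV_coord) rV_set0 rV_setC rV_bigcup.

End measurable_rV.

Lemma measurable_fun_rVP d1 d (T1 : measurableType d1) (T : measurableType d)
    n (f : T1 -> 'rV[T]_n) :
  (forall i, measurable_fun setT (fun x => f x ord0 i)) -> measurable_fun setT f.
Proof.
move=> mf.
suff : g_sigma_preimage (fun i => @rV_coord _ T n i \o f) `<=` measurable.
  by rewrite g_sigma_preimage_comp => sub _ A mA; apply: sub; exists A.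
apply: smallest_sub; first exact: sigma_algebra_measurable.
elim/big_ind : _ => // [A B sA sB C [/sA|/sB]//|i _ A [B mB <-]].
exact: mf.
Qed.

(* Lebesgue measure on R^n, as the n-fold product of the one on R. *)
Section lebesgue_rV.
Context {R : realType}.

Definition rV_cons n (p : 'rV[R]_n * measurableTypeR R) : 'rV[R]_n.+1 :=
  \row_i oapp (fun j => p.1 ord0 j) p.2 (unlift ord0 i).

Lemma measurable_rV_cons n : measurable_fun setT (@rV_cons n).
Proof.
apply: measurable_fun_rVP => i.
under eq_fun do rewrite mxE.
case: (unlift ord0 i) => [j|] /=; last exact: measurable_snd.
apply: (measurableT_comp (f := fun x : 'rV[R]_n => x ord0 j)); last first.
  exact: measurable_fst.
move=> _ A mA; rewrite setTI; apply: sub_sigma_algebra.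
by rewrite -bigcup_seq; exists j; [exact: mem_index_enum|exists A; rewrite ?setTI].
Qed.

Section step.
Variables (n : nat) (m : {measure set 'rV[R]_n -> \bar R}).

(* The product of m with one more copy of the Lebesgue measure on R. *)
Definition lebesgue_rVS : set 'rV[R]_n.+1 -> \bar R :=
  pushforward (m \x @lebesgue_measure R)%E (@rV_cons n).

Let preim A : measurable A -> measurable (@rV_cons n @^-1` A).
Proof.
by move=> mA; rewrite -[X in measurable X]setTI; exact: measurable_rV_cons.
Qed.

Let lebesgue_rVS0 : lebesgue_rVS set0 = 0%E.
Proof. by rewrite /lebesgue_rVS /pushforward preimage_set0 measure0. Qed.

Let lebesgue_rVS_ge0 A : (0 <= lebesgue_rVS A)%E.
Proof. by rewrite /lebesgue_rVS /pushforward measure_ge0. Qed.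

Let lebesgue_rVS_sigma_additive : semi_sigma_additive lebesgue_rVS.
Proof.
move=> F mF tF mUF; rewrite /lebesgue_rVS /pushforward preimage_bigcup.
apply: measure_semi_sigma_additive.
- by move=> k; exact: preim.
- apply/trivIsetP => /= i j _ _ ij; rewrite -preimage_setI.
  by move/trivIsetP : tF => /(_ _ _ _ _ ij) ->//; rewrite preimage_set0.
- by rewrite -preimage_bigcup; exact: preim.
Qed.

HB.instance Definition _ := isMeasure.Build _ _ _ lebesgue_rVS
  lebesgue_rVS0 lebesgue_rVS_ge0 lebesgue_rVS_sigma_additive.

End step.

Fixpoint lebesgue_rV n : {measure set 'rV[R]_n -> \bar R} :=
  if n is k.+1 then lebesgue_rVS (lebesgue_rV k) else \d_(0 : 'rV[R]_0).

End lebesgue_rV.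

Section definitions.
Context {R : realType} {n : nat}.
Implicit Types (x y : 'rV[R]_n) (u v phi psi : 'rV[R]_n -> R).

Local Notation mu := (@lebesgue_rV R n).

Definition enorm x : R := Num.sqrt (\sum_i x ord0 i ^+ 2).

Definition unit_ball_volume : R := fine (mu [set x | enorm x < 1]).

Definition tensor x y : 'M[R]_n := x^T *m y.

(* Real-valued: it is 0 at the points x where the integral is not absolutely
   convergent, a null set when u is in L^2 and phi in L^1. *)
Definition convolution u phi x : R := (\int[mu]_y (u (x - y) * phi y))%R.

Definition rescale phi (eps : R) x : R := eps ^- n * phi (eps^-1 *: x).

Definition moment_matrix phi : 'M[R]_n :=
  \matrix_(i, j) (\int[mu]_y (tensor y y i j * phi y))%R.

(* Only the values of phit on [0, +oo[ matter. *)
Definition radial_constant (phit : R -> R) : R :=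
  unit_ball_volume *
  (\int[lebesgue_measure]_(r in `[0%R, +oo[) (r ^+ n.+1 * phit r))%R.

(* eps^-2 * \int (f(u) - f(u_eps)), with u_eps = u * phi_eps. *)
Definition rescaled_defect (f : R -> R) u phi (eps : R) : \bar R :=
  ((eps ^- 2)%:E *
   \int[mu]_x (f (u x) - f (convolution u (rescale phi eps) x))%:E)%E.

Definition C2 (f : R -> R) : Prop :=
  [/\ forall t, derivable f t 1, forall t, derivable (f^`()%classic) t 1 &
      continuous (f^`(2)%classic)].

Definition basis_rV (i : 'I_n) : 'rV[R]_n := delta_mx ord0 i.

Definition iter_partial (s : seq 'I_n) psi : 'rV[R]_n -> R :=
  foldr (fun i g => 'D_(basis_rV i) g) psi s.

(* C^oo: all iterated partial derivatives exist and are continuous. *)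
Definition smooth psi : Prop := forall s,
  continuous (iter_partial s psi) /\
  forall i x, derivable (iter_partial s psi) x (basis_rV i).

Definition test_function psi : Prop :=
  smooth psi /\ compact (closure [set x | psi x != 0]).

Definition weak_gradient u (Du : 'rV[R]_n -> 'rV[R]_n) : Prop :=
  forall psi i, test_function psi ->
    (\int[mu]_x (u x * 'D_(basis_rV i) psi x) =
     - \int[mu]_x (Du x ord0 i * psi x))%R.

(* Du is the gradient of u in W^{1,2}; it is unique up to a null set. *)
Definition W12_with_gradient u (Du : 'rV[R]_n -> 'rV[R]_n) : Prop :=
  [/\ u \in Lfun mu 2%:E, forall i, (fun x => Du x ord0 i) \in Lfun mu 2%:E &
      weak_gradient u Du].

Definition W12 u : Prop := exists Du, W12_with_gradient u Du.

End definitions.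

(* Main.v *)
Require Import Defs.
From HB Require Import structures.
From mathcomp Require Import all_boot all_order all_algebra perm fingroup.
From mathcomp Require Import all_classical all_reals all_analysis.
From mathcomp Require Import measurable_realfun.
From mathcomp Require Import ring lra.
Import Order.TTheory GRing.Theory Num.Theory.
Import numFieldNormedType.Exports.
Local Open Scope classical_set_scope.
Local Open Scope ring_scope.
Set Implicit Arguments.
Unset Strict Implicit.
Unset Printing Implicit Defensive.

(** Let P be the probability measure phi dx, let u_e(x) be the P-average over y of
    u(x - e y), which is the convolution of u with the rescaled kernel, let A be the
    matrix of second moments of P, and let Rem(a, b) = f(b) - f(a) - f'(a)(b - a).

    The defect as a square. Since u_e(x) is the mean of u(x - e y) over y, the
    first-order Taylor term at u_e(x) averages to 0, and since translations preserve
    Lebesgue measure, the integral of f(u) - f(u_e) equals the double integral of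
    Rem(u_e(x), u(x - e y)) dx dP(y) ([defectE]). As c1 <= f'' <= M, this is comparable
    to the square of the norm of the fluctuation u(x - e y) - u_e(x) in L2(dx dP). A
    finite lower limit therefore bounds fluctuation / e along some e tending to 0.

    The gradient exists. Test the fluctuation against psi(x) (w . y), with psi smooth and
    compactly supported. Because y has mean 0 the average u_e drops out, and the
    translation can be moved from u to psi ([fluct_pairing]); in the limit e -> 0 the
    pairing divided by e becomes the integral of u times the derivative of psi in the
    direction A w. So this integral is bounded by a multiple of the L2 norm of psi. The
    matrix A is invertible because P charges no hyperplane ([moments_unit]), so every
    coordinate direction is of the form A w, and the Riesz theorem gives weak derivatives
    in L2 ([fluct_bound_gradient]).

    The limit. A function with weak gradient Du in L2 has difference quotients that
    converge in L2(dx dP) to Du . y ([prod_quot_vanish]), because they are controlled by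
    the oscillation of Du under small translations ([diffquot_le]). As the P-average of
    Du . y is 0, the fluctuation / e converges to - Du . y, and Taylor's formula in
    Lagrange form together with dominated convergence yields the limit
    f''(u) (Du . y)^2 / 2 of the integrand ([defect_cvg]); integrating in y first
    produces A.

    Radial kernels. Reflections and exchanges of coordinates make A a multiple of the
    identity, and polar coordinates identify the factor ([radial_moment_matrix]). The
    radial profile is an arbitrary function: it is replaced by the restriction of the
    kernel to a generic ray, a Borel function with which it agrees at almost every
    radius.

    The L2 theory that this uses (completeness, the Riesz theorem on a subspace, density
    of test functions, continuity of translations) comes first. *)

(** * Square-integrable functions *)

Lemma sqrrD_le2 (R : realDomainType) (a b : R) :
  (a + b) ^+ 2 <= 2 * a ^+ 2 + 2 * b ^+ 2.
Proof.
rewrite -subr_ge0 (_ : _ - _ = (a - b) ^+ 2) ?sqr_ge0//; ring.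
Qed.

(** The sequences a_k - 2 C / 2^k and a_k + 2 C / 2^k are monotone in opposite
    directions and enclose the limit, which gives the rate as well. *)
Lemma geometric_cauchy (R : realType) (a : R ^nat) (C : R) :
  (forall k, `|a k.+1 - a k| <= C * 2^-1 ^+ k) ->
  exists l, a k @[k --> \oo] --> l /\
    forall k, `|a k - l| <= 2 * C * 2^-1 ^+ k.
Proof.
move=> aC.
pose b k := a k - 2 * C * 2^-1 ^+ k; pose c k := a k + 2 * C * 2^-1 ^+ k.
have C0 : 0 <= C by have := aC 0%N; rewrite expr0 mulr1; apply: le_trans.
have hk (k : nat) : 0 <= (2^-1 : R) ^+ k by rewrite exprn_ge0.
have ndb : {homo b : n m / (n <= m)%N >-> n <= m}.
  apply/nondecreasing_seqP => k; have := aC k; rewrite ler_norml /b exprS.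
  by move=> /andP[]; lra.
have nic : {homo c : n m / (n <= m)%N >-> m <= n}.
  apply/nonincreasing_seqP => k; have := aC k; rewrite ler_norml /c exprS.
  by move=> /andP[]; lra.
have bc i j : b i <= c j.
  have [ij|/ltnW ji] := leqP i j.
    apply: (le_trans (ndb _ _ ij)); rewrite /b /c.
    by have := mulr_ge0 C0 (hk j); lra.
  apply: (le_trans _ (nic _ _ ji)); rewrite /b /c.
  by have := mulr_ge0 C0 (hk i); lra.
have ub : has_ubound (range b) by exists (c 0%N) => _ [i _ <-]; exact: bc.
have bl := nondecreasing_cvgn ndb ub.
exists (sup (range b)); split.
  rewrite (_ : a = fun k => b k + 2 * C * 2^-1 ^+ k); last first.
    by apply/funext => k; rewrite /b subrK.
  rewrite -[X in _ --> X]addr0; apply: cvgD => //.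
  rewrite -[X in _ --> X](mulr0 (2 * C)); apply: cvgM; first exact: cvg_cst.
  by apply: cvg_expr; rewrite ger0_norm// invf_lt1// ltr1n.
move=> k; rewrite ler_distlC; apply/andP; split.
  by apply: ub_le_sup => //; exists k.
by apply: ge_sup => [|_ [i _ <-]]; [exists (b 0%N), 0%N|exact: bc].
Qed.

Section L2.
Context d (T : measurableType d) (R : realType).
Variable m : {measure set T -> \bar R}.
Implicit Types F G g h : T -> R.

Definition rint F := m.-integrable setT (EFin \o F).

Lemma rintD F G : rint F -> rint G -> rint (fun x => F x + G x).
Proof. by move=> iF iG; apply: (integrableD _ iF iG). Qed.

Lemma rintB F G : rint F -> rint G -> rint (fun x => F x - G x).
Proof. by move=> iF iG; apply: (integrableB _ iF iG). Qed.

Lemma rintZ (c : R) F : rint F -> rint (fun x => c * F x).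
Proof. by move=> iF; apply: (integrableZl _ c iF). Qed.

Lemma rint_dom F G : measurable_fun setT F ->
  (forall x, `|F x| <= G x) -> rint G -> rint F.
Proof.
move=> mF FG; apply: le_integrable => //; first exact/measurable_EFinP.
by move=> x _; rewrite /= lee_fin (le_trans (FG x))// ler_norm.
Qed.

Definition L2 g := measurable_fun setT g /\ rint (fun x => g x ^+ 2).

Definition ip g h : R := (\int[m]_x (g x * h x))%R.
Definition sq g : R := (\int[m]_x (g x ^+ 2))%R.

Lemma ipE g : ip g g = sq g.
Proof. by apply: eq_Rintegral => x _; rewrite expr2. Qed.

Lemma ipC g h : ip g h = ip h g.
Proof. by apply: eq_Rintegral => x _; rewrite mulrC. Qed.

Lemma sq_ge0 g : 0 <= sq g.
Proof. by apply: Rintegral_ge0 => x _; rewrite sqr_ge0. Qed.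

Lemma L2_mul_integrable g h : L2 g -> L2 h ->
  rint (fun x => g x * h x).
Proof.
move=> [mg ig] [mh ih].
apply: (@rint_dom _ (fun x => g x ^+ 2 + h x ^+ 2)).
- exact: measurable_funM.
- by move=> x; rewrite ler_norml; apply/andP; split; nra.
- exact: rintD ig ih.
Qed.

Lemma L2_bound h (G : T -> R) : measurable_fun setT h ->
  (forall x, h x ^+ 2 <= G x) -> rint G -> L2 h.
Proof.
move=> mh hG iG; split => //; apply: (rint_dom _ _ iG).
  exact: measurable_funX.
by move=> x; rewrite ger0_norm ?sqr_ge0.
Qed.

Lemma L2D g h : L2 g -> L2 h -> L2 (fun x => g x + h x).
Proof.
move=> [mg ig] [mh ih].
apply: (@L2_bound _ (fun x => 2 * g x ^+ 2 + 2 * h x ^+ 2)).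
- exact: measurable_funD.
- by move=> x; exact: sqrrD_le2.
- by apply: rintD; exact: rintZ.
Qed.

Lemma L2Z (c : R) g : L2 g -> L2 (fun x => c * g x).
Proof.
move=> [mg ig].
apply: (@L2_bound _ (fun x => c ^+ 2 * g x ^+ 2)).
- exact: measurable_funM.
- by move=> x; rewrite exprMn.
- exact: rintZ.
Qed.

Lemma L2N g : L2 g -> L2 (fun x => - g x).
Proof.
by move=> /(L2Z (-1)) h; under eq_fun do rewrite -mulN1r.
Qed.

Lemma L2B g h : L2 g -> L2 h -> L2 (fun x => g x - h x).
Proof. by move=> lg lh; apply: L2D => //; exact: L2N. Qed.

Lemma L20 : L2 (fun=> 0).
Proof.
split => //; rewrite /rint (_ : _ \o _ = cst 0%E); first exact: integrable0.
by apply/funext => x /=; rewrite expr0n.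
Qed.

Lemma L2_sum I (s : seq I) (F : I -> T -> R) : (forall i, L2 (F i)) ->
  L2 (fun x => \sum_(i <- s) F i x).
Proof.
move=> LF; elim: s => [|i s ih].
  by under eq_fun do rewrite big_nil; exact: L20.
by under eq_fun do rewrite big_cons; exact: L2D.
Qed.

Lemma ipDl g h k : L2 g -> L2 h -> L2 k ->
  ip (fun x => g x + h x) k = ip g k + ip h k.
Proof.
move=> lg lh lk; rewrite -RintegralD//; try exact: L2_mul_integrable.
by apply: eq_Rintegral => x _; rewrite mulrDl.
Qed.

Lemma ipZl (c : R) g h : L2 g -> L2 h -> ip (fun x => c * g x) h = c * ip g h.
Proof.
move=> lg lh; rewrite -RintegralZl//; last exact: L2_mul_integrable.
by apply: eq_Rintegral => x _; rewrite mulrA.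
Qed.

Lemma ipDr g h k : L2 g -> L2 h -> L2 k ->
  ip k (fun x => g x + h x) = ip k g + ip k h.
Proof. by move=> *; rewrite ipC ipDl// !(ipC _ k). Qed.

Lemma ipZr (c : R) g h : L2 g -> L2 h -> ip h (fun x => c * g x) = c * ip h g.
Proof. by move=> *; rewrite ipC ipZl// ipC. Qed.

Lemma ipNl g h : L2 g -> L2 h -> ip (fun x => - g x) h = - ip g h.
Proof.
move=> lg lh; rewrite -mulN1r -ipZl//.
by apply: eq_Rintegral => x _; rewrite mulN1r.
Qed.

Lemma ipBl g h k : L2 g -> L2 h -> L2 k ->
  ip (fun x => g x - h x) k = ip g k - ip h k.
Proof. by move=> lg lh lk; rewrite ipDl ?ipNl//; exact: L2N. Qed.

Lemma ipBr g h k : L2 g -> L2 h -> L2 k ->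
  ip k (fun x => g x - h x) = ip k g - ip k h.
Proof. by move=> *; rewrite ipC ipBl// !(ipC _ k). Qed.

Lemma sqZ (c : R) g : L2 g -> sq (fun x => c * g x) = c ^+ 2 * sq g.
Proof.
by move=> lg; rewrite -!ipE ipZl ?ipZr//; [rewrite mulrA expr2|exact: L2Z].
Qed.

Lemma sqN g : sq (fun x => - g x) = sq g.
Proof. by apply: eq_Rintegral => x _; rewrite sqrrN. Qed.

Lemma sqD g h : L2 g -> L2 h ->
  sq (fun x => g x + h x) = sq g + 2 * ip g h + sq h.
Proof.
move=> lg lh; have lgh := L2D lg lh.
by rewrite -!ipE ipDl// !ipDr// (ipC h g); ring.
Qed.

Lemma sqD_le g h : L2 g -> L2 h ->
  sq (fun x => g x + h x) <= 2 * sq g + 2 * sq h.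
Proof.
move=> lg lh; have lgh := L2B lg lh.
have := sqD lg lh; have := sqD lg (L2N lh); rewrite sqN.
have := sq_ge0 (fun x => g x - h x); rewrite (ipC g (fun x => - h x)) ipNl// (ipC h).
lra.
Qed.

Lemma sqB_le g h : L2 g -> L2 h ->
  sq (fun x => g x - h x) <= 2 * sq g + 2 * sq h.
Proof. by move=> lg lh; rewrite -(sqN h) sqD_le//; exact: L2N. Qed.

Lemma ip_suml (I : Type) (s : seq I) (F : I -> T -> R) g :
  (forall i, L2 (F i)) -> L2 g ->
  ip (fun x => \sum_(i <- s) F i x) g = \sum_(i <- s) ip (F i) g.
Proof.
move=> lF lg; elim: s => [|i s ih].
  rewrite big_nil /ip (_ : (fun x => _) = fun=> 0); first by rewrite Rintegral_cst// mul0r.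
  by apply/funext => x; rewrite big_nil mul0r.
rewrite big_cons -ih -ipDl//; last exact: L2_sum.
by apply: eq_Rintegral => x _; rewrite big_cons.
Qed.

Lemma ip_sumr (I : Type) (s : seq I) (F : I -> T -> R) g :
  (forall i, L2 (F i)) -> L2 g ->
  ip g (fun x => \sum_(i <- s) F i x) = \sum_(i <- s) ip g (F i).
Proof.
by move=> lF lg; rewrite ipC ip_suml//; apply: eq_bigr => i _; rewrite ipC.
Qed.

Lemma ip_sqr_le g h : L2 g -> L2 h -> ip g h ^+ 2 <= sq g * sq h.
Proof.
move=> lg lh.
have poly (t : R) : 0 <= sq g + 2 * t * ip g h + t ^+ 2 * sq h.
  by rewrite -sqZ// -mulrA -(ipZr t lh lg) -sqD ?sq_ge0//; exact: L2Z.
(* if |h| = 0, the nonnegative polynomial is affine, hence constant *)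
have [h0|h0] := eqVneq (sq h) 0.
  rewrite h0 mulr0; have [->|i0] := eqVneq (ip g h) 0; first by rewrite expr0n.
  have := poly (- (sq g + 1) / (2 * ip g h)); rewrite h0 mulr0 addr0.
  have -> : sq g + 2 * (- (sq g + 1) / (2 * ip g h)) * ip g h = -1 by field.
  by lra.
have hp : 0 < sq h by rewrite lt_neqAle eq_sym h0 sq_ge0.
(* the minimum of the polynomial *)
have := poly (- ip g h / sq h).
have -> : sq g + 2 * (- ip g h / sq h) * ip g h + (- ip g h / sq h) ^+ 2 * sq h =
  sq g - ip g h ^+ 2 / sq h by field.
by rewrite subr_ge0 ler_pdivrMr.
Qed.

Lemma L2_sq g h : L2 g -> measurable_fun setT h ->
  (forall x, `|h x| <= `|g x|) -> L2 h.
Proof.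
move=> [mg ig] mh hg; apply: (L2_bound mh _ ig) => x.
by rewrite -[leLHS]real_normK ?num_real// -[leRHS]real_normK ?num_real//
  lerXn2r ?nnegrE.
Qed.

Lemma rint_dom_ae F G : measurable_fun setT F ->
  {ae m, forall x, `|F x| <= G x} -> rint G -> rint F.
Proof.
move=> mF FG /integrableP[mG iG]; apply/integrableP; split.
  exact/measurable_EFinP.
apply: le_lt_trans iG; apply: ae_ge0_le_integral => //.
- by apply: measurableT_comp => //; exact/measurable_EFinP.
- exact: measurableT_comp.
- apply: filterS FG => x FGx _; rewrite /= lee_fin (le_trans FGx)//.
  exact: ler_norm.
Qed.

Lemma le_Rint_ae F G : rint F -> rint G -> {ae m, forall x, F x <= G x} ->
  \int[m]_x F x <= \int[m]_x G x.
Proof.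
move=> iF iG FG; rewrite -subr_ge0 -RintegralB//.
have iGF := rintB iG iF.
have mGF : measurable_fun setT (fun x => G x - F x).
  by case/integrableP : iGF => /measurable_EFinP.
rewrite (_ : (\int[m]_x (G x - F x)) = \int[m]_x `|G x - F x|).
  by apply: Rintegral_ge0.
congr fine; apply: ae_eq_integral => //.
- exact/measurable_EFinP.
- by apply/measurable_EFinP; exact: measurableT_comp.
- by apply: filterS FG => x FGx _; rewrite ger0_norm// subr_ge0.
Qed.

Lemma sq_le_ae G h : rint G -> measurable_fun setT h ->
  {ae m, forall x, h x ^+ 2 <= G x} -> L2 h /\ sq h <= \int[m]_x G x.
Proof.
move=> iG mh hG; have lh : L2 h.
  split => //; apply: (rint_dom_ae _ _ iG); first exact: measurable_funX.
  by apply: filterS hG => x hGx; rewrite ger0_norm ?sqr_ge0.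
by split => //; apply: le_Rint_ae => //; case: lh.
Qed.

Lemma sq_ae_eq g h : measurable_fun setT g -> measurable_fun setT h ->
  {ae m, forall x, g x = h x} -> sq g = sq h.
Proof.
move=> mg mh gh; congr fine; apply: ae_eq_integral => //.
- by apply/measurable_EFinP; exact: measurable_funX.
- by apply/measurable_EFinP; exact: measurable_funX.
- by apply: filterS gh => x ->.
Qed.

Lemma Rint_dom_cvg (F_ : nat -> T -> R) F G :
  (forall k, measurable_fun setT (F_ k)) -> measurable_fun setT F ->
  {ae m, forall x, F_ k x @[k --> \oo] --> F x} ->
  rint G -> {ae m, forall x k, `|F_ k x| <= G x} ->
  (\int[m]_x F_ k x) @[k --> \oo] --> (\int[m]_x F x).
Proof.
move=> mF_ mF F_F iG F_G.
have [] := @dominated_convergence _ _ _ m setT measurableT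
  (fun k => EFin \o F_ k) (EFin \o F) (EFin \o G).
- by move=> k; exact/measurable_EFinP.
- exact/measurable_EFinP.
- by apply: filterS F_F => x F_Fx _; apply: cvg_EFin => //; exact: nearW.
- by [].
- by apply: filterS F_G => x F_Gx k _; rewrite /= lee_fin.
move=> iF _; have iFk k : m.-integrable setT (EFin \o F_ k).
  by apply: (rint_dom_ae _ _ iG) => //; apply: filterS F_G.
move=> h; apply: fine_cvg; rewrite fineK//.
exact: integrable_fin_num.
Qed.

Lemma sq_dom_cvg (h : nat -> T -> R) G :
  (forall k, measurable_fun setT (h k)) ->
  {ae m, forall x, h k x @[k --> \oo] --> 0} ->
  rint G -> {ae m, forall x k, h k x ^+ 2 <= G x} ->
  sq (h k) @[k --> \oo] --> 0.
Proof.
move=> mh h0 iG hG; rewrite (_ : 0 = \int[m]_x (fun=> 0) x); last first.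
  by rewrite Rintegral_cst// mul0r.
apply: (Rint_dom_cvg (G := G)) => //.
- by move=> k; exact: measurable_funX.
- apply: filterS h0 => x h0; rewrite -[X in _ --> X](mulr0 (0 : R)).
  by under eq_cvg do rewrite expr2; exact: cvgM.
- by apply: filterS hG => x hG k; rewrite ger0_norm ?sqr_ge0.
Qed.

(** The series of the functions 4^k h_k^2 has integral at most the sum of the 2^-k, so
    it is finite almost everywhere, and it dominates each of its terms. *)
Lemma fast_domination (h : nat -> T -> R) :
  (forall k, L2 (h k)) -> (forall k, sq (h k) <= 8^-1 ^+ k) ->
  exists H, [/\ forall x, 0 <= H x, rint H &
    {ae m, forall x k, 4 ^+ k * h k x ^+ 2 <= H x}].
Proof.
move=> lh hk.
pose S x := (\sum_(k <oo) (4 ^+ k * h k x ^+ 2)%:E)%E.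
have nn k x : (0 <= (4 ^+ k * h k x ^+ 2)%:E)%E.
  by rewrite lee_fin mulr_ge0 ?sqr_ge0// exprn_ge0.
have mt k : measurable_fun setT (fun x => (4 ^+ k * h k x ^+ 2)%:E).
  apply/measurable_EFinP; apply: measurable_funM => //.
  by apply: measurable_funX; case: (lh k).
have mS : measurable_fun setT S by exact: ge0_emeasurable_sum.
have S0 x : (0 <= S x)%E by apply: nneseries_ge0 => k _ _; exact: nn.
have iS : m.-integrable setT S.
  apply/integrableP; split => //.
  under eq_integral => x _ do rewrite gee0_abs//.
  rewrite integral_nneseries//.
  apply: (@le_lt_trans _ _ (\sum_(k <oo) (2^-1 ^+ k)%:E)%E); last first.
    rewrite (_ : (fun n : nat => _) =
        EFin \o (series (geometric 1 (2^-1 : R)))); last first.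
      apply/funext => n /=; rewrite sumEFin /series /=.
      by congr EFin; apply: eq_bigr => i _; rewrite mul1r.
    rewrite EFin_lim ?ltry//; apply/cvg_ex; eexists.
    by apply: cvg_geometric_series; rewrite ger0_norm// invf_lt1// ltr1n.
  apply: lee_nneseries => [k _ _|k _]; first by apply: integral_ge0 => x _; exact: nn.
  rewrite (_ : (\int[m]_x _)%E = (4 ^+ k * sq (h k))%:E); last first.
    rewrite /sq -RintegralZl//; last by case: (lh k).
    rewrite /Rintegral fineK//; apply: integrable_fin_num => //.
    by apply: rintZ; case: (lh k).
  rewrite lee_fin (_ : 2^-1 = 4 * 8^-1 :> R); last by field.
  by rewrite exprMn ler_pM2l// exprn_gt0.
have Sfin := integrable_ae measurableT iS.
exists (fun x => fine (S x)); split.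
- by move=> x; rewrite fine_ge0.
- apply/integrableP; split.
    by apply/measurable_EFinP; apply: measurableT_comp.
  case/integrableP : iS => _; apply: le_lt_trans; apply: ae_ge0_le_integral => //.
  + do 2 apply: measurableT_comp => //; exact: measurableT_comp.
  + exact: measurableT_comp.
  + by apply: filterS Sfin => x /(_ I) fS _; rewrite /= -[in leRHS](fineK fS).
- apply: filterS Sfin => x /(_ I) fS k; rewrite -lee_fin fineK//.
  have := @nneseries_lim_ge R (fun k => (4 ^+ k * h k x ^+ 2)%:E) xpredT 0%N k.+1.
  move=> /(_ (fun i _ _ => nn i x)); apply: le_trans.
  rewrite big_mkord big_ord_recr/= leeDr//; apply: sume_ge0 => i _; exact: nn.
Qed.

(** Provides the pointwise limit and the integrable bound that dominated convergence
    requires, without extracting subsequences. *)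
Lemma fast_cvg (h : nat -> T -> R) :
  (forall k, L2 (h k)) -> (forall k, sq (h k) <= 8^-1 ^+ k) ->
  exists H, [/\ rint H, {ae m, forall x k, h k x ^+ 2 <= H x} &
    {ae m, forall x, h k x @[k --> \oo] --> 0}].
Proof.
move=> lh hk; have [H [H0 iH Hae]] := fast_domination lh hk.
exists H; split => //; apply: filterS Hae => x hx.
  move=> k; apply: le_trans (hx k); rewrite ler_peMl ?sqr_ge0//.
  by rewrite exprn_ege1// ler1n.
have hb k : `|h k x| <= Num.sqrt (H x) * 2^-1 ^+ k.
  rewrite exprVn ler_pdivlMr ?exprn_gt0// -ler_sqr ?nnegrE ?sqrtr_ge0 ?mulr_ge0 ?exprn_ge0//.
  rewrite sqr_sqrtr// exprMn real_normK ?num_real// mulrC -exprM mulnC exprM.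
  by have := hx k; rewrite (_ : 2 ^+ 2 = 4 :> R)//; ring.
have c0 : (Num.sqrt (H x) * 2^-1 ^+ k) @[k --> \oo] --> 0.
  rewrite -[X in _ --> X](mulr0 (Num.sqrt (H x))); apply: cvgM; first exact: cvg_cst.
  by apply: cvg_expr; rewrite ger0_norm ?invr_ge0// invf_lt1// ltr1n.
apply: norm_cvg0; apply: (squeeze_cvgr _ (cvg_cst 0) c0).
by apply: nearW => k; rewrite normr_ge0 hb.
Qed.

(** The bound of [fast_domination] on the increments makes g_k Cauchy almost everywhere
    with a geometric rate; the upper limit is a measurable choice of the limit. *)
Lemma L2_complete (g : nat -> T -> R) : (forall k, L2 (g k)) ->
  (forall k, sq (fun x => g k.+1 x - g k x) <= 8^-1 ^+ k) ->
  exists l, L2 l /\ sq (fun x => g k x - l x) @[k --> \oo] --> 0.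
Proof.
move=> lg gk.
have [H [H0 iH Hae]] := fast_domination (fun k => L2B (lg k.+1) (lg k)) gk.
pose l x := fine (limn_esup (fun k => (g k x)%:E)).
have ml : measurable_fun setT l.
  apply: measurableT_comp => //; apply: measurable_fun_limn_esup => k.
  by apply/measurable_EFinP; case: (lg k).
have gl : {ae m, forall x, g k x @[k --> \oo] --> l x /\
    forall k, (g k x - l x) ^+ 2 <= 4 * H x * 4^-1 ^+ k}.
  apply: filterS Hae => x Hx.
  have /geometric_cauchy[y [gy yb]] k :
      `|g k.+1 x - g k x| <= Num.sqrt (H x) * 2^-1 ^+ k.
    rewrite -ler_sqr ?nnegrE ?mulr_ge0 ?sqrtr_ge0 ?exprn_ge0// real_normK ?num_real//.
    rewrite exprMn sqr_sqrtr// exprAC (_ : 2^-1 ^+ 2 = 4^-1); last by field.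
    by rewrite exprVn ler_pdivlMr ?exprn_gt0// mulrC.
  have -> : l x = y.
    rewrite /l; suff /cvg_limn_einf_sup[_ ->] : (g k x)%:E @[k --> \oo] --> y%:E.
      by [].
    by apply: cvg_EFin => //; exact: nearW.
  split => // k; have := yb k.
  rewrite -ler_sqr ?nnegrE ?mulr_ge0 ?sqrtr_ge0 ?exprn_ge0// real_normK ?num_real//.
  rewrite !exprMn sqr_sqrtr// exprAC (_ : 2^-1 ^+ 2 = 4^-1); last by field.
  by rewrite (_ : 2 ^+ 2 = 4)//; ring.
have iH' k : rint (fun x => 4 * H x * 4^-1 ^+ k).
  by under eq_fun do rewrite mulrC mulrA; exact: rintZ.
have lgl k : L2 (fun x => g k x - l x) /\
    sq (fun x => g k x - l x) <= \int[m]_x (4 * H x * 4^-1 ^+ k).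
  apply: sq_le_ae => //; first by apply: measurable_funB => //; case: (lg k).
  by apply: filterS gl => x [_ /(_ k)].
exists l; split.
  rewrite (_ : l = fun x => g 0%N x - (g 0%N x - l x)); last first.
    by apply/funext => x; rewrite subKr.
  by apply: L2B => //; case: (lgl 0%N).
apply: (@squeeze_cvgr _ _ _ _ (fun=> 0) (fun k => \int[m]_x (4 * H x * 4^-1 ^+ k))).
- by apply: nearW => k; rewrite sq_ge0/=; case: (lgl k).
- exact: cvg_cst.
- rewrite (_ : (fun k => _) = fun k => 4^-1 ^+ k * 4 * \int[m]_x H x).
  2: by apply/funext => k; rewrite -RintegralZl//; apply: eq_Rintegral => x _; ring.
  rewrite -[X in _ --> X](mul0r (\int[m]_x H x)); apply: cvgM; last exact: cvg_cst.
  rewrite -[X in _ --> X](mul0r (4 : R)); apply: cvgM; last exact: cvg_cst.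
  by apply: cvg_expr; rewrite ger0_norm// invf_lt1// ltr1n.
Qed.

Lemma ip_cvg (g : nat -> T -> R) l h : (forall k, L2 (g k)) -> L2 l -> L2 h ->
  sq (fun x => g k x - l x) @[k --> \oo] --> 0 ->
  ip (g k) h @[k --> \oo] --> ip l h.
Proof.
move=> lg ll lh gl; apply/cvgrPdist_lt => e e0.
have e' : 0 < e ^+ 2 / (sq h + 1).
  by rewrite divr_gt0 ?exprn_gt0// ltr_wpDl// sq_ge0.
move/cvgrPdist_lt : gl => /(_ _ e'); apply: filterS => k.
rewrite sub0r normrN ger0_norm ?sq_ge0// ltr_pdivlMr ?ltr_wpDl ?sq_ge0// => ke.
rewrite distrC -ipBl// -ltr_sqr ?nnegrE ?(ltW e0)// real_normK ?num_real//.
apply: le_lt_trans (ip_sqr_le (L2B (lg k) ll) lh) _; apply: le_lt_trans ke.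
by rewrite ler_wpM2l ?sq_ge0// lerDl.
Qed.

Lemma sq_cvg (g : nat -> T -> R) l : (forall k, L2 (g k)) -> L2 l ->
  sq (fun x => g k x - l x) @[k --> \oo] --> 0 ->
  sq (g k) @[k --> \oo] --> sq l.
Proof.
move=> lg ll gl.
have -> : (fun k => sq (g k)) =
    (fun k => sq (fun x => g k x - l x) + (2 * ip (g k) l - sq l)).
  apply/funext => k; have lk := lg k.
  have -> : sq (g k) = sq (fun x => (g k x - l x) + l x).
    by apply: eq_Rintegral => x _; rewrite subrK.
  rewrite sqD//; last exact: L2B.
  by rewrite ipBl// ipE; ring.
rewrite -[X in _ --> X]add0r; apply: cvgD => //.
have -> : nbhs (sq l) = nbhs (2 * ip l l - sq l) by congr nbhs; rewrite ipE; ring.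
apply: cvgB; last exact: cvg_cst.
by apply: cvgM; [exact: cvg_cst|exact: ip_cvg].
Qed.

(** S is only a linear subspace, and L is bounded on it. A minimizing sequence of |g|^2
    - 2 L g over S is Cauchy by the parallelogram identity, and the first variation at
    its limit G vanishes. That G is a limit of elements of S is recorded because it
    yields the density of test functions. *)
Theorem riesz_subspace (S : set (T -> R)) (L : (T -> R) -> R) (C : R) :
  S (fun=> 0) ->
  (forall g h, S g -> S h -> S (fun x => g x + h x)) ->
  (forall c g, S g -> S (fun x => c * g x)) ->
  (forall g, S g -> L2 g) ->
  (forall g h, S g -> S h -> L (fun x => g x + h x) = L g + L h) ->
  (forall c g, S g -> L (fun x => c * g x) = c * L g) ->
  (forall g, S g -> L g ^+ 2 <= C * sq g) ->
  exists G, [/\ L2 G, forall h, S h -> ip G h = L h &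
    exists p : nat -> T -> R, (forall k, S (p k)) /\
      sq (fun x => p k x - G x) @[k --> \oo] --> 0].
Proof.
move=> S0 SD SZ SL LD LZ LC.
pose J g := sq g - 2 * L g.
have JC g : S g -> - `|C| <= J g.
  move=> Sg; rewrite /J; have := LC _ Sg; have := sq_ge0 g.
  move: (sq g) (L g) => s t s0 tC.
  have {}tC : t ^+ 2 <= `|C| * s by apply: le_trans tC _; rewrite ler_wpM2r// ler_norm.
  have := normr_ge0 C; move: `|C| tC => c tC c0.
  rewrite -subr_ge0 opprK; suff : 2 * t <= s + c by lra.
  rewrite leNgt; apply/negP => h.
  have : (s + c) ^+ 2 < (2 * t) ^+ 2 by rewrite ltrXn2r ?nnegrE ?addr_ge0// (le_trans _ (ltW h)) ?addr_ge0.
  have := sqr_ge0 (s - c); rewrite !expr2; nra.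
have hasinf : has_inf (J @` S).
  split; first by exists (J (fun=> 0)); exists (fun=> 0).
  by exists (- `|C|) => _ [g Sg <-]; exact: JC.
pose I := inf (J @` S).
have IJ g : S g -> I <= J g by move=> Sg; apply: (inf_lbound hasinf.2); exists g.
have /choice[p pP] (k : nat) : exists g, S g /\ J g <= I + 4^-1 * 8^-1 ^+ k.
  have : 0 < 4^-1 * 8^-1 ^+ k :> R by rewrite mulr_gt0// exprn_gt0.
  by move=> /(inf_adherent) /(_ hasinf)[_ [g Sg <-] /ltW]; exists g.
have Sp k : S (p k) by case: (pP k).
have lp k : L2 (p k) by exact: SL.
(* the midpoint of p (k + 1) and p k is a competitor in S *)
have [|G [lG pG]] := @L2_complete p lp.
  move=> k; have la := lp k.+1; have lb := lp k.
  have Sm : S (fun x => 2^-1 * (p k.+1 x + p k x)) by apply: SZ; exact: SD.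
  have := IJ _ Sm; rewrite /J sqZ ?LZ ?LD//; [|exact: SD|exact: L2D].
  rewrite sqD//; have [_] := pP k; have [_] := pP k.+1; rewrite /J exprS.
  rewrite (_ : sq (fun x => _ - _) = sq (p k.+1) - 2 * ip (p k.+1) (p k) + sq (p k)).
    rewrite (_ : (2^-1) ^+ 2 = 4^-1 :> R); last by field.
    have : 0 <= 8^-1 ^+ k :> R by rewrite exprn_ge0.
    by lra.
  by rewrite sqD// ?sqN; [rewrite (ipC (p k.+1) (fun x => - _)) ipNl// (ipC (p k)); ring|exact: L2N].
exists G; split=> //; last by exists p.
move=> h Sh; have lh := SL _ Sh.
(* the first variation of the functional at G in the direction h *)
have key t : 0 <= 2 * t * (ip G h - L h) + t ^+ 2 * sq h.
  suff : I <= I + (2 * t * (ip G h - L h) + t ^+ 2 * sq h) by lra.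
  have cv : (I + 4^-1 * 8^-1 ^+ k + (2 * t * (ip (p k) h - L h) + t ^+ 2 * sq h))
      @[k --> \oo] --> I + 4^-1 * 0 + (2 * t * (ip G h - L h) + t ^+ 2 * sq h).
    apply: cvgD.
      apply: cvgD; first exact: cvg_cst.
      apply: cvgM; first exact: cvg_cst.
      by apply: cvg_expr; rewrite ger0_norm// invf_lt1// ltr1n.
    apply: cvgD; last exact: cvg_cst.
    apply: cvgM; first exact: cvg_cst.
    by apply: cvgB; [exact: ip_cvg|exact: cvg_cst].
  rewrite mulr0 addr0 in cv.
  rewrite -(cvg_lim _ cv)//; apply: limr_ge; first by apply/cvg_ex; eexists; exact: cv.
  apply: nearW => k.
  have Sth : S (fun x => p k x + t * h x) by apply: SD => //; exact: SZ.
  have := IJ _ Sth; rewrite /J LD// ?LZ//; last exact: SZ.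
  have := (pP k).2; rewrite /J sqD ?sqZ ?ipZr//; last exact: L2Z.
  by rewrite mulrA; lra.
apply/eqP; rewrite -subr_eq0; apply/eqP; move: (ip G h - L h) key => a key.
(* a step that makes the right-hand side negative unless a = 0 *)
have := key (- a / (sq h + 1)); have h0 := sq_ge0 h; have h1 : sq h + 1 != 0 by rewrite gt_eqF// ltr_wpDl.
have -> : 2 * (- a / (sq h + 1)) * a + (- a / (sq h + 1)) ^+ 2 * sq h =
  - (a ^+ 2 * (sq h + 2)) / (sq h + 1) ^+ 2 by field.
rewrite pmulr_lge0 ?invr_gt0 ?exprn_gt0 ?ltr_wpDl// oppr_ge0 pmulr_lle0 ?ltr_wpDl//.
by move=> a2; apply/eqP; rewrite -sqrf_eq0 eq_le a2 sqr_ge0.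
Qed.

End L2.

Lemma Lfun_L2 d (T : measurableType d) (R : realType) (m : {measure set T -> \bar R})
    (g : T -> R) : g \in Lfun m 2%:E <-> L2 m g.
Proof.
split=> [lg|[mg /integrableP[_ ig]]].
  split; last exact: Lfun2_integrable_sqr.
  by move: lg; rewrite inE => /andP[]; rewrite inE.
rewrite inE; apply/andP; split; rewrite inE//=.
rewrite /finite_norm unlock poweR_lty//; apply: le_lt_trans ig.
rewrite le_eqVlt; apply/orP; left; apply/eqP; apply: eq_integral => x _ /=.
by rewrite normrX powR_mulrn.
Qed.

(** * Lebesgue measure on boxes and affine changes of variables *)

(** When x = y = oo, both sides equal oo - oo = -oo. *)
Lemma gt0_muleBr (R : realType) (c : R) (x y : \bar R) : 0 < c ->
  (0 <= x)%E -> (0 <= y)%E -> (c%:E * (x - y) = c%:E * x - c%:E * y)%E.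
Proof.
move=> c0; move: x y => [x| |] [y| |] //= _ _.
- by congr EFin; rewrite mulrDr mulrN.
- by rewrite gt0_muley ?lte_fin// addeNy gt0_muleNy ?lte_fin.
- by rewrite gt0_muley ?lte_fin// !addye// gt0_muley ?lte_fin.
- by rewrite gt0_muley ?lte_fin// !addeNy gt0_muleNy ?lte_fin.
Qed.

Lemma gt0_integralZ d (T : measurableType d) (R : realType)
    (m : {measure set T -> \bar R}) (c : R) (g : T -> \bar R) : 0 < c ->
  measurable_fun setT g -> (\int[m]_x (c%:E * g x) = c%:E * \int[m]_x g x)%E.
Proof.
move=> c0 mg; rewrite integralE [X in _ = (_ * X)%E]integralE.
have c0' : (0 <= c%:E)%E by rewrite lee_fin ltW.
rewrite (_ : (fun x => c%:E * g x)^\+%E = (fun x => c%:E * g^\+ x)%E); last first.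
  by apply/funext => x; rewrite !funeposE maxeMr ?mule0.
rewrite (_ : (fun x => c%:E * g x)^\-%E = (fun x => c%:E * g^\- x)%E); last first.
  by apply/funext => x; rewrite !funenegE maxeMr// mule0 muleN.
rewrite !ge0_integralZl//; [|exact: measurable_funeneg|exact: measurable_funepos].
have i1 := @integral_ge0 _ _ R m setT g^\+%E (fun x _ => funepos_ge0 g x).
have i2 := @integral_ge0 _ _ R m setT g^\-%E (fun x _ => funeneg_ge0 g x).
exact: esym (gt0_muleBr c0 i1 i2).
Qed.

Section rV.
Context {R : realType}.

Lemma measurable_coord n (i : 'I_n) :
  measurable_fun setT (fun x : 'rV[R]_n => x ord0 i).
Proof.
move=> _ A mA; rewrite setTI; apply: sub_sigma_algebra.
rewrite -bigcup_seq; exists i; first exact: mem_index_enum.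
by exists A => //; rewrite setTI.
Qed.

Lemma rV_norm_lt n (x : 'rV[R]_n) (e : R) : 0 < e ->
  `|x| < e <-> (forall i, `|x ord0 i| < e).
Proof.
move=> e0; rewrite [`|x|]mx_normrE; split=> [h i|h].
  by apply: le_lt_trans h; exact: (le_bigmax _ (fun ij => `|x ij.1 ij.2|) (ord0, i)).
by apply: bigmax_lt => // -[i j] _ /=; rewrite (ord1 i).
Qed.

Lemma coord_le_norm n (x : 'rV[R]_n) i : `|x ord0 i| <= `|x|.
Proof.
rewrite [`|x|]mx_normrE.
exact: (le_bigmax _ (fun ij => `|x ij.1 ij.2|) (ord0, i)).
Qed.

Definition obox n (a b : 'rV[R]_n) : set 'rV[R]_n :=
  [set x | forall i, a ord0 i < x ord0 i < b ord0 i].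

Lemma oboxE n (a b : 'rV[R]_n) :
  obox a b = \bigcap_(i in [set: 'I_n]) [set x | x ord0 i \in `]a ord0 i, b ord0 i[].
Proof.
by apply/seteqP; split=> x h i; [move=> _ /=; rewrite in_itv/= h|
  have /= := h i I; rewrite in_itv].
Qed.

Lemma measurable_obox n (a b : 'rV[R]_n) : measurable (obox a b).
Proof.
rewrite oboxE; apply: fin_bigcap_measurable => // i _.
have := @measurable_coord n i measurableT _ (measurable_itv `]a ord0 i, b ord0 i[).
by rewrite setTI.
Qed.

Lemma obox_setI n (a b c d : 'rV[R]_n) : obox a b `&` obox c d =
  obox (\row_i Num.max (a ord0 i) (c ord0 i)) (\row_i Num.min (b ord0 i) (d ord0 i)).
Proof.
apply/seteqP; split=> x.
  by move=> [ab cd] i; rewrite !mxE gt_max lt_min; move: (ab i) (cd i) => /andP[-> ->] /andP[-> ->].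
by move=> h; split=> i; have := h i; rewrite !mxE gt_max lt_min => /andP[/andP[? ?] /andP[? ?]];
  apply/andP.
Qed.

Lemma lebesgue_obox n (a b : 'rV[R]_n) : (forall i, a ord0 i <= b ord0 i) ->
  lebesgue_rV n (obox a b) = (\prod_i (b ord0 i - a ord0 i))%:E.
Proof.
elim: n a b => [|n ih] a b ab.
  by rewrite big_ord0 /= diracE mem_set// => -[].
rewrite /= /lebesgue_rVS /pushforward.
pose a' : 'rV[R]_n := \row_j a ord0 (lift ord0 j).
pose b' : 'rV[R]_n := \row_j b ord0 (lift ord0 j).
have -> : @rV_cons R n @^-1` obox a b =
    obox a' b' `*` [set` `]a ord0 ord0, b ord0 ord0[].
  apply/seteqP; split=> -[x t] /=.
    move=> h; split.
      by move=> j; have := h (lift ord0 j); rewrite !mxE liftK.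
    by have := h ord0; rewrite !mxE unlift_none/= in_itv.
  move=> [h]; rewrite in_itv/= => t0 i; rewrite !mxE.
  by case: unliftP => [j ->|->]//=; have := h j; rewrite !mxE.
rewrite product_measure1E//; last exact: measurable_obox.
rewrite ih => [|j]; last by rewrite !mxE.
rewrite [X in (_ * X)%E](lebesgue_measure_itv `]a ord0 ord0, b ord0 ord0[).
rewrite /= lte_fin big_ord_recl.
under eq_bigr do rewrite !mxE.
case: ltP => ab0; first by rewrite -EFinB -EFinM mulrC.
have -> : b ord0 ord0 - a ord0 ord0 = 0.
  by apply/eqP; rewrite subr_eq0 eq_le ab0 ab.
by rewrite mule0 mul0r.
Qed.

Lemma lebesgue_obox_lty n (a b : 'rV[R]_n) : (lebesgue_rV n (obox a b) < +oo)%E.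
Proof.
have [ab|/existsNP[i /negP ab]] := pselect (forall i, a ord0 i <= b ord0 i).
  by rewrite lebesgue_obox// ltry.
rewrite (_ : obox a b = set0) ?measure0//.
apply/seteqP; split => // x /(_ i) /andP[h1 h2].
by move: ab; rewrite (ltW (lt_trans h1 h2)).
Qed.

Definition boxes n : set (set 'rV[R]_n) :=
  [set A | exists ab : 'rV[R]_n * 'rV[R]_n, A = obox ab.1 ab.2].

Definition cube n (k : R) : set 'rV[R]_n := obox (const_mx (- k)) (const_mx k).

Lemma cubeP n (k : R) (x : 'rV[R]_n) : cube k x <-> forall i, `|x ord0 i| < k.
Proof.
by split=> h i; have := h i; rewrite ?mxE ltr_norml ?mxE.
Qed.

Lemma bigcup_cube n : \bigcup_k cube k%:R = [set: 'rV[R]_n].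
Proof.
apply/seteqP; split => // x _; exists (Num.bound `|x|) => //.
apply/cubeP => i; apply: le_lt_trans (coord_le_norm x i) _.
exact: archi_boundP.
Qed.

Lemma measurable_boxes n : @measurable _ 'rV[R]_n = <<s @boxes n >>.
Proof.
apply/seteqP; split; last first.
  apply: smallest_sub; first exact: sigma_algebra_measurable.
  by move=> _ [ab ->]; exact: measurable_obox.
apply: smallest_sub; first exact: smallest_sigma_algebra.
rewrite -bigcup_seq => A [i _ [B mB <-]]; rewrite setTI.
have : measurable_fun (setT : set (g_sigma_algebraType (@boxes n))) (fun x : 'rV[R]_n => x ord0 i).
  apply: (measurability _ (RGenOpens.measurableE R)) => // _ [_ [a [b ->]] <-].
  rewrite setTI (_ : _ @^-1` _ = \bigcup_k obox
      (\row_j if j == i then a else - k%:R) (\row_j if j == i then b else k%:R)).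
    by apply: bigcup_measurable => k _; apply: sub_sigma_algebra; eexists (_, _).
  apply/seteqP; split=> x /=; rewrite in_itv/=.
    move=> axb; have := @bigcup_cube n => /seteqP[_ /(_ x I)][k _ /cubeP kx].
    exists k => // j; rewrite !mxE; case: eqP => [->//|_].
    by rewrite -ltr_norml.
  by move=> [k _ /(_ i)]; rewrite !mxE eqxx.
by move=> /(_ measurableT _ mB); rewrite setTI.
Qed.

Lemma boxes_setI n : setI_closed (@boxes n).
Proof. by move=> _ _ [ab ->] [cd ->]; rewrite obox_setI; eexists (_, _). Qed.

Lemma measure_unique_boxes n (m1 m2 : {measure set 'rV[R]_n -> \bar R}) :
  (forall a b, m1 (obox a b) = m2 (obox a b)) ->
  (forall a b, (m1 (obox a b) < +oo)%E) ->
  forall A, measurable A -> m1 A = m2 A.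
Proof.
move=> m12 m1oo; apply: (measure_unique (@boxes n) (fun k => @cube n k%:R)).
- exact: measurable_boxes.
- exact: boxes_setI.
- by move=> k; eexists (_, _).
- exact: bigcup_cube.
- by move=> _ [ab ->].
- by move=> k; exact: m1oo.
Qed.

Lemma lebesgue_sigma_finite n : sigma_finite setT (@lebesgue_rV R n).
Proof.
exists (fun k => @cube n k%:R); first by rewrite bigcup_cube.
by move=> k; split; [exact: measurable_obox|exact: lebesgue_obox_lty].
Qed.

End rV.

Section leb.
Context {R : realType} (n : nat).

(** The same measure under a name that carries its sigma-finite structure, which the
    theorems on product measures take from the term. *)
Definition leb : set 'rV[R]_n -> \bar R := lebesgue_rV n.

HB.instance Definition _ := Measure.copy leb (@lebesgue_rV R n).
HB.instance Definition _ := Measure_isSigmaFinite.Build _ _ _ leb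
  (@lebesgue_sigma_finite R n).

End leb.

Section invariance.
Context {R : realType} (n : nat).
Local Notation mu := (@lebesgue_rV R n).

Lemma measurable_funTP d1 d2 (T1 : measurableType d1) (T2 : measurableType d2)
  (f : T1 -> T2) A : measurable_fun setT f -> measurable A ->
  measurable (f @^-1` A).
Proof. by move=> mf mA; rewrite -[X in measurable X]setTI; exact: mf. Qed.

(** Translations, dilations, reflections and permutations of coordinates all multiply
    volumes by a constant, and it is enough to see this on boxes. *)
Definition scales_boxes (h : 'rV[R]_n -> 'rV[R]_n) (c : R) :=
  forall a b : 'rV[R]_n, (forall i, a ord0 i <= b ord0 i) ->
  mu (h @^-1` obox a b) = (c * \prod_i (b ord0 i - a ord0 i))%:E.

(** Both sides are measures in A, and boxes form a family stable under intersection that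
    generates the sigma-algebra. *)
Lemma scales_boxes_measure (h : 'rV[R]_n -> 'rV[R]_n) (c : R) : 0 <= c ->
  measurable_fun setT h -> scales_boxes h c ->
  forall A, measurable A -> mu (h @^-1` A) = (c%:E * mu A)%E.
Proof.
move=> c0 mh hc A mA.
pose H1 := isMeasurableFun.Build _ _ _ _ h mh.
pose hm : {mfun _ >-> _} := HB.pack h H1.
apply: (@measure_unique_boxes R n (pushforward mu hm) (mscale (NngNum c0) mu)) => //.
- move=> a b; rewrite /= /mscale/= /pushforward/=.
  have [ab|/existsNP[i /negP ab]] := pselect (forall i, a ord0 i <= b ord0 i).
    by rewrite hc// lebesgue_obox// EFinM.
  have -> : obox a b = set0.
    apply/seteqP; split => // x /(_ i) /andP[h1 h2].
    by move: ab; rewrite (ltW (lt_trans h1 h2)).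
  by rewrite preimage_set0 !measure0 mule0.
- move=> a b; rewrite /= /pushforward/=.
  have [ab|/existsNP[i /negP ab]] := pselect (forall i, a ord0 i <= b ord0 i).
    by rewrite hc// ltry.
  have -> : obox a b = set0.
    apply/seteqP; split => // x /(_ i) /andP[h1 h2].
    by move: ab; rewrite (ltW (lt_trans h1 h2)).
  by rewrite preimage_set0 measure0.
Qed.

Lemma ge0_integral_scales (h : 'rV[R]_n -> 'rV[R]_n) (c : R) : 0 <= c ->
  measurable_fun setT h -> scales_boxes h c ->
  forall g : 'rV[R]_n -> \bar R, measurable_fun setT g ->
  (forall x, (0 <= g x)%E) ->
  (\int[mu]_x g (h x) = c%:E * \int[mu]_x g x)%E.
Proof.
move=> c0 mh hc g mg g0.
pose H1 := isMeasurableFun.Build _ _ _ _ h mh.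
pose hm : {mfun _ >-> _} := HB.pack h H1.
rewrite -[RHS](@ge0_integral_mscale _ _ R mu setT measurableT (NngNum c0))//.
rewrite -[LHS](@ge0_integral_pushforward _ _ _ _ R hm _ mu setT)//.
apply: eq_measure_integral => A mA _.
by rewrite /= /mscale/=; exact: scales_boxes_measure.
Qed.

(** Stated for extended-real integrals of functions of any sign, so that it applies to a
    convolution at every point, convergent or not. *)
Lemma integral_scales (h : 'rV[R]_n -> 'rV[R]_n) (c : R) : 0 < c ->
  measurable_fun setT h -> scales_boxes h c ->
  forall g : 'rV[R]_n -> \bar R, measurable_fun setT g ->
  (\int[mu]_x g (h x) = c%:E * \int[mu]_x g x)%E.
Proof.
move=> c0 mh hc g mg.
rewrite integralE [X in _ = (_ * X)%E]integralE.
rewrite (_ : (fun x => g (h x))^\+%E = g^\+%E \o h); last first.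
  by apply/funext => x; rewrite /= !funeposE.
rewrite (_ : (fun x => g (h x))^\-%E = g^\-%E \o h); last first.
  by apply/funext => x; rewrite /= !funenegE.
rewrite (ge0_integral_scales (ltW c0) mh hc (measurable_funepos mg))//.
rewrite (ge0_integral_scales (ltW c0) mh hc (measurable_funeneg mg))//.
have i1 := @integral_ge0 _ _ R mu setT g^\+%E (fun x _ => funepos_ge0 g x).
have i2 := @integral_ge0 _ _ R mu setT g^\-%E (fun x _ => funeneg_ge0 g x).
exact: esym (gt0_muleBr c0 i1 i2).
Qed.

Lemma box_prod_scale (a b : 'rV[R]_n) (c : R) :
  \prod_i (c * (b ord0 i - a ord0 i)) = c ^+ n * \prod_i (b ord0 i - a ord0 i).
Proof. by rewrite big_split/= prodr_const card_ord. Qed.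

Lemma scales_boxes_shift (v : 'rV[R]_n) : scales_boxes (fun x => x + v) 1.
Proof.
move=> a b ab; rewrite mul1r.
rewrite (_ : _ @^-1` _ = obox (a - v) (b - v)); last first.
  by apply/seteqP; split=> x h i; have := h i; rewrite /= !mxE ltrBlDr ltrBrDr.
rewrite lebesgue_obox => [|i]; last by rewrite !mxE lerB.
by congr EFin; apply: eq_bigr => i _; rewrite !mxE opprB addrA subrK.
Qed.

Lemma scales_boxes_scale (e : R) : 0 < e -> scales_boxes (fun x => e *: x) (e ^- n).
Proof.
move=> e0 a b ab.
rewrite (_ : _ @^-1` _ = obox (e^-1 *: a) (e^-1 *: b)); last first.
  apply/seteqP; split=> x h i; have := h i; rewrite /= !mxE.
    by rewrite ltr_pdivrMl// ltr_pdivlMl.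
  by rewrite ltr_pdivrMl// ltr_pdivlMl.
rewrite lebesgue_obox => [|i]; last by rewrite !mxE ler_pM2l ?invr_gt0.
rewrite -exprVn -box_prod_scale; congr EFin; apply: eq_bigr => i _.
by rewrite !mxE mulrBr.
Qed.

Lemma scales_boxes_swap (s : {perm 'I_n}) : scales_boxes (col_perm s) 1.
Proof.
move=> a b ab; rewrite mul1r.
rewrite (_ : _ @^-1` _ = obox (col_perm s^-1%g a) (col_perm s^-1%g b)); last first.
  apply/seteqP; split=> x h i.
    by have := h (s^-1%g i); rewrite !mxE permKV.
  by have := h (s i); rewrite !mxE permK.
rewrite lebesgue_obox => [|i]; last by rewrite !mxE.
rewrite (reindex_inj (@perm_inj _ s)); congr EFin; apply: eq_bigr => i _.
by rewrite !mxE permK.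
Qed.

Definition reflect_coord (i : 'I_n) (x : 'rV[R]_n) : 'rV[R]_n :=
  \row_j if j == i then - x ord0 j else x ord0 j.

Lemma scales_boxes_reflect (i : 'I_n) : scales_boxes (reflect_coord i) 1.
Proof.
move=> a b ab; rewrite mul1r.
rewrite (_ : _ @^-1` _ = obox (\row_j if j == i then - b ord0 j else a ord0 j)
   (\row_j if j == i then - a ord0 j else b ord0 j)); last first.
  apply/seteqP; split=> x h j; have := h j; rewrite /= !mxE; case: eqP => // _.
    by rewrite ltrNr ltrNl andbC.
  by rewrite ltrNr ltrNl andbC.
rewrite lebesgue_obox => [|j]; last by rewrite !mxE; case: eqP; rewrite ?lerN2.
congr EFin; apply: eq_bigr => j _; rewrite !mxE; case: eqP => // _.
by rewrite opprK addrC.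
Qed.

Lemma measurable_rVD d (T : measurableType d) (f g : T -> 'rV[R]_n) :
  measurable_fun setT f -> measurable_fun setT g ->
  measurable_fun setT (fun x => f x + g x).
Proof.
move=> mf mg; apply: measurable_fun_rVP => i; under eq_fun do rewrite mxE.
by apply: measurable_funD; exact: (measurableT_comp (measurable_coord i)).
Qed.

Lemma measurable_rVZ d (T : measurableType d) (f : T -> 'rV[R]_n) (g : T -> R) :
  measurable_fun setT f -> measurable_fun setT g ->
  measurable_fun setT (fun x => g x *: f x).
Proof.
move=> mf mg; apply: measurable_fun_rVP => i; under eq_fun do rewrite mxE.
by apply: measurable_funM => //; exact: (measurableT_comp (measurable_coord i)).
Qed.

Lemma measurable_rVN d (T : measurableType d) (f : T -> 'rV[R]_n) :
  measurable_fun setT f -> measurable_fun setT (fun x => - f x).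
Proof.
move=> mf; apply: measurable_fun_rVP => i; under eq_fun do rewrite mxE.
by apply: measurableT_comp => //; exact: (measurableT_comp (measurable_coord i)).
Qed.

Lemma measurable_col_perm (s : {perm 'I_n}) :
  measurable_fun setT (col_perm s : 'rV[R]_n -> 'rV[R]_n).
Proof.
apply: measurable_fun_rVP => i; under eq_fun do rewrite mxE.
exact: measurable_coord.
Qed.

Lemma measurable_reflect (i : 'I_n) : measurable_fun setT (reflect_coord i).
Proof.
apply: measurable_fun_rVP => j; under eq_fun do rewrite mxE.
case: eqP => _; last exact: measurable_coord.
by apply: measurableT_comp => //; exact: measurable_coord.
Qed.

(** An open set is the union of the boxes with rational corners that it contains. *)
Lemma open_measurable_rV (U : set 'rV[R]_n) : open U -> measurable U.
Proof.
move=> oU.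
pose Q : countType := ('rV[rat]_n * 'rV[rat]_n)%type.
pose B (q : Q) : set 'rV[R]_n := obox (map_mx ratr q.1) (map_mx ratr q.2).
pose F k := if unpickle k is Some q then (if pselect (B q `<=` U) then B q else set0)
  else set0.
rewrite (_ : U = \bigcup_k F k).
  apply: bigcup_measurable => k _; rewrite /F; case: unpickle => // q.
  by case: pselect => /= BU; [exact: measurable_obox|exact: measurable0].
apply/seteqP; split=> x; last first.
  by move=> [k _]; rewrite /F; case: unpickle => [q|//]; case: pselect => /= [BU /BU|].
move=> Ux; have /nbhs_ballP[e /= e0 eU] : nbhs x U by exact: open_nbhs_nbhs.
have /choice[a aP] (i : 'I_n) : exists q : rat, x ord0 i - e < ratr q < x ord0 i.
  have /rat_in_itvoo[q] : x ord0 i - e < x ord0 i by rewrite ltrBlDr ltrDl.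
  by rewrite in_itv/= => ?; exists q.
have /choice[b bP] (i : 'I_n) : exists q : rat, x ord0 i < ratr q < x ord0 i + e.
  have /rat_in_itvoo[q] : x ord0 i < x ord0 i + e by rewrite ltrDl.
  by rewrite in_itv/= => ?; exists q.
pose q : Q := (\row_i a i, \row_i b i).
exists (pickle q) => //; rewrite /F pickleK.
have Bx : B q x.
  by move=> i; rewrite !mxE; move: (aP i) (bP i) => /andP[_ ->] /andP[-> _].
case: pselect => /= [//|]; case => y By; apply: eU.
rewrite mx_norm_ball /ball_ /=; apply/rV_norm_lt => // i; rewrite !mxE.
have := By i; rewrite !mxE; move: (aP i) (bP i) => /andP[? ?] /andP[? ?] /andP[? ?].
by rewrite ltr_norml; apply/andP; split; lra.
Qed.

Lemma continuous_measurable_rV (f : 'rV[R]_n -> R) :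
  continuous f -> measurable_fun setT f.
Proof.
move=> /continuousP cf.
apply: (measurability _ (RGenOpens.measurableE R)) => // _ [_ [a [b ->]] <-].
by rewrite setTI; apply: open_measurable_rV; apply: cf; exact: interval_open.
Qed.

End invariance.

(** * Measures with a density *)

Section density.
Context d (T : measurableType d) (R : realType).
Variables (mu : {measure set T -> \bar R}) (g : T -> R).
Hypotheses (mg : measurable_fun setT g) (g0 : forall x, 0 <= g x).

Definition dens of measurable_fun setT g & (forall x, 0 <= g x) : set T -> \bar R :=
  fun A => (\int[mu]_(x in A) (g x)%:E)%E.

Local Notation nu := (dens mg g0).

Let dens0 : nu set0 = 0%E.
Proof. by rewrite /dens integral_set0. Qed.

Let dens_ge0 A : (0 <= nu A)%E.
Proof. by apply: integral_ge0 => x _; rewrite lee_fin. Qed.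

Let dens_sigma_additive : semi_sigma_additive nu.
Proof.
apply: semi_sigma_additive_nng_induced => [|x]; last by rewrite lee_fin.
exact/measurable_EFinP.
Qed.

HB.instance Definition _ := isMeasure.Build _ _ _ nu dens0 dens_ge0 dens_sigma_additive.

Import HBNNSimple.

(** True by definition for indicators, by linearity for simple functions, and in general
    by monotone convergence. *)
Lemma ge0_integral_dens (h : T -> \bar R) : measurable_fun setT h ->
  (forall x, (0 <= h x)%E) -> (\int[nu]_x h x = \int[mu]_x (h x * (g x)%:E))%E.
Proof.
move=> mh h0; pose f_ := nnsfun_approx measurableT mh.
have mg' : measurable_fun setT (EFin \o g) by exact/measurable_EFinP.
rewrite (@nd_ge0_integral_lim _ _ _ nu h f_ h0); first last.
- by move=> x; exact: cvg_nnsfun_approx.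
- by move=> x p q pq; exact/lefP/nd_nnsfun_approx.
transitivity (limn (fun k => \int[mu]_x ((f_ k x)%:E * (g x)%:E)))%E; last first.
  rewrite -monotone_convergence//; first last.
  - by move=> x _ p q pq; rewrite lee_wpmul2r ?lee_fin//; exact/lefP/nd_nnsfun_approx.
  - by move=> k x _; rewrite mule_ge0 ?lee_fin.
  - by move=> k; apply: emeasurable_funM => //; exact/measurable_EFinP/measurable_funP.
  apply: eq_integral => x _; apply/cvg_lim => //; apply: cvgeZr => //.
  exact: cvg_nnsfun_approx.
congr (limn _); apply/funext => k /=; rewrite sintegralE.
pose A r := f_ k @^-1` [set r].
have mA r : measurable (A r).
  by rewrite -[A r]setTI; exact: (measurable_funP (f_ k) measurableT _ (measurable_set1 r)).
rewrite (eq_integral (fun x => \sum_(r \in range (f_ k)) (r * \1_(A r) x * g x)%:E)%E); last first.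
  move=> x _; rewrite -EFinM [in LHS](fimfunE (f_ k)) fsumEFin//; congr EFin.
  by rewrite !fsbig_finite//= mulr_suml.
rewrite ge0_integral_fsum//; first last.
- move=> r x _; rewrite lee_fin mulr_ge0//.
  by have := nnfun_muleindic_ge0 (f_ k) r x; rewrite lee_fin.
- by move=> r; apply/measurable_EFinP; apply: measurable_funM => //; exact: measurable_funM.
apply: eq_fsbigr => r /[!inE] -[x _ rE].
have r0 : 0 <= r by rewrite -rE.
rewrite (eq_integral (fun x => r%:E * (\1_(A r) x * g x)%:E)%E); last first.
  by move=> y _; rewrite -EFinM mulrA.
rewrite ge0_integralZl//; first last.
- by move=> y _; rewrite lee_fin mulr_ge0.
- by apply/measurable_EFinP; exact: measurable_funM.
congr (r%:E * _)%E; apply: etrans (integral_mkcond _ _) _; apply: eq_integral => y _.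
by rewrite epatch_indic/= -EFinM mulrC.
Qed.

Hypothesis g1 : (\int[mu]_x (g x)%:E = 1)%E.

Definition pdens of (\int[mu]_x (g x)%:E = 1)%E : set T -> \bar R := nu.

Local Notation P := (pdens g1).

HB.instance Definition _ := Measure.on P.

Let pdensT : P setT = 1%E. Proof. exact: g1. Qed.

HB.instance Definition _ := Measure_isProbability.Build _ _ _ P pdensT.

Lemma pdens_dominates : P `<< mu.
Proof.
apply/null_content_dominatesP => A mA A0; rewrite /pdens /dens/=.
apply/null_set_integral => //.
by apply/measurable_funTS/measurable_EFinP.
Qed.

Lemma ge0_integral_pdens (h : T -> \bar R) : measurable_fun setT h ->
  (forall x, (0 <= h x)%E) -> (\int[P]_x h x = \int[mu]_x (h x * (g x)%:E))%E.
Proof. exact: ge0_integral_dens. Qed.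

Lemma integral_pdens (h : T -> \bar R) : measurable_fun setT h ->
  (\int[P]_x h x = \int[mu]_x (h x * (g x)%:E))%E.
Proof.
move=> mh; rewrite [LHS]integralE [RHS]integralE; congr (_ - _)%E.
- rewrite ge0_integral_pdens//; last exact: measurable_funepos.
  apply: eq_integral => x _; rewrite !funeposE; case: leP => hx.
    by rewrite mul0e max_r// mule_le0_ge0// lee_fin.
  by rewrite max_l// mule_ge0// ?lee_fin// ltW.
- rewrite ge0_integral_pdens//; last exact: measurable_funeneg.
  apply: eq_integral => x _; rewrite !funenegE -mulNe.
  have [hx|hx] := leP (- h x)%E 0%E.
    by rewrite mul0e max_r// mule_le0_ge0// lee_fin.
  by rewrite max_l// mule_ge0// ?lee_fin// ltW.
Qed.

Lemma Rintegral_pdens (h : T -> R) : measurable_fun setT h ->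
  (\int[P]_x h x = \int[mu]_x (h x * g x))%R.
Proof.
by move=> mh; rewrite /Rintegral integral_pdens//; exact/measurable_EFinP.
Qed.

Lemma rint_pdens (h : T -> R) : measurable_fun setT h ->
  rint mu (fun x => h x * g x) -> rint P h.
Proof.
move=> mh /integrableP[_ ih]; apply/integrableP; split; first exact/measurable_EFinP.
rewrite ge0_integral_pdens//; last by apply: measurableT_comp => //; exact/measurable_EFinP.
by move: ih; under eq_integral do rewrite /= normrM (ger0_norm (g0 _)).
Qed.

End density.

(** * Product of Lebesgue measure with a probability measure *)

Lemma integrable_fine d (T : measurableType d) (R : realType)
    (m : {measure set T -> \bar R}) (G : T -> \bar R) :
  m.-integrable setT G -> rint m (fun x => fine (G x)) /\
  \int[m]_x fine (G x) = fine (\int[m]_x G x)%E.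
Proof.
move=> iG; have mG := measurable_int _ iG.
have fG := integrable_ae measurableT iG.
have mfG : measurable_fun setT (fun x => (fine (G x))%:E).
  by apply/measurable_EFinP; exact: measurableT_comp.
have GG : ae_eq m setT (fun x => (fine (G x))%:E) G.
  by apply: filterS fG => x /(_ I) fGx _; rewrite fineK.
split; last by congr fine; exact: ae_eq_integral.
apply/integrableP; split => //; case/integrableP : iG => _; apply: le_lt_trans.
apply: ae_ge0_le_integral => //; [exact: measurableT_comp|exact: measurableT_comp|].
by apply: filterS GG => x /(_ I) GGx _; rewrite -[in leRHS]GGx.
Qed.

Section product.
Context {R : realType} (n : nat).
Variable P : probability 'rV[R]_n R.
Local Notation X := 'rV[R]_n.
Local Notation mu := (@lebesgue_rV R n).
Local Notation mm := (mu \x P)%E.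

Lemma tonelli1 (F : X * X -> \bar R) : measurable_fun setT F ->
  (forall z, (0 <= F z)%E) ->
  (\int[mm]_z F z = \int[mu]_x \int[P]_y F (x, y))%E.
Proof. by move=> mF F0; exact: (@fubini_tonelli1 _ _ _ _ _ (@leb R n) P F mF F0). Qed.

Lemma tonelli2 (F : X * X -> \bar R) : measurable_fun setT F ->
  (forall z, (0 <= F z)%E) ->
  (\int[mm]_z F z = \int[P]_y \int[mu]_x F (x, y))%E.
Proof. by move=> mF F0; exact: (@fubini_tonelli2 _ _ _ _ _ (@leb R n) P F mF F0). Qed.

Lemma fubini1 (F : X * X -> R) : rint mm F ->
  [/\ {ae mu, forall x, rint P (fun y => F (x, y))},
     rint mu (fun x => \int[P]_y F (x, y)) &
     \int[mm]_z F z = \int[mu]_x \int[P]_y F (x, y)].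
Proof.
move=> iF.
have i1 := @integrable_fubini_F _ _ _ _ _ (@leb R n) P _ iF.
have [i2 i3] := @integrable_fine _ _ R mu _ i1.
split => //.
- exact: (@ae_integrable1 _ _ _ _ _ (@leb R n) P _ iF).
- apply: esym; apply: etrans i3 _.
  by congr fine; exact: (@integral12_prod_meas1 _ _ _ _ _ (@leb R n) P _ iF).
Qed.

Lemma fubini2 (F : X * X -> R) : rint mm F ->
  [/\ {ae P, forall y, rint mu (fun x => F (x, y))},
     rint P (fun y => \int[mu]_x F (x, y)) &
     \int[mm]_z F z = \int[P]_y \int[mu]_x F (x, y)].
Proof.
move=> iF.
have i1 : P.-integrable setT (fun y => \int[mu]_x (F (x, y))%:E)%E.
  case/integrableP : (iF) => mF iFa.
  have mFa : measurable_fun setT (fun z => `|(EFin \o F) z|%E) by exact: measurableT_comp.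
  apply/integrableP; split; first exact: (@measurable_fubini_G _ _ _ _ _ (@leb R n) P _ iF).
  move: iFa; rewrite tonelli2//; apply: le_lt_trans; apply: ge0_le_integral => //.
  - apply: measurableT_comp => //; exact: (@measurable_fubini_G _ _ _ _ _ (@leb R n) P _ iF).
  - exact: (@measurable_fun_fubini_tonelli_G _ _ _ _ _ (@leb R n) (fun z => `|(F z)%:E|%E)).
  - move=> y _; apply: le_abse_integral => //.
    exact: (measurableT_comp mF (measurable_pair2 y)).
have [i2 i3] := @integrable_fine _ _ R P _ i1.
split => //.
- exact: (@ae_integrable2 _ _ _ _ _ (@leb R n) P _ iF).
- apply: esym; apply: etrans i3 _.
  by congr fine; exact: (@integral21_prod_meas1 _ _ _ _ _ (@leb R n) P _ iF).
Qed.

Definition shear (e : R) (z : X * X) : X * X := (z.1 - e *: z.2, z.2).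

Lemma measurable_shear e : measurable_fun setT (shear e).
Proof.
apply: measurable_fun_pair; last exact: measurable_snd.
apply: measurable_rVD; first exact: measurable_fst.
by apply: measurable_rVN; apply: measurable_rVZ => //; exact: measurable_snd.
Qed.

Lemma measurable_shift (v : X) : measurable_fun setT (fun x : X => x + v).
Proof. exact: measurable_rVD. Qed.

Lemma integral_shift (v : X) (g : X -> \bar R) : measurable_fun setT g ->
  (\int[mu]_x g (x + v)%R = \int[mu]_x g x)%E.
Proof.
move=> mg; rewrite (integral_scales ltr01 (measurable_shift v))// ?mul1e//.
exact: scales_boxes_shift.
Qed.

(** The shear translates each slice where the second variable is fixed. *)
Lemma ge0_integral_shear e (F : X * X -> \bar R) : measurable_fun setT F ->
  (forall z, (0 <= F z)%E) ->
  (\int[mm]_z F (shear e z) = \int[mm]_z F z)%E.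
Proof.
move=> mF F0; have mFs := measurableT_comp mF (measurable_shear e).
rewrite !tonelli2//; apply: eq_integral => y _.
apply: (integral_shift (- (e *: y)) (g := fun x => F (x, y))).
exact: (measurableT_comp mF (measurable_pair2 _)).
Qed.

Lemma integral_shear e (F : X * X -> \bar R) : measurable_fun setT F ->
  (\int[mm]_z F (shear e z) = \int[mm]_z F z)%E.
Proof.
move=> mF; rewrite integralE [RHS]integralE; congr (_ - _)%E.
- rewrite -(ge0_integral_shear e (measurable_funepos mF))//.
  by apply: eq_integral => x _; rewrite !funeposE.
- rewrite -(ge0_integral_shear e (measurable_funeneg mF))//.
  by apply: eq_integral => x _; rewrite !funenegE.
Qed.

Lemma rint_shear e (F : X * X -> R) : rint mm F -> rint mm (F \o shear e).
Proof.
move=> /integrableP[/measurable_EFinP mF iF]; apply/integrableP; split.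
  by apply/measurable_EFinP; apply: measurableT_comp => //; exact: measurable_shear.
rewrite (ge0_integral_shear e (F := fun z => `|(F z)%:E|%E))//.
by apply: measurableT_comp => //; exact/measurable_EFinP.
Qed.

Lemma Rintegral_shear e (F : X * X -> R) : measurable_fun setT F ->
  \int[mm]_z F (shear e z) = \int[mm]_z F z.
Proof.
move=> mF; congr fine; apply: (integral_shear e (F := EFin \o F)).
exact/measurable_EFinP.
Qed.

Lemma L2_shear e (F : X * X -> R) : L2 mm F -> L2 mm (F \o shear e).
Proof.
move=> [mF iF]; split; first by apply: measurableT_comp => //; exact: measurable_shear.
exact: (rint_shear e iF).
Qed.

Lemma rint_prod (g h : X -> R) : rint mu g -> rint P h ->
  rint mm (fun z => g z.1 * h z.2).
Proof.
move=> /[dup] ig /integrableP[/measurable_EFinP mg iga].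
move=> /[dup] ih /integrableP[/measurable_EFinP mh iha].
have mF : measurable_fun setT (fun z : X * X => g z.1 * h z.2).
  by apply: measurable_funM; exact: measurableT_comp.
apply/integrableP; split; first exact/measurable_EFinP.
rewrite tonelli1//; last by do 2 apply: measurableT_comp => //.
have mh' : measurable_fun setT (fun y => `|(h y)%:E|%E).
  by apply: measurableT_comp => //; exact/measurable_EFinP.
rewrite (eq_integral (fun x => (`|(g x)%:E| * \int[P]_y `|(h y)%:E|)%E)); last first.
  move=> x _; rewrite -ge0_integralZl//.
  by apply: eq_integral => y _; rewrite -abseM.
rewrite ge0_integralZr//.
- by rewrite lte_mul_pinfty// ?integral_ge0// ge0_fin_numE// integral_ge0.
- by apply: measurableT_comp => //; exact/measurable_EFinP.
- exact: integral_ge0.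
Qed.

Lemma Rint_prod (g h : X -> R) : rint mu g -> rint P h ->
  \int[mm]_z (g z.1 * h z.2) = \int[mu]_x g x * \int[P]_y h y.
Proof.
move=> ig ih; have [_ _ ->] := fubini1 (rint_prod ig ih).
rewrite -RintegralZr//; apply: eq_Rintegral => x _.
by rewrite /= RintegralZl.
Qed.

Lemma rint_cstP (c : R) : rint P (fun=> c).
Proof. exact: finite_measure_integrable_cst. Qed.

Lemma Rint_cstP (c : R) : \int[P]_y c = c.
Proof.
rewrite Rintegral_cst// -[RHS]mulr1; congr (_ * _).
by have -> : fine (P setT) = fine 1%E by congr fine; exact: probability_setT.
Qed.

Lemma L2_prod (g h : X -> R) : L2 mu g -> L2 P h -> L2 mm (fun z => g z.1 * h z.2).
Proof.
move=> [mg ig] [mh ih]; split.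
  by apply: measurable_funM; exact: measurableT_comp.
by have := rint_prod ig ih; congr (rint _ _); apply/funext => z; rewrite exprMn.
Qed.

Lemma sq_prod (g h : X -> R) : L2 mu g -> L2 P h ->
  sq mm (fun z => g z.1 * h z.2) = sq mu g * sq P h.
Proof.
move=> [mg ig] [mh ih]; rewrite /sq -Rint_prod//.
by apply: eq_Rintegral => z _; rewrite exprMn.
Qed.

Lemma L2_fst (g : X -> R) : L2 mu g -> L2 mm (fun z => g z.1).
Proof.
move=> lg; have lc : L2 P (fun=> 1) by split => //; exact: rint_cstP.
by have := L2_prod lg lc; congr (L2 _ _); apply/funext => z; rewrite mulr1.
Qed.

Lemma sq_fst (g : X -> R) : L2 mu g -> sq mm (fun z => g z.1) = sq mu g.
Proof.
move=> lg; have lc : L2 P (fun=> 1) by split => //; exact: rint_cstP.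
have := sq_prod lg lc; rewrite [sq P _]/sq Rint_cstP expr1n mulr1 => <-.
by apply: eq_Rintegral => z _; rewrite mulr1.
Qed.

Definition avg (F : X * X -> R) (x : X) : R := \int[P]_y F (x, y).

Lemma measurable_avg (F : X * X -> R) : measurable_fun setT F ->
  measurable_fun setT (avg F).
Proof.
move=> mF; apply: measurableT_comp => //.
have mF' : measurable_fun setT (EFin \o F) by exact/measurable_EFinP.
rewrite (_ : (fun x => _) = (fun x => (\int[P]_y ((EFin \o F)^\+ (x, y))) -
    \int[P]_y ((EFin \o F)^\- (x, y)))%E).
  apply: emeasurable_funB.
  - apply: (@measurable_fun_fubini_tonelli_F _ _ _ _ _ P) => //.
    exact: measurable_funepos.
  - apply: (@measurable_fun_fubini_tonelli_F _ _ _ _ _ P) => //.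
    exact: measurable_funeneg.
apply/funext => x; rewrite integralE; congr (_ - _)%E.
- by apply: eq_integral => y _; rewrite !funeposE.
- by apply: eq_integral => y _; rewrite !funenegE.
Qed.

Lemma avg_sqr_le (F : X -> R) : measurable_fun setT F -> rint P (fun y => F y ^+ 2) ->
  rint P F /\ (\int[P]_y F y) ^+ 2 <= \int[P]_y (F y ^+ 2).
Proof.
move=> mF iF2; have lF : L2 P F by [].
have lc : L2 P (fun=> 1) by split => //; exact: rint_cstP.
split.
  by have := L2_mul_integrable lF lc; congr (rint _ _); apply/funext => y; rewrite mulr1.
have := ip_sqr_le lF lc; rewrite [sq P (fun=> 1)]/sq Rint_cstP expr1n mulr1.
by rewrite (_ : ip P F _ = \int[P]_y F y)//; apply: eq_Rintegral => y _; rewrite mulr1.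
Qed.

(** The Cauchy-Schwarz inequality for P in the second variable, then integration in the
    first. *)
Lemma avg_L2 (F : X * X -> R) : L2 mm F ->
  [/\ L2 mu (avg F), sq mu (avg F) <= sq mm F &
    {ae mu, forall x, rint P (fun y => F (x, y)) /\ rint P (fun y => F (x, y) ^+ 2)}].
Proof.
move=> [mF iF]; have [ae1 i1 i2] := fubini1 iF.
have ae2 : {ae mu, forall x, rint P (fun y => F (x, y)) /\
    rint P (fun y => F (x, y) ^+ 2)}.
  apply: filterS ae1 => x ix; split => //.
  by have [] := avg_sqr_le (measurableT_comp mF (measurable_pair1 x)) ix.
have [|] := @sq_le_ae _ _ R mu _ (avg F) i1 (measurable_avg mF).
  apply: filterS ae1 => x ix.
  by have [] := avg_sqr_le (measurableT_comp mF (measurable_pair1 x)) ix.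
by rewrite -i2.
Qed.

Lemma ip_avg (F : X * X -> R) (g : X -> R) : L2 mm F -> L2 mu g ->
  ip mm F (fun z => g z.1) = ip mu (avg F) g.
Proof.
move=> lF lg; have lg' := L2_fst lg.
have [_ i1 i2] := fubini1 (L2_mul_integrable lF lg'); apply: (etrans i2).
have [la _ ae2] := avg_L2 lF.
congr fine; apply: ae_eq_integral => //.
- by case/integrableP : i1.
- by case/integrableP : (L2_mul_integrable la lg).
- by apply: filterS ae2 => x [ix _] _; rewrite /= RintegralZr.
Qed.

(** The norm of F_k is the P-integral of the norms of its slices, to which dominated
    convergence applies. *)
Lemma slice_cvg0 (F : nat -> X * X -> R) (b : X -> R) :
  (forall k, L2 mm (F k)) -> rint P b ->
  (forall k y, L2 mu (fun x => F k (x, y))) ->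
  (forall k y, sq mu (fun x => F k (x, y)) <= b y) ->
  (forall y, sq mu (fun x => F k (x, y)) @[k --> \oo] --> 0) ->
  sq mm (F k) @[k --> \oo] --> 0.
Proof.
move=> lF ib lFy Fb F0.
rewrite (_ : (fun k => _) = (fun k => \int[P]_y sq mu (fun x => F k (x, y)))); last first.
  apply/funext => k; have [_ _] := fubini2 (lF k).2; exact.
rewrite (_ : 0 = \int[P]_y (fun=> 0) y); last by rewrite Rint_cstP.
apply: (Rint_dom_cvg (G := b)) => //.
- move=> k; have [_ i _] := fubini2 (lF k).2.
  by case/integrableP : i => /measurable_EFinP.
- exact: nearW.
- by apply: nearW => y k; rewrite ger0_norm ?sq_ge0.
Qed.

End product.

(** * Test functions *)

Lemma is_derive_cont (R : realType) (g g' : R -> R) : (forall t : R, is_derive t 1 g (g' t)) ->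
  continuous g.
Proof.
by move=> dg y; apply: differentiable_continuous; apply/derivable1_diffP; case: (dg y).
Qed.

Lemma mvt0 (R : realType) (f df : R -> R) :
  (forall s : R, is_derive s 1 f (df s)) ->
  forall t, exists s, `|s| <= `|t| /\ f t - f 0 = t * df s.
Proof.
move=> dg t.
have cg := is_derive_cont dg.
have [t0|t0] := leP 0 t.
  have [|s + e] := @MVT_segment R f _ 0 t t0 (fun y _ => dg y).
    exact: continuous_subspaceT.
  rewrite in_itv/= => /andP[s0 st]; exists s; split; first by rewrite !ger0_norm.
  by rewrite e subr0 mulrC.
have [|s + e] := @MVT_segment R f _ t 0 (ltW t0) (fun y _ => dg y).
  exact: continuous_subspaceT.
rewrite in_itv/= => /andP[ts s0]; exists s; split.
  by rewrite !ler0_norm ?lerN2// ltW.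
by rewrite -opprB e sub0r mulrN opprK mulrC.
Qed.

Section test.
Context {R : realType} {n : nat}.
Local Notation X := 'rV[R]_n.
Local Notation mu := (@lebesgue_rV R n).
Implicit Types (psi chi : X -> R) (x v : X) (i : 'I_n).
Local Notation e_ i := (@basis_rV R n i).

Lemma smooth_continuous psi : smooth psi -> continuous psi.
Proof. by move=> /(_ [::])[]. Qed.

Lemma smooth_derivable psi i x : smooth psi -> derivable psi x (e_ i).
Proof. by move=> /(_ [::])[_]. Qed.

Lemma smooth_partial psi i : smooth psi -> smooth ('D_(e_ i) psi).
Proof.
by move=> sp s; have := sp (rcons s i); rewrite /iter_partial foldr_rcons.
Qed.

Let diffquot_shift psi v w x :
  (fun h : R => h^-1 *: (((fun y => psi (y + v)) \o shift x) (h *: w) - psi (x + v))) =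
  (fun h => h^-1 *: ((psi \o shift (x + v)) (h *: w) - psi (x + v))).
Proof. by apply/funext => h /=; rewrite addrA. Qed.

Lemma partial_shift psi v w x :
  'D_w (fun y => psi (y + v)) x = 'D_w psi (x + v).
Proof. by rewrite /derive diffquot_shift. Qed.

Lemma derivable_shift psi v w x :
  derivable psi (x + v) w -> derivable (fun y => psi (y + v)) x w.
Proof. by rewrite /derivable diffquot_shift. Qed.

Lemma iter_partial_shift s psi v :
  iter_partial s (fun y => psi (y + v)) = (fun y => iter_partial s psi (y + v)).
Proof.
elim: s => //= i s ->; apply/funext => x; exact: partial_shift.
Qed.

Lemma smooth_shift psi v : smooth psi -> smooth (fun y => psi (y + v)).
Proof.
move=> sp s; rewrite iter_partial_shift; have [cs ds] := sp s; split.
  move=> x; apply: (cvg_comp (fun y : X => y + v) (iter_partial s psi) _ (cs (x + v))).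
  by apply: (@cvgD _ X _ (nbhs x)); [exact: cvg_id|exact: cvg_cst].
by move=> i x; exact: derivable_shift.
Qed.

Lemma smoothD psi chi : smooth psi -> smooth chi -> smooth (fun x => psi x + chi x).
Proof.
move=> sp sc.
have E s : iter_partial s (fun x => psi x + chi x) =
    (fun x => iter_partial s psi x + iter_partial s chi x).
  elim: s => //= i s ->; apply/funext => x.
  by rewrite -deriveD//; [have [_] := sp s|have [_] := sc s].
move=> s; rewrite E; have [cp dp] := sp s; have [cc dc] := sc s; split.
  by move=> x; exact: (continuousD (cp x) (cc x)).
by move=> i x; apply: derivableD.
Qed.

Lemma smoothZ (c : R) psi : smooth psi -> smooth (fun x => c * psi x).
Proof.
move=> sp.
have E s : iter_partial s (fun x => c * psi x) =
    (fun x => c * iter_partial s psi x).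
  elim: s => //= i s ->; apply/funext => x.
  by have := @deriveZ _ _ _ (iter_partial s psi) c x (e_ i) ((sp s).2 i x).
move=> s; rewrite E; have [cp dp] := sp s; split.
  by move=> x; exact: (continuousM (@cst_continuous _ _ c x) (cp x)).
by move=> i x; have := @derivableZ _ _ _ (iter_partial s psi) c x (e_ i) (dp i x).
Qed.

Lemma partialD psi chi i x : smooth psi -> smooth chi ->
  'D_(e_ i) (fun x => psi x + chi x) x = 'D_(e_ i) psi x + 'D_(e_ i) chi x.
Proof. by move=> sp sc; rewrite -deriveD//; exact: smooth_derivable. Qed.

Lemma partialZ (c : R) psi i x : smooth psi ->
  'D_(e_ i) (fun x => c * psi x) x = c * 'D_(e_ i) psi x.
Proof.
move=> sp; exact: (@deriveZ _ _ _ psi c x (e_ i) (smooth_derivable sp)).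
Qed.

(** Compact supports are handled through cubes, which behave well under sums and
    translations. *)
Definition supp_in (r : R) psi := forall x, psi x != 0 -> cube r x.

Lemma closed_cube (r : R) : closed [set x : X | forall i, `|x ord0 i| <= r].
Proof.
rewrite (_ : [set x : X | _] = \bigcap_(i in [set: 'I_n]) [set x : X | `|x ord0 i| <= r]).
  apply: closed_bigI => i _.
  apply: (@closed_comp _ _ (fun x : X => `|x ord0 i|) [set t : R | t <= r]).
    move=> x _; apply: (@continuous_comp _ _ _ (fun x : X => x ord0 i)).
      exact: coord_continuous.
    exact: norm_continuous.
  exact: closed_le.
by apply/seteqP; split=> x h i; [move=> _; exact: h|exact: h].
Qed.

Lemma compact_cube (r : R) : compact [set x : X | forall i, `|x ord0 i| <= r].
Proof.
apply: bounded_closed_compact; last exact: closed_cube.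
exists (Num.max r 0); split; first exact: num_real.
move=> M rM x /= xr; apply/ltW; apply/rV_norm_lt.
  by apply: le_lt_trans rM; rewrite le_max lexx orbT.
by move=> i; apply: le_lt_trans (xr i) _; apply: le_lt_trans rM; rewrite le_max lexx.
Qed.

Lemma supp_in_compact r psi : supp_in r psi ->
  compact (closure [set x | psi x != 0]).
Proof.
move=> sr; apply: (@subclosed_compact _ _ [set x : X | forall i, `|x ord0 i| <= r]).
- exact: closed_closure.
- exact: compact_cube.
- rewrite closureE; apply: smallest_sub; first exact: closed_cube.
  by move=> x /sr/cubeP xr i; exact/ltW.
Qed.

Lemma compact_supp_in psi : compact (closure [set x | psi x != 0]) ->
  exists2 r, 0 < r & supp_in r psi.
Proof.
move=> /compact_bounded[M [_ Mb]].
exists (`|M| + 2); first by rewrite ltr_wpDl.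
move=> x px; apply/cubeP => i; apply: le_lt_trans (coord_le_norm x i) _.
apply: le_lt_trans (Mb (`|M| + 1) _ x _) _.
- by rewrite ltr_pwDr// ler_norm.
- exact: subset_closure.
- by rewrite ltrD2l ltr1n.
Qed.

Lemma test_shift psi v : test_function psi -> test_function (fun y => psi (y + v)).
Proof.
move=> [sp /compact_supp_in[r r0 cp]]; split; first exact: smooth_shift.
apply: (@supp_in_compact (r + `|v|)) => x /cp/cubeP xr; apply/cubeP => i.
have := xr i; rewrite mxE => h.
rewrite -[x _ _](addrK (v ord0 i)); apply: le_lt_trans (ler_normB _ _) _.
by apply: ltr_leD => //; exact: coord_le_norm.
Qed.

Lemma testD psi chi : test_function psi -> test_function chi ->
  test_function (fun x => psi x + chi x).
Proof.
move=> [sp /compact_supp_in[r r0 cp]] [sc /compact_supp_in[s s0 cc]].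
split; first exact: smoothD.
apply: (@supp_in_compact (r + s)) => x pcx.
have [p0|/cp] := eqVneq (psi x) 0; last first.
  by move=> /cubeP h; apply/cubeP => i; apply: lt_le_trans (h i) _; rewrite lerDl ltW.
have /cc : chi x != 0 by apply: contra_neq pcx => ->; rewrite p0 addr0.
by move=> /cubeP h; apply/cubeP => i; apply: lt_le_trans (h i) _; rewrite lerDr ltW.
Qed.

Lemma testZ (c : R) psi : test_function psi -> test_function (fun x => c * psi x).
Proof.
move=> [sp /compact_supp_in[r r0 cp]]; split; first exact: smoothZ.
apply: (@supp_in_compact r) => x; rewrite mulf_eq0 negb_or => /andP[_]; exact: cp.
Qed.

Lemma test0 : test_function ((fun=> 0) : X -> R).
Proof.
have E s : iter_partial s ((fun=> 0) : X -> R) = (fun=> 0).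
  by elim: s => //= i s ->; apply/funext => x; rewrite derive_cst.
split; last by apply: (@supp_in_compact 1) => x; rewrite eqxx.
by move=> s; rewrite E; split=> [x|i x]; [exact: cst_continuous|exact: derivable_cst].
Qed.

Lemma test_partial psi i : test_function psi -> test_function ('D_(e_ i) psi).
Proof.
move=> [sp /compact_supp_in[r r0 cp]]; split; first exact: smooth_partial.
apply: (@supp_in_compact (r + 1)) => x; apply: contra_neqP => /cubeP/existsNP[j /negP].
rewrite -leNgt => xj.
rewrite (@near_eq_derive _ _ _ psi (fun=> 0)) ?derive_cst//.
have : ball x 1 `<=` [set y | psi y = 0].
  move=> y; rewrite mx_norm_ball /ball_ /= => /rV_norm_lt => /(_ ltr01) /(_ j).
  rewrite !mxE => h; apply/eqP; apply: contraT => /cp/cubeP /(_ j) yj.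
  have := ler_normD (x ord0 j - y ord0 j) (y ord0 j); rewrite subrK => h2.
  move: xj h yj h2; lra.
by move=> h; apply: filterS h _; exact: nbhsx_ballx.
Qed.

Lemma test_bounded psi : test_function psi ->
  exists M r : R, [/\ 0 <= M, 0 < r & forall x, `|psi x| <= M * \1_(cube r) x].
Proof.
move=> [sp /compact_supp_in[r r0 cp]].
have /compact_bounded[M [_ Mb]] : compact (psi @` [set x : X | forall i, `|x ord0 i| <= r]).
  apply: continuous_compact; last exact: compact_cube.
  by apply: continuous_subspaceT; exact: smooth_continuous.
exists (`|M| + 1), r; split => // x.
have [->|/[dup] px /cp xr] := eqVneq (psi x) 0.
  by rewrite normr0 mulr_ge0.
rewrite indicE mem_set// mulr1; apply: (Mb (`|M| + 1)).
  by rewrite ltr_pwDr// ler_norm.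
by exists x => //= i; move/cubeP : xr => /(_ i)/ltW.
Qed.

Lemma rint_box (a b : X) (M : R) : rint mu (fun x => M * \1_(obox a b) x).
Proof.
apply: rintZ; have mo := measurable_obox a b.
apply/integrableP; split; first exact/measurable_EFinP.
rewrite (eq_integral (fun x => (\1_(obox a b) x)%:E)) => [|x _]; last first.
  by rewrite gee0_abs// lee_fin.
by rewrite integral_indic// setIT; exact: lebesgue_obox_lty.
Qed.

Lemma L2_box (a b : X) (M : R) : L2 mu (fun x => M * \1_(obox a b) x).
Proof.
split.
  apply: measurable_funM => //; apply: measurable_indic; exact: measurable_obox.
have := rint_box a b (M ^+ 2); congr (rint _ _); apply/funext => x.
by rewrite exprMn indicE; case: (_ \in _); rewrite ?expr1n ?expr0n.
Qed.

Lemma L2_box_bound (h : X -> R) (a b : X) (M : R) : measurable_fun setT h ->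
  (forall x, `|h x| <= M * \1_(obox a b) x) -> L2 mu h.
Proof.
move=> mh hM; apply: (L2_sq (L2_box a b M)) => // x.
by rewrite (le_trans (hM x))// ler_norm.
Qed.

Lemma L2_test psi : test_function psi -> L2 mu psi.
Proof.
move=> /[dup] tp /test_bounded[M [r [_ _ Mr]]]; apply: L2_box_bound Mr.
by apply: continuous_measurable_rV; apply: smooth_continuous; case: tp.
Qed.

Lemma is_derive_line psi i x (t : R) : smooth psi ->
  is_derive t 1 (fun s : R => psi (x + s *: e_ i)) ('D_(e_ i) psi (x + t *: e_ i)).
Proof.
move=> sp.
have E : (fun h : R => h^-1 *: (((fun s : R => psi (x + s *: e_ i)) \o shift t) (h *: 1)
      - psi (x + t *: e_ i))) =
    (fun h => h^-1 *: ((psi \o shift (x + t *: e_ i)) (h *: e_ i) - psi (x + t *: e_ i))).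
  apply/funext => h /=; congr (_ *: (psi _ - _)).
  by rewrite [h%:A](_ : _ = h) ?scalerDl ?addrA 1?(addrC x)// /GRing.scale/= mulr1.
split; first by rewrite /derivable E; exact: smooth_derivable.
by rewrite /derive E.
Qed.

Lemma mvt_line psi i x (t : R) : smooth psi ->
  exists s, `|s| <= `|t| /\
    psi (x + t *: e_ i) - psi x = t * 'D_(e_ i) psi (x + s *: e_ i).
Proof.
move=> sp.
have [s [st e]] := mvt0 (fun s : R => is_derive_line i x s sp) t.
by exists s; split => //; rewrite -e scale0r addr0.
Qed.

End test.

(** * Bump functions and the indicators of boxes *)

Section bump.
Context {R : realType}.

Lemma expRN_le (x : R) (k : nat) : 0 < x ->
  expR (- x) <= (k.+1)`!%:R / x ^+ k.+1.
Proof.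
move=> x0; rewrite expRN -[leRHS]invf_div lef_pV2 ?posrE ?expR_gt0//; last first.
  by rewrite divr_gt0 ?exprn_gt0// ltr0n fact_gt0.
by apply: le_trans (expR_ge1Dxn k (ltW x0)); rewrite lerDr.
Qed.

Variables (a b lam : R).
Hypothesis lam0 : 0 < lam.

Definition bump_w (t : R) : R := (t - a) * (b - t).

(** The classical bump exp(- lam / w), where w = (t - a) (b - t), times a rational
    function p / w^m. With these factors the family is closed under differentiation. *)
Definition bump (p : {poly R}) (m : nat) (t : R) : R :=
  if a < t < b then p.[t] / bump_w t ^+ m * expR (- (lam / bump_w t)) else 0.

Lemma bump_w_gt0 t : a < t < b -> 0 < bump_w t.
Proof. by move=> /andP[at_ tb]; rewrite mulr_gt0// subr_gt0. Qed.

Lemma poly_bounded (p : {poly R}) : exists2 C : R, 0 < C &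
  forall t, a < t < b -> `|p.[t]| <= C.
Proof.
have [|M [_ Mb]] := @compact_bounded R R ((horner p) @` `[a, b]%classic).
  apply: continuous_compact; last exact: segment_compact.
  by apply: continuous_subspaceT => x; exact: continuous_horner.
exists (`|M| + 1); first by rewrite ltr_wpDl.
move=> t /andP[at_ tb]; apply: (Mb (`|M| + 1)); first by rewrite ltr_pwDr// ler_norm.
by exists t => //=; rewrite in_itv/= !ltW.
Qed.

(** The exponential beats every power of 1 / w, and w vanishes at least linearly at a
    and b. This gives the bump a zero derivative at the end points of the interval. *)
Lemma bump_quadratic p m : exists C : R, forall t0 t, ~~ (a < t0 < b) ->
  `|bump p m t| <= C * (t - t0) ^+ 2.
Proof.
have [C C0 Cp] := poly_bounded p.
pose K : R := (m.+2)`!%:R / lam ^+ m.+2.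
have K0 : 0 <= K by rewrite divr_ge0// exprn_ge0// ltW.
exists (C * K * (b - a) ^+ 2) => t0 t t0ab; rewrite /bump.
case: ifPn => tab; last first.
  by rewrite normr0 (mulr_ge0 (mulr_ge0 (mulr_ge0 (ltW C0) K0) (sqr_ge0 _)) (sqr_ge0 _)).
have w0 := bump_w_gt0 tab; set w := bump_w t in w0 *.
have wle : w ^+ 2 <= (b - a) ^+ 2 * (t - t0) ^+ 2.
  move: tab => /andP[at_ tb].
  have [t0a|t0b] : (t0 <= a \/ b <= t0).
    move: t0ab; rewrite negb_and -!leNgt => /orP[]; [by left|by right].
  - rewrite -exprMn lerXn2r ?nnegrE ?(ltW w0) ?mulr_ge0 ?subr_ge0 ?(ltW (lt_trans at_ tb)) ?(le_trans t0a (ltW at_))//.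
    by rewrite /w /bump_w mulrC; apply: ler_pM; lra.
  - rewrite -[(t - t0) ^+ 2]sqrrN opprB -exprMn lerXn2r ?nnegrE ?(ltW w0) ?mulr_ge0 ?subr_ge0 ?(ltW (lt_trans at_ tb)) ?(le_trans (ltW tb) t0b)//.
    by rewrite /w /bump_w; apply: ler_pM; lra.
have := expRN_le m.+1 (divr_gt0 lam0 w0).
rewrite expr_div_n invf_div mulrA => le1.
rewrite !normrM (gtr0_norm (expR_gt0 _)) normfV [`|w ^+ m|]gtr0_norm ?exprn_gt0//.
apply: (@le_trans _ _ (C / w ^+ m * ((m.+2)`!%:R * w ^+ m.+2 / lam ^+ m.+2))).
  apply: ler_pM => //.
  - by rewrite divr_ge0// exprn_ge0// ltW.
  - by rewrite ler_pM2r ?invr_gt0 ?exprn_gt0//; exact: Cp.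
rewrite (_ : _ * _ = C * K * w ^+ 2); last first.
  rewrite /K (_ : w ^+ m.+2 = w ^+ m * w ^+ 2); last by rewrite -exprD addn2.
  by field; rewrite ?expf_neq0 ?gt_eqF.
by rewrite -[leRHS]mulrA ler_wpM2l// mulr_ge0// ltW.
Qed.

(** Numerator of the derivative, over the denominator w^(m+2). *)
Definition bump_deriv (p : {poly R}) (m : nat) : {poly R} :=
  let w := ('X - a%:P) * (b%:P - 'X) in
  p^`() * w ^+ 2 - (m%:R *: p) * w^`() * w + lam *: (p * w^`()).

Lemma is_derive_quadratic (f : R -> R) (t C : R) : f t = 0 ->
  (forall s, `|f s| <= C * (s - t) ^+ 2) -> is_derive t 1 f 0.
Proof.
move=> ft fC.
have cv : h^-1 *: ((f \o shift t) (h *: (1 : R)) - f t) @[h --> 0^'] --> (0 : R).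
  apply/cvgrPdist_lt => e e0; near=> h.
  have h0 : h != 0 by near: h; exact: nbhs_dnbhs_neq.
  rewrite sub0r normrN /= ft subr0 normrM normfV ltr_pdivrMl ?normr_gt0//.
  apply: le_lt_trans (fC _) _; rewrite addrK /GRing.scale/= mulr1.
  rewrite -[h ^+ 2]real_normK ?num_real// expr2 mulrCA ltr_pM2l ?normr_gt0//.
  apply: (@le_lt_trans _ _ ((`|C| + 1) * `|h|)).
    by rewrite ler_wpM2r// (le_trans (ler_norm C))// lerDl.
  rewrite mulrC -ltr_pdivlMr ?ltr_wpDl//.
  by near: h; apply: dnbhs0_lt; rewrite divr_gt0// ltr_wpDl.
by split; [apply/cvg_ex; exists 0|exact: cvg_lim].
Unshelve. all: by end_near. Qed.

Lemma bump_is_derive p m (t : R) :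
  is_derive t 1 (bump p m) (bump (bump_deriv p m) m.+2 t).
Proof.
(* at the end points and outside, the bump has a double zero *)
have [tab|tab] := boolP (a < t < b); last first.
  have [C Cb] := bump_quadratic p m.
  rewrite {2}/bump (negbTE tab); apply: (is_derive_quadratic (C := C)).
    by rewrite /bump (negbTE tab).
  by move=> s; exact: Cb.
have [w wdef] : exists w : {poly R}, w = ('X - a%:P) * (b%:P - 'X) by eexists.
have wE s : w.[s] = bump_w s by rewrite wdef !hornerE.
have w0 : w.[t] != 0 by rewrite wE gt_eqF// bump_w_gt0.
have wm0 : (w ^+ m).[t] != 0 by rewrite horner_exp expf_neq0.
have dw : is_derive t 1 (horner w) w^`().[t] by exact: is_derive_poly.
have dp : is_derive t 1 (horner p) p^`().[t] by exact: is_derive_poly.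
have dwm : is_derive t 1 (horner (w ^+ m)) (w ^+ m)^`().[t] by exact: is_derive_poly.
have d1 := is_deriveV wm0 dwm.
have d2 := is_deriveV w0 dw.
have d3 := is_deriveN (is_deriveZ lam d2).
have d4 := is_derive1_comp (is_derive_expR _) d3.
have d5 := is_deriveM (is_deriveM dp d1) d4.
apply: near_eq_is_derive; last first.
  apply: (is_derive_eq d5).
  have hwm : (w ^+ m)^`().[t] = m%:R * w^`().[t] * w.[t] ^+ m / w.[t].
    rewrite deriv_exp hornerMn hornerM horner_exp.
    case: (m) => [|k]; first by rewrite mulr0n !mul0r.
    by rewrite -mulr_natl exprS /=; field.
  rewrite /bump tab -wE /bump_deriv -wdef !fctE /GRing.scale/= hwm.
  rewrite !(hornerD, hornerN, hornerM, hornerZ) horner_exp /GRing.scale/=.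
  rewrite -(addn2 m) exprD.
  move: (expR _) => E0; move: w0; move: (w.[t]) => W w0.
  have Wm0 : W ^+ m != 0 by rewrite expf_neq0.
  by move: (W ^+ m) Wm0 => V V0; field; rewrite w0 V0.
have : \near t, t \in `]a, b[ by apply: near_in_itvoo; rewrite in_itv.
apply: filterS => s; rewrite in_itv/= => sab.
by rewrite /bump sab !fctE/= horner_exp wE.
Qed.

End bump.

Section bump_box.
Context {R : realType} {n : nat}.
Local Notation X := 'rV[R]_n.
Local Notation e_ i := (@basis_rV R n i).
Variables (a b : X) (lam : R).
Hypothesis lam0 : 0 < lam.

Definition box_bump (pm : 'I_n -> {poly R} * nat) (x : X) : R :=
  \prod_i bump (a ord0 i) (b ord0 i) lam (pm i).1 (pm i).2 (x ord0 i).

(** Effect of the j-th partial derivative on the parameters of the factors. *)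
Definition box_bump_upd (j : 'I_n) (pm : 'I_n -> {poly R} * nat) i :=
  if i == j then (bump_deriv (a ord0 i) (b ord0 i) lam (pm i).1 (pm i).2, (pm i).2.+2)
  else pm i.

Lemma is_derive_cvg (f : R -> R) (t df : R) : is_derive t 1 f df ->
  h^-1 *: ((f \o shift t) (h *: (1 : R)) - f t) @[h --> 0^'] --> df.
Proof. by move=> [df1 <-]; exact: df1. Qed.

Lemma box_bump_is_derive pm j x :
  is_derive x (e_ j) (box_bump pm) (box_bump (box_bump_upd j pm) x).
Proof.
pose f i := bump (a ord0 i) (b ord0 i) lam (pm i).1 (pm i).2.
pose c := \prod_(i | i != j) f i (x ord0 i).
have E : (fun h : R => h^-1 *: ((box_bump pm \o shift x) (h *: e_ j) - box_bump pm x)) =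
   (fun h => (h^-1 *: ((f j \o shift (x ord0 j)) (h *: (1 : R)) - f j (x ord0 j))) * c).
  apply/funext => h; rewrite /= /box_bump (bigD1 j)//= [X in _ - X](bigD1 j)//=.
  rewrite -/(f j) (_ : \prod_(i | i != j) _ = c); last first.
    apply: eq_bigr => i ij; rewrite !mxE eqxx/= (negbTE ij).
    by rewrite mulr0 add0r.
  rewrite -/(f j) -/c !mxE !eqxx/= mulr1 /GRing.scale/= mulr1 -mulrA -mulrBl.
  by [].
have cv : (fun h : R => h^-1 *: ((box_bump pm \o shift x) (h *: e_ j) - box_bump pm x))
    @ 0^' --> box_bump (box_bump_upd j pm) x.
  rewrite E /box_bump (bigD1 j)//= /box_bump_upd eqxx/=.
  rewrite (_ : \prod_(i | i != j) _ = c); last first.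
    by apply: eq_bigr => i ij; rewrite (negbTE ij).
  apply: cvgM; last exact: cvg_cst.
  by apply: is_derive_cvg; exact: bump_is_derive.
by split; [apply/cvg_ex; eexists; exact: cv|exact: cvg_lim].
Qed.

Lemma box_bump_continuous pm : continuous (box_bump pm).
Proof.
suff H (s : seq 'I_n) : continuous (fun x : X =>
    \prod_(i <- s) bump (a ord0 i) (b ord0 i) lam (pm i).1 (pm i).2 (x ord0 i)).
  exact: H.
elim: s => [|i s ih].
  by under eq_fun do rewrite big_nil; exact: cst_continuous.
under eq_fun do rewrite big_cons.
move=> x; refine (@continuousM _ _ (fun x : X => bump (a ord0 i) (b ord0 i) lam
  (pm i).1 (pm i).2 (x ord0 i)) _ x _ (ih x)).
apply: (@continuous_comp _ _ _ (fun x : X => x ord0 i)); first exact: coord_continuous.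
apply: differentiable_continuous; apply/derivable1_diffP.
by case: (bump_is_derive (a ord0 i) (b ord0 i) lam0 (pm i).1 (pm i).2 (x ord0 i)).
Qed.

Lemma box_bump_smooth pm : smooth (box_bump pm).
Proof.
have E s : iter_partial s (box_bump pm) = box_bump (foldr box_bump_upd pm s).
  elim: s => //= i s ->; apply/funext => x.
  by have [_] := box_bump_is_derive (foldr box_bump_upd pm s) i x.
move=> s; rewrite E; split; first exact: box_bump_continuous.
by move=> i x; have [] := box_bump_is_derive (foldr box_bump_upd pm s) i x.
Qed.

Lemma box_bump_test pm : test_function (box_bump pm).
Proof.
split; first exact: box_bump_smooth.
apply: (@supp_in_compact _ _ (`|a| + `|b| + 1)) => x; rewrite /box_bump.
move=> /prodf_neq0 px; apply/cubeP => i; have := px i isT.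
rewrite /bump; case: ifPn; last by rewrite eqxx.
move=> /andP[ax xb] _; have := coord_le_norm a i; have := coord_le_norm b i.
by rewrite !ler_norml ltr_norml => /andP[_ ?] /andP[? _];
  have a0 := normr_ge0 a; have b0 := normr_ge0 b; apply/andP; split; lra.
Qed.

End bump_box.

Section box_density.
Context {R : realType} {n : nat}.
Local Notation X := 'rV[R]_n.
Local Notation mu := (@lebesgue_rV R n).
Implicit Types (psi chi : X -> R) (x v : X).

Lemma cvg_prod1 (I : Type) (s : seq I) (F : nat -> I -> R) :
  (forall i : I, F k i @[k --> \oo] --> (1 : R)) ->
  (\prod_(i <- s) F k i) @[k --> \oo] --> (1 : R).
Proof.
move=> F1; elim: s => [|i s ih].
  by under eq_fun do rewrite big_nil; exact: cvg_cst.
rewrite -[X in _ --> X]mulr1; under eq_fun do rewrite big_cons.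
by apply: cvgM.
Qed.

(** As lam tends to 0, the bumps of parameter lam converge pointwise to the indicator
    while staying below it. *)
Lemma box_approx (a b : X) : exists p : nat -> X -> R,
  (forall k, test_function (p k)) /\
  sq mu (fun x => p k x - \1_(obox a b) x) @[k --> \oo] --> 0.
Proof.
pose lam (k : nat) : R := k.+1%:R^-1.
have lam0 k : 0 < lam k by rewrite invr_gt0.
pose p k := box_bump a b (lam k) (fun=> (1, 0%N)).
exists p; split=> [k|]; first exact: box_bump_test.
have pE k x : p k x = if x \in obox a b then
    \prod_i expR (- (lam k / bump_w (a ord0 i) (b ord0 i) (x ord0 i))) else 0.
  rewrite /p /box_bump; case: ifPn => [|]; rewrite ?inE ?notin_setE => xab.
    by apply: eq_bigr => i _; rewrite /bump xab hornerE expr0 invr1 !mul1r.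
  have /existsNP[i /negP xi] := xab.
  by rewrite (bigD1 i)//= /bump (negbTE xi) mul0r.
have p01 k x : 0 <= p k x <= \1_(obox a b) x.
  rewrite pE indicE; case: ifPn => [xab|_]; last by rewrite lexx.
  rewrite prodr_ge0 => [|i _]; last exact: expR_ge0.
  have e1 : \prod_(i < n) (1 : R) = 1 by rewrite big1.
  rewrite /= -[leRHS]e1.
  apply: ler_prod => i _; rewrite expR_ge0 -expR0 ler_expR oppr_le0.
  by rewrite divr_ge0// ltW// bump_w_gt0//; move: xab; rewrite inE; exact.
apply: (sq_dom_cvg (G := fun x => 1 * \1_(obox a b) x)).
- move=> k; apply: measurable_funB.
    apply: continuous_measurable_rV; apply: smooth_continuous.
    exact: box_bump_smooth.
  by apply: measurable_indic; exact: measurable_obox.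
- apply: nearW => x.
  have [xab|xab] := boolP (x \in obox a b); last first.
    rewrite (_ : (fun k => _) = fun=> 0); first exact: cvg_cst.
    by apply/funext => k; rewrite pE indicE (negbTE xab) subrr.
  rewrite indicE xab/= -(subrr (1 : R)); apply: cvgB; last exact: cvg_cst.
  rewrite (_ : (fun k => _) = (fun k => \prod_i
    expR (- (lam k / bump_w (a ord0 i) (b ord0 i) (x ord0 i))))); last first.
    by apply/funext => k; rewrite pE xab.
  apply: cvg_prod1 => i; rewrite -expR0; set B := bump_w _ _ _.
  have c0 : (- (lam k / B)) @[k --> \oo] --> (0 : R).
    rewrite -[X in _ --> X]oppr0; apply: cvgN.
    rewrite -[X in _ --> X](mul0r B^-1); apply: cvgM; last exact: cvg_cst.
    exact: cvg_harmonic.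
  exact: (cvg_comp (fun k => - (lam k / B)) expR c0 (@continuous_expR R 0)).
- exact: rint_box.
- apply: nearW => x k; have := p01 k x; rewrite indicE mul1r.
  by case: (x \in _) => /= /andP[h1 h2]; rewrite expr2; nra.
Qed.

(** Orthogonality extends to the indicators of boxes, so the measures with densities
    max(G, 0) and max(-G, 0) agree on boxes, hence on all measurable sets. On the set
    where G >= 0 the second one is 0, hence so is the first, and symmetrically. *)
Lemma L2_orthogonal_test (G : X -> R) : L2 mu G ->
  (forall psi, test_function psi -> ip mu G psi = 0) ->
  {ae mu, forall x, G x = 0}.
Proof.
move=> lG oG; have mG := lG.1.
have l1 (a b : X) : L2 mu \1_(obox a b).
  by have := L2_box a b 1; congr (L2 _ _); apply/funext => x; rewrite mul1r.
have box0 (a b : X) : ip mu G \1_(obox a b) = 0.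
  have [p [tp pb]] := box_approx a b.
  have := ip_cvg (fun k => L2_test (tp k)) (l1 a b) lG pb.
  rewrite (_ : (fun k => _) = fun=> 0); last by apply/funext => k; rewrite ipC oG.
  by move=> h; rewrite ipC -(cvg_lim _ h)// lim_cst.
pose Gp x := Num.max (G x) 0; pose Gm x := Num.max (- G x) 0.
have mGp : measurable_fun setT Gp by exact: measurable_maxr.
have mGm : measurable_fun setT Gm.
  by apply: measurable_maxr => //; exact: measurableT_comp.
have Gp0 x : 0 <= Gp x by rewrite le_max lexx orbT.
have Gm0 x : 0 <= Gm x by rewrite le_max lexx orbT.
have GE x : Gp x - Gm x = G x.
  rewrite /Gp /Gm; have [h|/ltW h] := leP (G x) 0.
    by rewrite max_l ?oppr_ge0// sub0r opprK.
  by rewrite max_r ?oppr_le0// subr0.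
have lGp : L2 mu Gp.
  by apply: (L2_sq lG) => // x; rewrite ger0_norm// /Gp ge_max ler_norm normr_ge0.
have lGm : L2 mu Gm.
  by apply: (L2_sq lG) => // x; rewrite ger0_norm// /Gm ge_max -normrN ler_norm normr_ge0.
have densE (H : X -> R) (mH : measurable_fun setT H) (H0 : forall x, 0 <= H x) a b :
    L2 mu H -> dens mu mH H0 (obox a b) = (ip mu H \1_(obox a b))%:E.
  move=> lH; rewrite /dens integral_mkcond /ip fineK; last first.
    by apply: integrable_fin_num => //; exact: L2_mul_integrable.
  apply: eq_integral => x _; rewrite patchE indicE; case: ifPn => _.
    by rewrite mulr1.
  by rewrite mulr0.
have Gpm A : measurable A -> dens mu mGp Gp0 A = dens mu mGm Gm0 A.
  apply: measure_unique_boxes => a b; rewrite /= ?densE// ?ltry//.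
  congr EFin; apply/eqP; rewrite -subr_eq0 -ipBl//; apply/eqP.
  rewrite -(box0 a b); apply: eq_Rintegral => x _; congr (_ * _).
  exact: GE.
have mz (H : X -> R) : measurable_fun setT H -> measurable [set x | 0 <= H x].
  move=> mH; rewrite [X in measurable X](_ : _ = H @^-1` `[0, +oo[).
    exact: measurable_funTP.
  by apply/seteqP; split=> x /=; rewrite in_itv/= andbT.
(* H and K are the two parts of G in either order, and s is G or - G *)
have key (H K : X -> R) (mH : measurable_fun setT H) (mK : measurable_fun setT K)
    (H0 : forall x, 0 <= H x) (K0 : forall x, 0 <= K x) (s : X -> R) :
    measurable_fun setT s ->
    (forall A, measurable A -> dens mu mH H0 A = dens mu mK K0 A) ->
    (forall x, 0 <= s x -> K x = 0) -> (forall x, s x < 0 -> H x = 0) ->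
    {ae mu, forall x, H x = 0}.
  move=> ms HK sK sH; have mA := mz s ms; pose A := [set x | 0 <= s x].
  have : (\int[mu]_(x in A) (H x)%:E = 0)%E.
    apply: etrans (HK _ mA) _; rewrite /dens (eq_integral (fun=> 0%E)) ?integral0//.
    by move=> x /[!inE] /sK ->.
  rewrite integral_mkcond (_ : (_ \_ _) = (fun x => `|(H x)%:E|%E)); last first.
    apply/funext => x; rewrite patchE; case: ifPn; rewrite ?notin_setE/=.
      by rewrite ger0_norm.
    by move=> /negP; rewrite -ltNge => /sH ->; rewrite normr0.
  move/(ae_eq_integral_abs _ measurableT (proj2 (measurable_EFinP _ _) mH)).
  by apply: filterS => x /(_ I) [].
have aep : {ae mu, forall x, Gp x = 0}.
  apply: (key Gp Gm mGp mGm Gp0 Gm0 G) => // x.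
    by rewrite /Gm => G0; rewrite max_r// oppr_le0.
  by move=> G0; rewrite /Gp max_r// ltW.
have aem : {ae mu, forall x, Gm x = 0}.
  apply: (key Gm Gp mGm mGp Gm0 Gp0 (fun x => - G x)).
  - exact: measurableT_comp.
  - by move=> A mA; rewrite Gpm.
  - by move=> x; rewrite oppr_ge0 /Gp => G0; rewrite max_r.
  - by move=> x; rewrite oppr_lt0 /Gm => G0; rewrite max_r// oppr_le0 ltW.
by apply: filterS2 aep aem => x px mx; rewrite -GE px mx subrr.
Qed.

End box_density.

(** * Density of test functions, translations, difference quotients *)

(** Lets dominated convergence, a statement about sequences, prove limits over a
    continuous parameter. *)
Lemma seq_small (R : realType) (V : Type) (N Phi : V -> R) :
  (forall v : nat -> V, (forall k, N (v k) < k.+1%:R^-1) ->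
     Phi (v k) @[k --> \oo] --> 0) ->
  forall e, 0 < e -> exists2 d, 0 < d & forall v, N v < d -> Phi v < e.
Proof.
move=> H e e0; apply: contrapT => /forall2NP nd.
have /choice[v vP] (k : nat) : exists v, N v < k.+1%:R^-1 /\ e <= Phi v.
  have [h|] := nd k.+1%:R^-1; first by case: h; rewrite invr_gt0 ltr0n.
  move=> /existsNP[v /not_implyP[Nv /negP]]; rewrite -leNgt => ev.
  by exists v.
have /cvgrPdist_lt/(_ _ e0)[k _ /(_ k (leqnn _))] := H v (fun k => (vP k).1).
rewrite sub0r normrN => h; have := lt_le_trans h (vP k).2.
by rewrite ltNge ler_norm.
Qed.

Lemma seq_small_neq0 (R : realType) (Phi : R -> R) :
  (forall t : nat -> R, (forall k, t k != 0) -> (forall k, `|t k| < k.+1%:R^-1) ->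
     Phi (t k) @[k --> \oo] --> 0) ->
  forall e, 0 < e -> exists2 d, 0 < d & forall t, t != 0 -> `|t| < d -> Phi t < e.
Proof.
move=> H e e0.
have [|d d0 dP] := @seq_small R {t : R | t != 0} (fun t => `|sval t|)
  (fun t => Phi (sval t)) _ e e0.
  by move=> v vk; apply: H => // k; exact: (svalP (v k)).
by exists d => // t t0 td; exact: (dP (exist _ t t0)).
Qed.

Section translation.
Context {R : realType} {n : nat}.
Local Notation X := 'rV[R]_n.
Local Notation mu := (@lebesgue_rV R n).
Local Notation e_ i := (@basis_rV R n i).
Implicit Types (psi chi g u : X -> R) (x v y : X).

(** The element of the closure of test functions that represents the pairing with g
    differs from g by a function orthogonal to all test functions. *)
Theorem test_dense g : L2 mu g -> exists p : nat -> X -> R,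
  (forall k, test_function (p k)) /\ sq mu (fun x => p k x - g x) @[k --> \oo] --> 0.
Proof.
move=> lg.
have [G [lG Gg [p [tp pG]]]] := @riesz_subspace _ _ R mu (@test_function R n)
   (ip mu g) (sq mu g) test0 (@testD R n) (@testZ R n) (@L2_test R n)
   (fun a b ta tb => ipDr (L2_test ta) (L2_test tb) lg)
   (fun c a ta => ipZr c (L2_test ta) lg)
   (fun a ta => ip_sqr_le lg (L2_test ta)).
have ae0 : {ae mu, forall x, G x - g x = 0}.
  apply: L2_orthogonal_test; first exact: L2B.
  by move=> psi tpsi; rewrite ipBl// ?Gg ?subrr//; exact: L2_test.
exists p; split => //; rewrite (_ : (fun k => _) = (fun k => sq mu (fun x => p k x - G x)))//.
apply/funext => k; have [mp _] := L2_test (tp k).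
apply: sq_ae_eq.
- by apply: measurable_funB => //; case: lg.
- by apply: measurable_funB => //; case: lG.
- by apply: filterS ae0 => x /eqP; rewrite subr_eq0 => /eqP ->.
Qed.

(** By density, test functions suffice to compute a norm by duality. *)
Lemma sq_dual_le g (C : R) : 0 <= C -> L2 mu g ->
  (forall psi, test_function psi -> ip mu g psi ^+ 2 <= C * sq mu psi) -> sq mu g <= C.
Proof.
move=> C0 lg gC; have [p [tp pg]] := test_dense lg.
have lp k := L2_test (tp k).
have c1 := ip_cvg lp lg lg pg; have c2 := sq_cvg lp lg pg.
have c3 : ip mu (p k) g ^+ 2 @[k --> \oo] --> ip mu g g ^+ 2.
  by rewrite expr2; under eq_fun do rewrite expr2; exact: cvgM.
have c4 : C * sq mu (p k) @[k --> \oo] --> C * sq mu g by apply: cvgM => //; exact: cvg_cst.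
have : ip mu g g ^+ 2 <= C * sq mu g.
  rewrite -(cvg_lim _ c3)// -(cvg_lim _ c4)//; apply: ler_lim.
  - by apply/cvg_ex; eexists; exact: c3.
  - by apply/cvg_ex; eexists; exact: c4.
  - by apply: nearW => k; rewrite ipC; exact: gC.
rewrite ipE expr2; have := sq_ge0 mu g; rewrite le_eqVlt => /predU1P[<-//|g0].
by rewrite ler_pM2r.
Qed.

Lemma L2_shift g v : L2 mu g -> L2 mu (fun x => g (x + v)).
Proof.
move=> [mg ig]; have ms := measurableT_comp mg (measurable_shift v).
split => //; case/integrableP : ig => _ ig; apply/integrableP; split.
  by apply/measurable_EFinP; exact: measurable_funX.
rewrite (integral_shift v (g := fun x => `|(g x ^+ 2)%:E|%E))//.
by apply: measurableT_comp => //; apply/measurable_EFinP; exact: measurable_funX.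
Qed.

Lemma Rint_shift g v : measurable_fun setT g -> \int[mu]_x g (x + v) = \int[mu]_x g x.
Proof.
by move=> mg; congr fine; apply: (integral_shift v (g := EFin \o g)); exact/measurable_EFinP.
Qed.

Lemma sq_shift g v : L2 mu g -> sq mu (fun x => g (x + v)) = sq mu g.
Proof.
by move=> [mg _]; apply: (Rint_shift v (g := fun x => g x ^+ 2)); exact: measurable_funX.
Qed.

Lemma ip_shift u g v : L2 mu u -> L2 mu g ->
  ip mu (fun x => u (x + v)) g = ip mu u (fun x => g (x - v)).
Proof.
move=> [mu_ _] [mg _]; rewrite -[LHS](Rint_shift (- v)).
  by apply: eq_Rintegral => x _; rewrite subrK.
by apply: measurable_funM => //; exact: measurableT_comp mu_ (measurable_shift v).
Qed.

Lemma cube_shift (r s : R) x v : `|v| <= s -> cube r (x + v) -> cube (r + s) x.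
Proof.
move=> vs /cubeP xr; apply/cubeP => i; rewrite -[x _ _](addrK (v ord0 i)).
have := xr i; rewrite mxE => h; apply: le_lt_trans (ler_normB _ _) _.
by apply: ltr_leD => //; exact: le_trans (coord_le_norm _ _) vs.
Qed.

(** A common bound for all small translates, for use in dominated convergence. *)
Lemma test_shift_bound psi : test_function psi -> exists M r : R,
  0 <= M /\ forall x v, `|v| <= 1 -> `|psi (x + v)| <= M * \1_(cube r) x.
Proof.
move=> /test_bounded[M [r [M0 r0 Mb]]]; exists M, (r + 1); split => // x v v1.
apply: le_trans (Mb _) _; apply: ler_wpM2l => //.
rewrite !indicE; case: (boolP (x + v \in cube r)) => [/[!inE] xr|_ //].
by rewrite mem_set//; exact: cube_shift xr.
Qed.

Lemma sqr_box_bound (h M : R) (A : set X) x : `|h| <= M * \1_A x ->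
  h ^+ 2 <= M ^+ 2 * \1_A x.
Proof.
rewrite indicE; case: (_ \in _); rewrite ?mulr1 ?mulr0 => hM.
  by rewrite -real_normK ?num_real// lerXn2r ?nnegrE// (le_trans _ hM).
by move: hM; rewrite normr_le0 => /eqP ->; rewrite expr0n.
Qed.

Lemma test_shift_cont psi : test_function psi -> forall e : R, 0 < e ->
  exists2 d, 0 < d & forall v, `|v| < d -> sq mu (fun x => psi (x + v) - psi x) < e.
Proof.
move=> tp; apply: seq_small => v vk.
have [M [r [M0 Mb]]] := test_shift_bound tp.
have cp : continuous psi by apply: smooth_continuous; case: tp.
apply: (sq_dom_cvg (G := fun x => (M + M) ^+ 2 * \1_(cube r) x)).
- by move=> k; apply: measurable_funB; [have [] := L2_shift (v k) (L2_test tp)|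
    have [] := L2_test tp].
- apply: nearW => x.
  have xv : (x + v k : X) @[k --> \oo] --> (x : X).
    apply/cvgrPdist_lt => e e0; near=> k.
    rewrite opprD addrA subrr sub0r normrN; apply: lt_trans (vk k) _.
    near: k; exact: (near_infty_natSinv_lt (PosNum e0)).
  rewrite -(subrr (psi x)); apply: cvgB; last exact: cvg_cst.
  exact: (cvg_comp (fun k => x + v k) psi xv (cp x)).
- exact: rint_box.
- apply: nearW => x k; apply: sqr_box_bound.
  rewrite mulrDl (le_trans (ler_normB _ _))// lerD//.
    by apply: Mb; rewrite (le_trans (ltW (vk k)))// invf_le1// ler1n.
  by have := Mb x 0; rewrite normr0 addr0; exact.
Unshelve. all: by end_near. Qed.

(** Translations are isometries, so continuity passes from test functions to their
    closure. *)
Theorem L2_shift_cont g : L2 mu g -> forall e : R, 0 < e ->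
  exists2 d, 0 < d & forall v, `|v| < d -> sq mu (fun x => g (x + v) - g x) < e.
Proof.
move=> lg e e0.
have [p [tp pg]] := test_dense lg.
have e1 : 0 < e / 12 by rewrite divr_gt0.
have /cvgrPdist_lt/(_ _ e1)[k _ /(_ k (leqnn _))] := pg.
rewrite sub0r normrN ger0_norm ?sq_ge0// => pk.
have [d d0 dP] := test_shift_cont (tp k) e1.
exists d => // v vd; have lp := L2_test (tp k).
have l1 : L2 mu (fun x => p k x - g x) by exact: L2B.
have l2 : L2 mu (fun x => p k (x + v) - p k x) by apply: L2B => //; exact: L2_shift.
have l3 := L2_shift v l1.
have -> : sq mu (fun x => g (x + v) - g x) = sq mu (fun x =>
    ((p k (x + v) - p k x) + (p k x - g x)) - (p k (x + v) - g (x + v))).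
  by apply: eq_Rintegral => x _; congr (_ ^+ 2); ring.
apply: le_lt_trans (sqB_le (L2D l2 l1) l3) _.
have := sqD_le l2 l1; rewrite (sq_shift v l1); have := dP v vd; lra.
Qed.

Lemma norm_line i (s : R) : `|s *: e_ i| <= `|s|.
Proof.
apply/ler_addgt0Pr => q q0; apply/ltW/rV_norm_lt; first by rewrite ltr_wpDl.
move=> j; rewrite !mxE eqxx/=; case: eqP; rewrite ?mulr1 ?mulr0 ?normr0 => _.
  by rewrite ltrDl.
by rewrite ltr_wpDl.
Qed.

(** The mean value theorem bounds the difference quotients on a fixed cube, which
    dominates their pointwise convergence. *)
Lemma test_diffquot psi i : test_function psi -> forall e : R, 0 < e ->
  exists2 d, 0 < d & forall t : R, t != 0 -> `|t| < d ->
    sq mu (fun x => t^-1 * (psi (x + t *: e_ i) - psi x) - 'D_(e_ i) psi x) < e.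
Proof.
move=> tp e e0.
pose Phi t := if t == 0 then 0 else
  sq mu (fun x => t^-1 * (psi (x + t *: e_ i) - psi x) - 'D_(e_ i) psi x).
suff [d d0 dP] : exists2 d, 0 < d & forall t : R, `|t| < d -> Phi t < e.
  by exists d => // t t0 /dP; rewrite /Phi (negbTE t0).
have tdp := test_partial i tp.
have [M [r [M0 Mb]]] := test_shift_bound tdp.
have sp : smooth psi by case: tp.
apply: seq_small e0 => t tk.
pose F k x := if t k == 0 then 0 else
  (t k)^-1 * (psi (x + t k *: e_ i) - psi x) - 'D_(e_ i) psi x.
have -> : (fun k => Phi (t k)) = (fun k => sq mu (F k)).
  apply/funext => k; rewrite /Phi /F; case: eqP => // _.
  rewrite /sq (_ : (fun x => _) = fun=> 0) ?Rintegral_cst ?mul0r//.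
  by apply/funext => x; rewrite expr0n.
have t1 k : `|t k| <= 1 by rewrite (le_trans (ltW (tk k)))// invf_le1// ler1n.
have tc : t k @[k --> \oo] --> (0 : R).
  apply/cvgrPdist_lt => q q0; near=> k.
  rewrite sub0r normrN; apply: lt_trans (tk k) _.
  near: k; exact: (near_infty_natSinv_lt (PosNum q0)).
have ne1 (s : R) (s1 : `|s| <= 1) : `|s *: e_ i| <= 1 by exact: le_trans (norm_line i s) s1.
apply: (sq_dom_cvg (G := fun x => (M + M) ^+ 2 * \1_(cube r) x)).
- move=> k; rewrite /F; case: eqP => // _; apply: measurable_funB; last by have [] := L2_test tdp.
  apply: measurable_funM => //; apply: measurable_funB; last by have [] := L2_test tp.
  by have [] := L2_shift (t k *: e_ i) (L2_test tp).
- apply: nearW => x; have /cvgrPdist_lt dx := smooth_derivable (i := i) (x := x) sp.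
  apply/cvgrPdist_lt => q q0; have dq := dx q q0.
  have : \forall k \near \oo, t k != 0 -> `|'D_(e_ i) psi x -
     (t k)^-1 *: ((psi \o shift x) (t k *: e_ i) - psi x)| < q by exact: (tc _ dq).
  apply: filterS => k; rewrite /F sub0r normrN.
  case: eqP => [_ _|_ /(_ isT)]; first by rewrite normr0.
  by rewrite distrC /= /GRing.scale/= [_ + x]addrC.
- exact: rint_box.
- apply: nearW => x k; apply: sqr_box_bound; rewrite /F; case: eqP => [_|/eqP t0].
    by rewrite normr0 mulr_ge0// addr_ge0.
  have [s [st ->]] := mvt_line i x (t k) sp.
  rewrite mulKf// mulrDl (le_trans (ler_normB _ _))// lerD//.
    by apply: Mb; apply: ne1; exact: le_trans st (t1 k).
  by have := Mb x 0; rewrite normr0 addr0; exact.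
Unshelve. all: by end_near. Qed.

End translation.

(** * Weak derivatives and differentiability in L2 *)

Section sobolev.
Context {R : realType} {n : nat}.
Local Notation X := 'rV[R]_n.
Local Notation mu := (@lebesgue_rV R n).
Local Notation e_ i := (@basis_rV R n i).
Implicit Types (psi chi g u : X -> R) (x v y : X).

Definition weak_partial u g i := forall psi, test_function psi ->
  ip mu u ('D_(e_ i) psi) = - ip mu g psi.

Lemma ip_le_eps u g (e : R) : 0 < e -> L2 mu u -> L2 mu g ->
  sq mu g < e ^+ 2 / (sq mu u + 1) -> `|ip mu u g| < e.
Proof.
move=> e0 lu lg; rewrite ltr_pdivlMr ?ltr_wpDl ?sq_ge0// => h.
rewrite -ltr_sqr ?nnegrE ?(ltW e0)// real_normK ?num_real//.
apply: le_lt_trans (ip_sqr_le lu lg) _; apply: le_lt_trans h.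
by rewrite mulrC ler_wpM2l ?sq_ge0// lerDl.
Qed.

(** The difference quotients of psi converge in L2, hence their pairings with u do. *)
Lemma ip_line_is_derive u psi i (t : R) : L2 mu u -> test_function psi ->
  is_derive t 1 (fun s : R => ip mu u (fun x => psi (x + s *: e_ i)))
    (ip mu u (fun x => 'D_(e_ i) psi (x + t *: e_ i))).
Proof.
move=> lu tp; pose B s := ip mu u (fun x => psi (x + s *: e_ i)).
pose pt := fun x => psi (x + t *: e_ i).
have tpt : test_function pt by exact: test_shift.
have ltest s : L2 mu (fun x => psi (x + s *: e_ i)) by apply: L2_shift; exact: L2_test.
have lD := L2_test (test_partial i tpt).
have DE : (fun x => 'D_(e_ i) psi (x + t *: e_ i)) = 'D_(e_ i) pt.
  by apply/funext => x; rewrite partial_shift.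
have cv : h^-1 *: ((B \o shift t) (h *: (1 : R)) - B t) @[h --> 0^'] -->
    ip mu u ('D_(e_ i) pt).
  apply/cvgrPdist_lt => e e0.
  have e1 : 0 < e ^+ 2 / (sq mu u + 1).
    by rewrite divr_gt0 ?exprn_gt0// ltr_wpDl// sq_ge0.
  have [d d0 dP] := test_diffquot i tpt e1.
  near=> h.
  have h0 : h != 0 by near: h; exact: nbhs_dnbhs_neq.
  have hd : `|h| < d by near: h; exact: dnbhs0_lt.
  have lpt := L2_test tpt; have lpth := L2_shift (h *: e_ i) lpt.
  have lB := L2B lpth lpt; have lq := L2Z h^-1 lB.
  have qE : ip mu u (fun x => h^-1 * (pt (x + h *: e_ i) - pt x)) =
      h^-1 * (ip mu u (fun x => pt (x + h *: e_ i)) - ip mu u pt).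
    by rewrite (ipZr _ lB lu) (ipBr lpth lpt lu).
  have Bth : B (h *: (1 : R) + t) = ip mu u (fun x => pt (x + h *: e_ i)).
    apply: eq_Rintegral => x _; rewrite /pt -addrA -scalerDl.
    by rewrite [h *: (1 : R)]mulr1.
  have QE : h^-1 *: ((B \o shift t) (h *: (1 : R)) - B t) =
      ip mu u (fun x => h^-1 * (pt (x + h *: e_ i) - pt x)) by rewrite qE -Bth.
  rewrite distrC QE -(ipBr lq lD lu).
  exact: (ip_le_eps e0 lu (L2B lq lD) (dP h h0 hd)).
rewrite DE; split; [apply/cvg_ex; eexists; exact: cv|exact: cvg_lim].
Unshelve. all: by end_near. Qed.

(** By the mean value theorem in the length of the translation, pairing the difference
    quotient of u with psi amounts to pairing g, translated by at most |t|, with psi.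
    The bound then follows by duality. *)
Lemma diffquot_le u g i (C t : R) : 0 <= C -> L2 mu u -> L2 mu g ->
  weak_partial u g i -> t != 0 ->
  (forall s : R, `|s| <= `|t| -> sq mu (fun x => g (x + s *: e_ i) - g x) <= C) ->
  sq mu (fun x => t^-1 * (u (x + t *: e_ i) - u x) - g x) <= C.
Proof.
move=> C0 lu lg wug t0 gC.
have lq : L2 mu (fun x => t^-1 * (u (x + t *: e_ i) - u x)).
  by apply: L2Z; apply: L2B => //; exact: L2_shift.
apply: sq_dual_le => //; first exact: L2B.
move=> psi tp; have lp := L2_test tp.
pose B s := ip mu u (fun x => psi (x + s *: e_ i)).
have dB (s : R) := ip_line_is_derive i s lu tp.
have B0 : B 0 = ip mu u psi.
  by apply: eq_Rintegral => x _; rewrite scale0r addr0.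
have [s [st Bs]] := mvt0 dB (- t); rewrite normrN in st.
have gs : ip mu u (fun x => 'D_(e_ i) psi (x + s *: e_ i)) =
    - ip mu (fun x => g (x - s *: e_ i)) psi.
  rewrite (_ : (fun x => 'D_(e_ i) psi _) =
      'D_(e_ i) (fun x => psi (x + s *: e_ i))); last first.
    by apply/funext => x; rewrite partial_shift.
  rewrite wug; last exact: test_shift.
  by rewrite ip_shift// ?opprK//; under eq_fun do rewrite opprK.
have -> : ip mu (fun x => t^-1 * (u (x + t *: e_ i) - u x) - g x) psi =
    ip mu (fun x => g (x - s *: e_ i) - g x) psi.
  rewrite !ipBl//; last 1 first.
    exact: L2_shift.
  congr (_ - _); rewrite ipZl//; last by apply: L2B => //; exact: L2_shift.
  rewrite ipBl//; last exact: L2_shift.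
  rewrite ip_shift// -B0; apply: (mulfI t0); rewrite mulVKf//.
  rewrite (_ : ip mu u (fun x => psi (x - t *: e_ i)) = B (- t)).
    by rewrite [B _ - _]Bs gs mulrN mulNr opprK.
  by apply: eq_Rintegral => x _; rewrite scaleNr.
apply: le_trans (ip_sqr_le _ lp) _.
  by apply: L2B => //; exact: L2_shift.
rewrite ler_wpM2r ?sq_ge0//; have := gC (- s); rewrite normrN => /(_ st).
by under [X in sq mu X <= _ -> _]eq_fun do rewrite scaleNr.
Qed.

(** The last clause provides the domination when difference quotients are averaged over
    directions. *)
Definition L2_differentiable u (G : 'I_n -> X -> R) :=
  [/\ L2 mu u, forall i, L2 mu (G i),
    forall i (e : R), 0 < e -> exists2 d, 0 < d & forall t : R, t != 0 -> `|t| < d ->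
      sq mu (fun x => t^-1 * (u (x + t *: e_ i) - u x) - G i x) < e &
    exists2 C : R, 0 <= C & forall i (t : R),
      sq mu (fun x => u (x + t *: e_ i) - u x) <= C * t ^+ 2].

(** [diffquot_le] is used twice: with the modulus of continuity of G i under
    translations, for the limit, and with the crude bound 4 |G i|^2, for the uniform
    estimate. *)
Lemma weak_L2_differentiable u (G : 'I_n -> X -> R) : L2 mu u ->
  (forall i, L2 mu (G i)) -> (forall i, weak_partial u (G i) i) ->
  L2_differentiable u G.
Proof.
move=> lu lG wG; split => // [i e e0|].
  have e1 : 0 < e / 2 by rewrite divr_gt0.
  have [d d0 dP] := L2_shift_cont (lG i) e1.
  exists d => // t t0 td; apply: (@le_lt_trans _ _ (e / 2)); last by lra.
  apply: diffquot_le => //; first exact: ltW.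
  move=> s st; apply/ltW/dP; apply: le_lt_trans (norm_line i s) _.
  exact: le_lt_trans st td.
(* 10 = 2 * 4 + 2: the error is at most 4 |G i|^2, and |G i|^2 is added to it *)
pose C := \sum_j 10 * sq mu (G j).
have Ci i : 10 * sq mu (G i) <= C.
  rewrite /C (bigD1 i)//= lerDl; apply: sumr_ge0 => j _.
  by rewrite mulr_ge0// sq_ge0.
exists C.
  by apply: sumr_ge0 => j _; rewrite mulr_ge0// sq_ge0.
move=> i t; have [->|t0] := eqVneq t 0.
  rewrite expr0n mulr0 (_ : (fun x => _) = fun=> 0).
    by rewrite /sq Rintegral_cst// expr0n mul0r.
  by apply/funext => x; rewrite scale0r addr0 subrr.
have lq : L2 mu (fun x => t^-1 * (u (x + t *: e_ i) - u x)).
  by apply: L2Z; apply: L2B => //; exact: L2_shift.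
have h : sq mu (fun x => t^-1 * (u (x + t *: e_ i) - u x) - G i x) <= 4 * sq mu (G i).
  apply: diffquot_le => //; first by rewrite mulr_ge0// sq_ge0.
  move=> s _; apply: le_trans (sqB_le (L2_shift _ (lG i)) (lG i)) _.
  by rewrite sq_shift//; lra.
have -> : (fun x => u (x + t *: e_ i) - u x) =
    (fun x => t * ((t^-1 * (u (x + t *: e_ i) - u x) - G i x) + G i x)).
  by apply/funext => x; rewrite subrK mulVKf.
rewrite sqZ; last by under eq_fun do rewrite subrK.
rewrite mulrC ler_wpM2r ?sqr_ge0//; apply: le_trans (Ci i).
by apply: le_trans (sqD_le (L2B lq (lG i)) (lG i)) _; lra.
Qed.

(** Integration by parts: the difference quotient of step t of one function is moved to
    the quotient of step -t of the other by translation invariance. *)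
Lemma test_weak_partial psi i : test_function psi -> weak_partial psi ('D_(e_ i) psi) i.
Proof.
move=> tp chi tc; have lp := L2_test tp; have lc := L2_test tc.
have lDp := L2_test (test_partial i tp); have lDc := L2_test (test_partial i tc).
apply/eqP; rewrite -subr_eq0 opprK -normr_le0; apply/ler_addgt0Pr => e e0; rewrite add0r.
have e2 : 0 < e / 2 by rewrite divr_gt0.
have e1 g : 0 < (e / 2) ^+ 2 / (sq mu g + 1).
  by rewrite divr_gt0 ?exprn_gt0// ltr_wpDl// sq_ge0.
have [d d0 dP] := test_diffquot i tc (e1 psi).
have [d' d'0 d'P] := test_diffquot i tp (e1 chi).
pose t := Num.min d d' / 2.
have t0 : 0 < t by rewrite divr_gt0// lt_min d0.
have td : `|t| < d.
  by rewrite gtr0_norm// /t; have : Num.min d d' <= d by [rewrite ge_min lexx]; lra.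
have td' : `|- t| < d'.
  rewrite normrN gtr0_norm// /t.
  by have : Num.min d d' <= d' by [rewrite ge_min lexx orbT]; lra.
have tn : - t != 0 by rewrite oppr_eq0 gt_eqF.
have lq1 : L2 mu (fun x => t^-1 * (chi (x + t *: e_ i) - chi x)).
  by apply: L2Z; apply: L2B => //; exact: L2_shift.
have lq2 : L2 mu (fun x => (- t)^-1 * (psi (x + - t *: e_ i) - psi x)).
  by apply: L2Z; apply: L2B => //; exact: L2_shift.
have := ip_le_eps e2 lp (L2B lq1 lDc) (dP t (lt0r_neq0 t0) td).
have := ip_le_eps e2 lc (L2B lq2 lDp) (d'P _ tn td').
rewrite !ipBr// !ipZr//; try by apply: L2B => //; exact: L2_shift.
rewrite !ipBr//; try exact: L2_shift.
rewrite (ipC mu chi (fun x => psi (x + - t *: e_ i))) ip_shift//.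
rewrite (_ : (fun x => chi (x - - t *: e_ i)) = (fun x => chi (x + t *: e_ i))); last first.
  by apply/funext => x; rewrite scaleNr opprK.
rewrite (ipC mu chi psi) (ipC mu chi ('D_(e_ i) psi)) invrN mulNr.
rewrite !ltr_norml => /andP[? ?] /andP[? ?].
by rewrite ler_norml; apply/andP; split; lra.
Qed.

Lemma test_L2_differentiable psi : test_function psi ->
  L2_differentiable psi (fun i => 'D_(e_ i) psi).
Proof.
move=> tp; apply: weak_L2_differentiable; first exact: L2_test.
- by move=> i; apply: L2_test; exact: test_partial.
- by move=> i; exact: test_weak_partial.
Qed.

End sobolev.

(** * Hyperplanes are null sets *)

Section hyperplane.
Context {R : realType} {n : nat}.
Local Notation X := 'rV[R]_n.
Local Notation mu := (@lebesgue_rV R n).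

Definition dotv (w y : X) : R := \sum_i w ord0 i * y ord0 i.

Lemma measurable_dotv (w : X) : measurable_fun setT (dotv w).
Proof.
apply: measurable_sum => i; apply: measurable_funM => //; exact: measurable_coord.
Qed.

Lemma dotv_shift (w y : X) i (s : R) : dotv w (y + s *: basis_rV i) = dotv w y + s * w ord0 i.
Proof.
rewrite /dotv (bigD1 i)//= [in RHS](bigD1 i)//= !mxE !eqxx/= mulr1 mulrDr.
rewrite -!addrA; congr (_ + _); rewrite addrC mulrC; congr (_ + _).
by apply: eq_bigr => j ji; rewrite !mxE eqxx (negbTE ji) mulr0 addr0.
Qed.

(** Infinitely many disjoint translates of a bounded piece of the hyperplane, all of the
    same measure, fit into one cube. *)
Lemma hyperplane_null (w : X) : w != 0 -> mu.-negligible [set y | dotv w y = 0].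
Proof.
move=> w0.
have [i wi] : exists i, w ord0 i != 0.
  apply: contrapT => /forallNP h; move/eqP: w0; apply; apply/rowP => i.
  by rewrite mxE; apply/eqP; apply: contrapT => /negP; exact: h.
have mH : measurable [set y | dotv w y = 0].
  have := measurable_funTP (measurable_dotv w) (measurable_set1 0).
  by [].
pose H k := [set y | dotv w y = 0] `&` @cube R n k%:R.
have mHk k : measurable (H k) by apply: measurableI => //; exact: measurable_obox.
suff H0 k : mu (H k) = 0%E.
  apply: (negligibleS (A := \bigcup_k H k)) => [y y0|].
    have [k _ ky] : (\bigcup_k @cube R n k%:R) y by rewrite bigcup_cube.
    by exists k.
  by apply: negligible_bigcup => k; exists (H k); split.
(* translates along an axis that is transverse to the hyperplane *)
pose F m := (fun y : X => y + (- m.+1%:R^-1 *: basis_rV i)) @^-1` H k.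
have mF m : measurable (F m) by apply: measurable_funTP => //; exact: measurable_shift.
have muF m : mu (F m) = mu (H k).
  rewrite (scales_boxes_measure ler01 (measurable_shift _))// ?mul1e//.
  exact: scales_boxes_shift.
have tF : trivIset setT F.
  move=> m m' _ _ [y [[ym _] [ym' _]]]; apply/eqP.
  move: ym ym'; rewrite /= !dotv_shift => /eqP + /eqP.
  rewrite !mulNr !subr_eq0 => /eqP -> /eqP /(mulIf wi) /invr_inj /eqP.
  by rewrite eqr_nat eqSS.
have sF : \bigcup_m F m `<=` @cube R n (k%:R + 1).
  move=> y [m _ [_]]; apply: cube_shift; rewrite scaleNr normrN.
  apply: le_trans (norm_line _ _) _; rewrite ger0_norm ?invr_ge0// invf_le1 ?ltr0n//.
  by rewrite ler1n.
have : (mu (\bigcup_m F m) < +oo)%E.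
  apply: le_lt_trans (lebesgue_obox_lty (const_mx (- (k%:R + 1))) (const_mx (k%:R + 1))).
  by apply: le_measure; rewrite ?inE//; [exact: bigcup_measurable|exact: measurable_obox].
rewrite measure_bigcup//.
have Hfin : (mu (H k) < +oo)%E.
  apply: (@le_lt_trans _ _ (mu (@cube R n k%:R))); last exact: lebesgue_obox_lty.
  by apply: le_measure; rewrite ?inE//; [exact: measurable_obox|move=> y []].
have HE : mu (H k) = (fine (mu (H k)))%:E by rewrite fineK// ge0_fin_numE.
rewrite (eq_eseriesr (fun m _ => etrans (muF m) HE)).
rewrite (eq_eseriesl (Q := xpredT)) => [hs|m]; last by rewrite in_setT.
have c0 : 0 <= fine (mu (H k)) by rewrite fine_ge0.
have /cvg_series_cvg_0 := nnseries_is_cvg (fun=> c0) hs.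
move=> /cvg_lim; rewrite lim_cst// => hk.
by rewrite HE hk.
Qed.

End hyperplane.

(** * Difference quotients in all directions *)

Section directions.
Context {R : realType} {n : nat}.
Local Notation X := 'rV[R]_n.
Local Notation mu := (@lebesgue_rV R n).
Local Notation e_ i := (@basis_rV R n i).
Implicit Types (psi chi g u : X -> R) (x v y : X).

Definition vanish (F : R -> X -> R) := forall e : R, 0 < e ->
  exists2 d, 0 < d & forall t : R, t != 0 -> `|t| < d -> sq mu (F t) < e.

Lemma vanishD (F G : R -> X -> R) :
  (forall t, L2 mu (F t)) -> (forall t, L2 mu (G t)) ->
  vanish F -> vanish G -> vanish (fun t x => F t x + G t x).
Proof.
move=> lF lG vF vG e e0; have e1 : 0 < e / 4 by rewrite divr_gt0.
have [d d0 dP] := vF _ e1; have [d' d'0 d'P] := vG _ e1.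
exists (Num.min d d'); first by rewrite lt_min d0.
move=> t t0; rewrite lt_min => /andP[td td'].
apply: le_lt_trans (sqD_le (lF t) (lG t)) _.
by have := dP t t0 td; have := d'P t t0 td'; lra.
Qed.

Lemma vanishZ (c : R) (F : R -> X -> R) : (forall t, L2 mu (F t)) ->
  vanish F -> vanish (fun t x => c * F t x).
Proof.
move=> lF vF e e0; have e1 : 0 < e / (c ^+ 2 + 1).
  by rewrite divr_gt0// ltr_wpDl// sqr_ge0.
have [d d0 dP] := vF _ e1; exists d => // t t0 td.
rewrite sqZ//; have := dP t t0 td; rewrite ltr_pdivlMr ?ltr_wpDl ?sqr_ge0//.
by apply: le_lt_trans; rewrite mulrC ler_wpM2l ?sq_ge0// lerDl.
Qed.

Lemma vanish_shift (F : R -> X -> R) (v : R -> X) : (forall t, L2 mu (F t)) ->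
  vanish F -> vanish (fun t x => F t (x + v t)).
Proof.
move=> lF vF e e0; have [d d0 dP] := vF _ e0.
by exists d => // t t0 td; rewrite sq_shift//; exact: dP.
Qed.

Lemma vanish_scale (c : R) (F : R -> X -> R) : c != 0 -> vanish F ->
  vanish (fun t => F (t * c)).
Proof.
move=> c0 vF e e0; have [d d0 dP] := vF _ e0.
exists (d / `|c|); first by rewrite divr_gt0// normr_gt0.
move=> t t0; rewrite ltr_pdivlMr ?normr_gt0// -normrM => td.
by apply: dP => //; rewrite mulf_neq0.
Qed.

Lemma eq_vanish (F G : R -> X -> R) : (forall t x, t != 0 -> F t x = G t x) ->
  vanish F -> vanish G.
Proof.
move=> FG vF e e0; have [d d0 dP] := vF _ e0; exists d => // t t0 td.
rewrite (_ : G t = F t); first exact: dP.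
by apply/funext => x; rewrite FG.
Qed.

Lemma vanish_translation g v : L2 mu g -> vanish (fun t x => g (x + t *: v) - g x).
Proof.
move=> lg e e0; have [d d0 dP] := L2_shift_cont lg e0.
exists (d / (`|v| + 1)); first by rewrite divr_gt0// ltr_wpDl.
move=> t t0; rewrite ltr_pdivlMr ?ltr_wpDl// => td; apply: dP.
rewrite normrZ; apply: le_lt_trans td.
by rewrite ler_wpM2l// lerDl.
Qed.

Lemma sq_sum_le (I : Type) (s : seq I) (F : I -> X -> R) : (forall i, L2 mu (F i)) ->
  sq mu (fun x => \sum_(i <- s) F i x) <= 2 ^+ size s * \sum_(i <- s) sq mu (F i).
Proof.
move=> lF; elim: s => [|i s ih].
  rewrite big_nil mulr0; under eq_fun do rewrite big_nil.
  by rewrite /sq Rintegral_cst// expr0n mul0r.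
under eq_fun do rewrite big_cons.
apply: le_trans (sqD_le (lF i) (L2_sum s lF)) _.
rewrite big_cons mulrDr /= exprS lerD//.
  rewrite -mulrA ler_wpM2l// ler_peMl ?sq_ge0//.
  by rewrite exprn_ege1// ler1n.
by rewrite -mulrA ler_wpM2l.
Qed.

Variables (u : X -> R) (G : 'I_n -> X -> R).
Hypothesis uG : L2_differentiable u G.

Let lu : L2 mu u. Proof. by case: uG. Qed.
Let lG i : L2 mu (G i). Proof. by case: uG. Qed.

Definition partial_sum_rV (s : seq 'I_n) (y : X) : X :=
  \sum_(i <- s) y ord0 i *: e_ i.

Lemma partial_sum_rV_full y : partial_sum_rV (index_enum 'I_n) y = y.
Proof. by rewrite [RHS]row_sum_delta. Qed.

(** A step along several axes is a step along all but one of them followed by a step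
    along the last. The quotient of the last step is taken at a translated point, which
    is harmless since translations are continuous in L2. *)
Lemma vanish_dir_seq (s : seq 'I_n) y :
  vanish (fun t x => t^-1 * (u (x + t *: partial_sum_rV s y) - u x) -
    \sum_(i <- s) y ord0 i * G i x).
Proof.
elim: s => [|i s ih].
  apply: (@eq_vanish (fun _ _ => 0)) => [t x _|e e0].
    by rewrite /partial_sum_rV !big_nil scaler0 addr0 subrr mulr0 subr0.
  by exists 1 => // t _ _; rewrite /sq Rintegral_cst// expr0n mul0r.
pose v := partial_sum_rV s y.
have lS : L2 mu (fun x => \sum_(i <- s) y ord0 i * G i x).
  by apply: L2_sum => j; exact: L2Z.
have lsh w : L2 mu (fun x => u (x + w)) by exact: L2_shift.
have lq t : L2 mu (fun x => t^-1 * (u (x + t *: v) - u x) - \sum_(i <- s) y ord0 i * G i x).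
  by apply: L2B => //; apply: L2Z; exact: L2B.
have lgs t : L2 mu (fun x => y ord0 i * (G i (x + t *: v) - G i x)).
  by apply: L2Z; apply: L2B => //; exact: L2_shift.
have v2 := vanishZ (y ord0 i) (fun t => L2B (L2_shift (t *: v) (lG i)) (lG i))
  (vanish_translation v (lG i)).
have [yi0|yi0] := eqVneq (y ord0 i) 0.
  apply: eq_vanish ih => t x t0.
  by rewrite /partial_sum_rV !big_cons yi0 scale0r add0r mul0r add0r.
have lqi (t : R) : L2 mu (fun x => t^-1 * (u (x + t *: e_ i) - u x) - G i x).
  by apply: L2B => //; apply: L2Z; exact: L2B.
have vi : vanish (fun t x => t^-1 * (u (x + t *: e_ i) - u x) - G i x).
  by case: uG => _ _ + _; exact.
have v1 := @vanish_shift _ (fun t => t *: v)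
   (fun t => lqi (t * y ord0 i)) (vanish_scale yi0 vi).
have v1' := vanishZ (y ord0 i) (fun t => L2_shift (t *: v) (lqi (t * y ord0 i))) v1.
have l1 t := L2Z (y ord0 i) (L2_shift (t *: v) (lqi (t * y ord0 i))).
have v12 := vanishD l1 lgs v1' v2.
have := vanishD (fun t => L2D (l1 t) (lgs t)) lq v12 ih.
apply: eq_vanish => t x t0; rewrite /partial_sum_rV !big_cons -/(partial_sum_rV s y) -/v.
rewrite scalerDr scalerA (addrC (_ *: e_ i)) (addrA x).
by field; rewrite t0 yi0.
Qed.

Lemma vanish_dir y :
  vanish (fun t x => t^-1 * (u (x + t *: y) - u x) - \sum_i y ord0 i * G i x).
Proof. by have := vanish_dir_seq (index_enum 'I_n) y; rewrite partial_sum_rV_full. Qed.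

Lemma dir_bound : exists2 C : R, 0 <= C & forall y (t : R),
  sq mu (fun x => u (x + t *: y) - u x) <= C * t ^+ 2 * \sum_i y ord0 i ^+ 2.
Proof.
have [_ _ _ [C C0 Cb]] := uG.
suff H (s : seq 'I_n) : exists2 D : R, 0 <= D & forall y (t : R),
  sq mu (fun x => u (x + t *: partial_sum_rV s y) - u x) <=
    D * t ^+ 2 * \sum_(i <- s) y ord0 i ^+ 2.
  have [D D0 Db] := H (index_enum 'I_n); exists D => // y t.
  by have := Db y t; rewrite partial_sum_rV_full.
elim: s => [|i s [D D0 Db]].
  exists 0 => // y t; rewrite !mul0r (_ : (fun x => _) = fun=> 0).
    by rewrite /sq Rintegral_cst// expr0n mul0r.
  by apply/funext => x; rewrite /partial_sum_rV big_nil scaler0 addr0 subrr.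
exists (2 * C + 2 * D); first by rewrite addr_ge0// mulr_ge0.
move=> y t; set v := partial_sum_rV s y.
have lsh w : L2 mu (fun x => u (x + w)) by exact: L2_shift.
have E : (fun x => u (x + t *: partial_sum_rV (i :: s) y) - u x) =
   (fun x => (fun z => u (z + (t * y ord0 i) *: e_ i) - u z) (x + t *: v) + (u (x + t *: v) - u x)).
  apply/funext => x; rewrite /partial_sum_rV big_cons -/(partial_sum_rV s y) -/v.
  by rewrite scalerDr scalerA (addrC (_ *: e_ i)) addrA addrA subrK.
rewrite E; apply: le_trans (sqD_le (L2_shift _ (L2B (lsh _) lu)) (L2B (lsh _) lu)) _.
rewrite (sq_shift (t *: v) (L2B (lsh _) lu)).
have h1 := Cb i (t * y ord0 i); have h2 := Db y t; rewrite exprMn in h1.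
rewrite big_cons.
have Y0 : 0 <= \sum_(j <- s) y ord0 j ^+ 2 by apply: sumr_ge0 => j _; rewrite sqr_ge0.
set Y := \sum_(j <- s) _ in h2 Y0 *; set a := y ord0 i ^+ 2 in h1 *.
have a0 : 0 <= a by rewrite sqr_ge0.
have t0 : 0 <= t ^+ 2 by rewrite sqr_ge0.
have p1 := mulr_ge0 (mulr_ge0 C0 t0) Y0; have p2 := mulr_ge0 (mulr_ge0 D0 t0) a0.
rewrite -/v in h2; nra.
Qed.

End directions.

Section product_quotients.
Context {R : realType} {n : nat}.
Local Notation X := 'rV[R]_n.
Local Notation mu := (@lebesgue_rV R n).
Variable P : probability X R.
Hypothesis P2 : forall i, L2 P (fun y : X => y ord0 i).
Local Notation mm := (mu \x P)%E.
Implicit Types (psi chi g u : X -> R) (x v y : X).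

Definition dir_deriv (G : 'I_n -> X -> R) (z : X * X) : R :=
  \sum_i G i z.1 * z.2 ord0 i.

Lemma L2_dir_deriv (G : 'I_n -> X -> R) : (forall i, L2 mu (G i)) -> L2 mm (dir_deriv G).
Proof.
move=> lG; apply: L2_sum => i; exact: (L2_prod (lG i) (P2 i)).
Qed.

Lemma L2_shear_fst u (t : R) : L2 mu u -> L2 mm (fun z => u (z.1 + t *: z.2)).
Proof.
move=> lu; have := L2_shear (- t) (L2_fst P lu); congr (L2 _ _).
by apply/funext => z; rewrite /= scaleNr opprK.
Qed.

Variables (u : X -> R) (G : 'I_n -> X -> R).
Hypothesis uG : L2_differentiable u G.
Let lu : L2 mu u. Proof. by case: uG. Qed.
Let lG i : L2 mu (G i). Proof. by case: uG. Qed.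

Definition prod_quot (t : R) (z : X * X) : R := t^-1 * (u (z.1 + t *: z.2) - u z.1).

Lemma L2_prod_quot t : L2 mm (prod_quot t).
Proof.
by apply: L2Z; apply: L2B; [exact: L2_shear_fst|exact: L2_fst].
Qed.

(** For fixed y this is [vanish_dir]; by [dir_bound] the slices are dominated by a
    multiple of |y|^2, which is P-integrable. *)
Theorem prod_quot_vanish (e : R) : 0 < e -> exists2 d, 0 < d &
  forall t, t != 0 -> `|t| < d ->
    sq mm (fun z => prod_quot t z - dir_deriv G z) < e.
Proof.
move: e; apply: seq_small_neq0 => t t0 tk.
have [C C0 Cb] := dir_bound uG.
(* 2 C bounds the quotients, the other term bounds the directional derivative *)
pose K := 2 * C + 2 * (2 ^+ n * \sum_i sq mu (G i)).
have K0 : 0 <= K.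
  rewrite addr_ge0// !mulr_ge0// ?exprn_ge0//; apply: sumr_ge0 => i _; exact: sq_ge0.
have lslice k y : L2 mu (fun x => (t k)^-1 * (u (x + t k *: y) - u x)).
  by apply: L2Z; apply: L2B => //; exact: L2_shift.
have lsum y : L2 mu (fun x => \sum_i G i x * y ord0 i).
  apply: L2_sum => i; under eq_fun do rewrite mulrC; exact: L2Z.
apply: (@slice_cvg0 _ _ P _ (fun y => K * \sum_i y ord0 i ^+ 2)).
- move=> k; apply: L2B; [exact: L2_prod_quot|exact: L2_dir_deriv].
- apply: rintZ; rewrite /rint (_ : _ \o _ = (fun y => \sum_i (y ord0 i ^+ 2)%:E)%E).
    by apply: integrable_sum => // i _; case: (P2 i).
  by apply/funext => y /=; rewrite sumEFin.
- by move=> k y; exact: (L2B (lslice k y) (lsum y)).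
- move=> k y; apply: le_trans (sqB_le (lslice k y) (lsum y)) _.
  have h1 := Cb y (t k).
  rewrite sqZ; last by apply: L2B => //; exact: L2_shift.
  have h2 : (t k)^-1 ^+ 2 * sq mu (fun x => u (x + t k *: y) - u x) <=
      C * \sum_i y ord0 i ^+ 2.
    rewrite exprVn (mulrC (_^-1)) ler_pdivrMr; last by rewrite exprn_even_gt0//= t0.
    by rewrite mulrAC.
  have h3 : sq mu (fun x => \sum_i G i x * y ord0 i) <=
      2 ^+ n * (\sum_i sq mu (G i)) * (\sum_i y ord0 i ^+ 2).
    apply: le_trans (sq_sum_le _ _) _ => [i|].
      by under eq_fun do rewrite mulrC; exact: L2Z.
    rewrite (_ : size _ = n); last by rewrite -[RHS](card_ord n) cardT enumT.
    rewrite -mulrA.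
    rewrite ler_wpM2l ?exprn_ge0// mulr_suml; apply: ler_sum => i _.
    rewrite [X in sq mu X](_ : _ = (fun x => y ord0 i * G i x)); last first.
      by apply/funext => x; rewrite mulrC.
    rewrite sqZ// mulrC ler_wpM2l ?sq_ge0// (bigD1 i)//= lerDl.
    by apply: sumr_ge0 => j _; rewrite sqr_ge0.
  apply: le_trans (lerD (ler_wpM2l (ler0n R 2) h2) (ler_wpM2l (ler0n R 2) h3)) _.
  by rewrite /K [leRHS]mulrDl !mulrA.
- move=> y; have vy := vanish_dir uG y.
  apply/cvgrPdist_lt => e e0; have [d d0 dP] := vy e e0.
  near=> k; rewrite sub0r normrN ger0_norm ?sq_ge0//.
  rewrite [X in sq mu X](_ : _ = (fun x => (t k)^-1 * (u (x + t k *: y) - u x) -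
     \sum_i y ord0 i * G i x)).
    apply: dP => //; apply: lt_trans (tk k) _.
    near: k; exact: (near_infty_natSinv_lt (PosNum d0)).
  by apply/funext => x; rewrite /dir_deriv; congr (_ - _); apply: eq_bigr => i _; rewrite mulrC.
Unshelve. all: by end_near. Qed.

End product_quotients.

(** * Existence of the weak gradient *)

Section fluctuation.
Context {R : realType} {n : nat}.
Local Notation X := 'rV[R]_n.
Local Notation mu := (@lebesgue_rV R n).
Local Notation e_ i := (@basis_rV R n i).
Variable P : probability X R.
Hypothesis P2 : forall i, L2 P (fun y : X => y ord0 i).
Hypothesis P1 : forall i, \int[P]_y (y ord0 i) = 0.
Hypothesis Pmu : P `<< mu.
Local Notation mm := (mu \x P)%E.
Implicit Types (psi chi g u : X -> R) (x v w y : X).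

Definition moments : 'M[R]_n := \matrix_(i, j) \int[P]_y (y ord0 i * y ord0 j).

Lemma L2_dotv w : L2 P (dotv w).
Proof. by apply: L2_sum => i; apply: L2Z. Qed.

Lemma mean_dotv w : \int[P]_y dotv w y = 0.
Proof.
have l1 : L2 P (fun=> 1) by split => //; exact: rint_cstP.
rewrite (_ : \int[P]_y _ = ip P (dotv w) (fun=> 1)); last first.
  by apply: eq_Rintegral => y _; rewrite mulr1.
rewrite ip_suml// => [|i]; last exact: L2Z.
apply: big1 => i _; rewrite ipZl// (_ : ip P _ _ = 0) ?mulr0//.
by rewrite -(P1 i); apply: eq_Rintegral => y _; rewrite mulr1.
Qed.

Lemma ip_dotv_coord w j : ip P (dotv w) (fun y => y ord0 j) = (w *m moments) ord0 j.
Proof.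
rewrite ip_suml// => [|i]; last exact: L2Z.
by rewrite mxE; apply: eq_bigr => i _; rewrite ipZl// mxE.
Qed.

(** If v is in the kernel, then v . y has second moment 0, so P is concentrated on the
    vectors orthogonal to v; these form a null set unless v = 0. *)
Lemma moments_unit : moments \in unitmx.
Proof.
rewrite -row_free_unit -kermx_eq0; apply/rowV0P => v /sub_kermxP vM.
apply/eqP; apply: contraT => v0.
have s0 : sq P (dotv v) = 0.
  rewrite -ipE {2}/dotv ip_sumr; [|by move=> i; exact: L2Z|exact: L2_dotv].
  apply: big1 => i _; rewrite ipZr//; last exact: L2_dotv.
  by rewrite ip_dotv_coord vM mxE mulr0.
have ae0 : {ae P, forall y, dotv v y = 0}.
  have [mv iv] := L2_dotv v.
  have : (\int[P]_y `|(dotv v y ^+ 2)%:E| = 0)%E.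
    rewrite (eq_integral (fun y => (dotv v y ^+ 2)%:E)) => [|y _].
      rewrite -[LHS]fineK; first by congr EFin; exact: s0.
      exact: integrable_fin_num.
    by rewrite gee0_abs// lee_fin sqr_ge0.
  move/(ae_eq_integral_abs _ measurableT); case.
    by apply/measurable_EFinP; exact: measurable_funX.
  move=> N [mN N0 sN]; exists N; split => // y yN; apply: sN => /= h.
  by apply: yN; have /eqP := h I; rewrite eqe sqrf_eq0 => /eqP.
have [N [mN N0 sN]] := hyperplane_null v0.
have PN : P N = 0%E := (null_content_dominatesP _ _).1 Pmu N mN N0.
have [N' [mN' PN' sN']] := ae0.
have : (P setT <= P N + P N')%E.
  apply: le_trans (measureU2 _ mN mN').
  apply: le_measure; rewrite ?inE//; first exact: measurableU.
  move=> y _; have [hy|hy] := pselect (dotv v y = 0).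
    by left; apply: sN.
  by right; apply: sN'.
by rewrite PN PN' probability_setT add0e lee_fin ler10.
Qed.

Definition uavg u (e : R) : X -> R := avg P (fun z => u (z.1 - e *: z.2)).

Definition fluct u (e : R) (z : X * X) : R := u (z.1 - e *: z.2) - uavg u e z.1.

Lemma L2_shear_sub u (e : R) : L2 mu u -> L2 mm (fun z => u (z.1 - e *: z.2)).
Proof. by move=> lu; exact: (L2_shear e (L2_fst P lu)). Qed.

Lemma L2_uavg u e : L2 mu u -> L2 mu (uavg u e).
Proof. by move=> lu; have [] := avg_L2 (L2_shear_sub e lu). Qed.

Lemma L2_fluct u e : L2 mu u -> L2 mm (fluct u e).
Proof.
by move=> lu; apply: L2B; [exact: L2_shear_sub|exact/L2_fst/L2_uavg].
Qed.

(** Because y has mean 0, functions of x alone are orthogonal to all h(x) (w . y). *)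
Lemma ip_prod_dotv g h w : L2 mu g -> L2 mu h ->
  ip mm (fun z => g z.1) (fun z => h z.1 * dotv w z.2) = 0.
Proof.
move=> lg lh; rewrite (_ : ip mm _ _ = \int[mm]_z (g z.1 * h z.1 * dotv w z.2)).
  rewrite (Rint_prod (g := fun x => g x * h x)); first by rewrite mean_dotv mulr0.
    exact: L2_mul_integrable.
  by have [] := avg_sqr_le (L2_dotv w).1 (L2_dotv w).2.
by apply: eq_Rintegral => z _; rewrite mulrA.
Qed.

(** The shear moves the translation from u to psi. By [ip_prod_dotv], u_e can be dropped
    on the left, and psi(x) subtracted on the right to form a difference quotient. *)
Lemma fluct_pairing u psi w (e : R) : L2 mu u -> L2 mu psi -> e != 0 ->
  ip mm (fluct u e) (fun z => psi z.1 * dotv w z.2) =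
  e * ip mm (fun z => u z.1 * dotv w z.2) (prod_quot psi e).
Proof.
move=> lu lp e0.
have lpw := L2_prod lp (L2_dotv w); have luw := L2_prod lu (L2_dotv w).
have lq := L2_shear_fst P e lp.
rewrite (ipBl (L2_shear_sub e lu) (L2_fst P (L2_uavg e lu)) lpw).
rewrite ip_prod_dotv//; last exact: L2_uavg.
rewrite subr0 -ipZr//; last first.
  by apply: L2Z; apply: L2B => //; exact: L2_fst.
transitivity (ip mm (fun z => u z.1 * dotv w z.2) (fun z => psi (z.1 + e *: z.2))).
  rewrite /ip -[RHS](Rintegral_shear P e); last first.
    by apply: measurable_funM; [case: luw|case: lq].
  by apply: eq_Rintegral => z _ /=; rewrite subrK; ring.
rewrite (_ : (fun z => e * _) = (fun z => psi (z.1 + e *: z.2) - psi z.1)); last first.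
  by apply/funext => z; rewrite /prod_quot mulrA divff// mul1r.
rewrite ipBr//; last exact: L2_fst.
rewrite [X in _ - X]ipC ip_prod_dotv// subr0//.
Qed.

Lemma ip_dir_deriv u w (G : 'I_n -> X -> R) : L2 mu u -> (forall i, L2 mu (G i)) ->
  ip mm (fun z => u z.1 * dotv w z.2) (dir_deriv G) =
  \sum_j ip mu u (G j) * (w *m moments) ord0 j.
Proof.
move=> lu lG; rewrite ip_sumr => [|j|]; first last.
- exact: L2_prod (L2_dotv w).
- exact: L2_prod (P2 j).
apply: eq_bigr => j _; rewrite -ip_dotv_coord -Rint_prod.
- by apply: eq_Rintegral => z _; ring.
- exact: L2_mul_integrable.
- exact: L2_mul_integrable (L2_dotv w) (P2 j).
Qed.

Lemma sum_select (a c : 'I_n -> R) i : (forall j, c j = (j == i)%:R) ->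
  \sum_j a j * c j = a i.
Proof.
move=> cE; rewrite (bigD1 i)//= cE eqxx mulr1 big1 ?addr0// => j ji.
by rewrite cE (negbTE ji) mulr0.
Qed.

Section energy_bound.
Variables (u : X -> R) (C : R).
Hypothesis lu : L2 mu u.
Hypothesis bound : forall d, 0 < d -> exists e, [/\ 0 < e, e < d & sq mm (fluct u e) <= C * e ^+ 2].

(** By [fluct_pairing], the pairing of the fluctuation with psi(x) (w . y), divided by
    e, tends to the sum over j of (w A)_j times the pairing of u with the j-th
    derivative of psi; the assumed bound on the fluctuation controls it by the norm of
    psi. The row w is chosen so that w A is the i-th basis vector. *)
Lemma ip_partial_bound i : exists K, forall psi, test_function psi ->
  ip mu u ('D_(e_ i) psi) ^+ 2 <= K * sq mu psi.
Proof.
have [w wM] : exists w : X, w *m moments = e_ i.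
  by exists (e_ i *m invmx moments); rewrite mulmxKV// moments_unit.
have wMj j : (w *m moments) ord0 j = (j == i)%:R by rewrite wM mxE eqxx.
exists (`|C| * sq P (dotv w)) => psi tp; have lp := L2_test tp.
set V := ip mu u _; set S := sq P _; set B := `|C| * S * _.
have S0 : 0 <= S by exact: sq_ge0.
have B0 : 0 <= B by rewrite !mulr_ge0// sq_ge0.
have luw := L2_prod lu (L2_dotv w); have lpw := L2_prod lp (L2_dotv w).
have dp := test_L2_differentiable tp.
have lD j : L2 mu ('D_(e_ j) psi) by apply: L2_test; exact: test_partial.
have VE : V = ip mm (fun z => u z.1 * dotv w z.2) (dir_deriv (fun j => 'D_(e_ j) psi)).
  exact: esym (etrans (ip_dir_deriv w lu lD) (sum_select _ wMj)).
suff : `|V| <= Num.sqrt B.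
  by rewrite -ler_sqr ?nnegrE// ?sqrtr_ge0// real_normK ?num_real// sqr_sqrtr.
apply/ler_addgt0Pr => r r0.
have r1 : 0 < r ^+ 2 / (sq mm (fun z => u z.1 * dotv w z.2) + 1).
  by rewrite divr_gt0 ?exprn_gt0// ltr_wpDl// sq_ge0.
have [d d0 dP] := prod_quot_vanish P2 dp r1.
have [e [e0 ed eb]] := bound d0.
have en0 : e != 0 by rewrite gt_eqF.
have lq := L2_prod_quot P dp e; have ld := L2_dir_deriv P2 lD.
set A := ip mm (fun z => u z.1 * dotv w z.2) (prod_quot psi e).
have AE : e * A = ip mm (fluct u e) (fun z => psi z.1 * dotv w z.2).
  by rewrite fluct_pairing.
have AB : `|A| <= Num.sqrt B.
  rewrite -sqrtr_sqr ler_wsqrtr//.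
  have := ip_sqr_le (L2_fluct e lu) lpw; rewrite -AE sq_prod//; last exact: L2_dotv.
  move=> h; have : (e * A) ^+ 2 <= C * e ^+ 2 * (sq mu psi * S).
    by apply: le_trans h _; rewrite ler_wpM2r// mulr_ge0// sq_ge0.
  rewrite exprMn (_ : C * _ * _ = e ^+ 2 * (C * S * sq mu psi)); last by ring.
  rewrite ler_pM2l ?exprn_gt0// => /le_trans; apply.
  by rewrite ler_wpM2r ?sq_ge0// ler_wpM2r// ler_norm.
have AV : `|A - V| <= r.
  rewrite VE -ipBr// -ler_sqr ?nnegrE// ?(ltW r0)// real_normK ?num_real//.
  apply: le_trans (ip_sqr_le luw (L2B lq ld)) _.
  have := dP e en0; rewrite gtr0_norm// => /(_ ed).
  rewrite ltr_pdivlMr ?ltr_wpDl ?sq_ge0// => /ltW; apply: le_trans.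
  by rewrite mulrC ler_wpM2l ?sq_ge0// lerDl.
rewrite (_ : V = A - (A - V)); last by rewrite opprB addrC subrK.
by apply: le_trans (ler_normB _ _) _; rewrite lerD.
Qed.

(** The i-th derivative represents the functional that maps psi to minus the pairing of
    u with the i-th derivative of psi. *)
Theorem fluct_bound_gradient : exists G : 'I_n -> X -> R,
  (forall i, L2 mu (G i)) /\ forall i, weak_partial u (G i) i.
Proof.
suff /choice[G GP] : forall i, exists g, L2 mu g /\ weak_partial u g i.
  by exists G; split => i; case: (GP i).
move=> i; have [K KP] := ip_partial_bound i.
have lD psi : test_function psi -> L2 mu ('D_(e_ i) psi).
  by move=> tp; apply: L2_test; exact: test_partial.
have [] := @riesz_subspace _ _ R mu (@test_function R n)
   (fun psi => - ip mu u ('D_(e_ i) psi)) K test0 (@testD R n) (@testZ R n) (@L2_test R n).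
- move=> g h tg th; rewrite -opprD -ipDr//; try exact: lD.
  congr (- _); congr (ip _ _ _); apply/funext => x; rewrite partialD//; first by case: tg.
  by case: th.
- move=> c g tg; rewrite mulrN -ipZr//; last exact: lD.
  by congr (- ip _ _ _); apply/funext => x; rewrite partialZ//; case: tg.
- by move=> g tg; rewrite sqrrN; exact: KP.
- move=> g [lg gP _]; exists g; split => // psi tp.
  by rewrite gP// opprK.
Qed.

End energy_bound.

End fluctuation.

(** * Second-order expansion of the defect *)

Section taylor.
Context {R : realType}.
Variables f f1 f2 : R -> R.
Hypothesis df : forall t : R, is_derive t 1 f (f1 t).
Hypothesis df1 : forall t : R, is_derive t 1 f1 (f2 t).

Definition taylor_rem (a b : R) : R := f b - f a - f1 a * (b - a).

(** Rolle's theorem for the auxiliary function of the Lagrange form of the remainder,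
    parametrized by the segment from a to b. *)
Lemma taylor_remE a b : exists s, `|s - a| <= `|b - a| /\
  taylor_rem a b = 2^-1 * f2 s * (b - a) ^+ 2.
Proof.
pose d := b - a; pose g s := a + s * d.
pose K := taylor_rem a b.
pose h := (fun s : R => f b - f (g s) - f1 (g s) * ((1 - s) * d) - K * (1 - s) ^+ 2).
have dgs (s : R) : is_derive s 1 g d.
  rewrite /g; apply: is_derive_eq.
  by rewrite /GRing.scale/= mulr0 !add0r mul1r mulr1.
have dh (s : R) : is_derive s 1 h ((1 - s) * (2 * K - f2 (g s) * d ^+ 2)).
  have d0 := is_derive1_comp (df (g s)) (dgs s).
  have d1 := is_derive1_comp (df1 (g s)) (dgs s).
  rewrite /h; apply: is_derive_eq.
  rewrite /GRing.scale/=; ring.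
have h0 : h 0 = 0 by rewrite /h /g mul0r addr0 /K /taylor_rem /d; ring.
have h1 : h 1 = 0 by rewrite /h /g /d mul1r (addrC a) subrK; ring.
have [||||s s01 [_ hs]] := @Rolle R h 0 1.
- exact: ltr01.
- by move=> x _; case: (dh x).
- by apply: continuous_subspaceT; exact: is_derive_cont dh.
- by rewrite h0 h1.
have [_] := dh s; rewrite hs => /esym/eqP.
move: s01; rewrite in_itv/= => /andP[s0 s1].
rewrite mulf_eq0 subr_eq0 (gt_eqF s1)/= subr_eq0 => /eqP h2.
exists (g s); split.
  rewrite /g (addrC a) addrK normrM ger0_norm ?(ltW s0)// ler_piMl// ltW//.
by rewrite -mulrA -h2 mulrA mulVf// mul1r.
Qed.

End taylor.

Section quarters.
Context {R : realFieldType}.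
Implicit Types p q r e : R.

Lemma quarter_sum p q r : q < r / 4 -> p <= q -> 2 * q + 2 * p <= r.
Proof. by lra. Qed.

Lemma quarter_sum2 p q r : q <= r / 4 -> p <= r / 4 -> 2 * q + 2 * p <= r.
Proof. by lra. Qed.

Lemma quarter_of_half p q r e : 2 * q + e < r / 2 -> 0 < e -> p <= q -> p <= r / 4.
Proof. by lra. Qed.

End quarters.

Section energy.
Context {R : realType} {n : nat}.
Local Notation X := 'rV[R]_n.
Local Notation mu := (@lebesgue_rV R n).
Variable P : probability X R.
Hypothesis P2 : forall i, L2 P (fun y : X => y ord0 i).
Hypothesis P1 : forall i, \int[P]_y (y ord0 i) = 0.
Local Notation mm := (mu \x P)%E.
Implicit Types (g u : X -> R) (x v w y : X).

Variables f f1 f2 : R -> R.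
Hypothesis df : forall t : R, is_derive t 1 f (f1 t).
Hypothesis df1 : forall t : R, is_derive t 1 f1 (f2 t).
Hypothesis f0 : f 0 = 0.
Hypothesis f10 : f1 0 = 0.
Hypothesis f2_cont : continuous f2.
Variables c1 M : R.
Hypothesis c1_gt0 : 0 < c1.
Hypothesis f2_ge : forall t, c1 <= f2 t.
Hypothesis f2_le : forall t, f2 t <= M.

Local Notation Rem := (taylor_rem f f1).

Let M_gt0 : 0 < M. Proof. exact: lt_le_trans c1_gt0 (le_trans (f2_ge 0) (f2_le 0)). Qed.

Let f2_ge0 t : 0 <= f2 t. Proof. exact: le_trans (ltW c1_gt0) (f2_ge t). Qed.

Lemma rem_ge a b : 2^-1 * c1 * (b - a) ^+ 2 <= Rem a b.
Proof.
have [s [_ ->]] := taylor_remE df df1 a b.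
by rewrite ler_wpM2r ?sqr_ge0// ler_wpM2l// invr_ge0.
Qed.

Lemma rem_le a b : Rem a b <= 2^-1 * M * (b - a) ^+ 2.
Proof.
have [s [_ ->]] := taylor_remE df df1 a b.
by rewrite ler_wpM2r ?sqr_ge0// ler_wpM2l// invr_ge0.
Qed.

Lemma rem_ge0 a b : 0 <= Rem a b.
Proof.
apply: le_trans (rem_ge a b); apply: mulr_ge0; last exact: sqr_ge0.
by apply: mulr_ge0; [rewrite invr_ge0|exact: ltW].
Qed.

Lemma f_bound t : `|f t| <= M * t ^+ 2.
Proof.
have [s [_]] := taylor_remE df df1 0 t.
rewrite /taylor_rem f0 f10 mul0r !subr0 => ->.
rewrite ger0_norm; last by rewrite mulr_ge0 ?sqr_ge0// mulr_ge0// invr_ge0.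
rewrite ler_wpM2r ?sqr_ge0//; apply: le_trans (f2_le s).
by rewrite ler_piMl// invf_le1// ler1n.
Qed.

Lemma f1_bound t : `|f1 t| <= `|M * t|.
Proof.
have [s [_]] := mvt0 df1 t; rewrite f10 subr0 => ->.
by rewrite mulrC !normrM ler_wpM2r// !ger0_norm// ltW.
Qed.

Lemma measurable_f : measurable_fun setT f.
Proof. exact: continuous_measurable_fun (is_derive_cont df). Qed.

Lemma measurable_f1 : measurable_fun setT f1.
Proof. exact: continuous_measurable_fun (is_derive_cont df1). Qed.

Lemma measurable_f2 : measurable_fun setT f2.
Proof. exact: continuous_measurable_fun. Qed.

Lemma rint_f d (T : measurableType d) (m : {measure set T -> \bar R}) (g : T -> R) :
  L2 m g -> rint m (f \o g).
Proof.
move=> [mg ig]; apply: (rint_dom _ _ (rintZ M ig)).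
- exact: measurableT_comp measurable_f mg.
- by move=> x; exact: f_bound.
Qed.

Lemma L2_f1 d (T : measurableType d) (m : {measure set T -> \bar R}) (g : T -> R) :
  L2 m g -> L2 m (f1 \o g).
Proof.
move=> lg; apply: (L2_sq (L2Z M lg)).
  by apply: measurableT_comp measurable_f1 _; case: lg.
by move=> x; exact: f1_bound.
Qed.

Definition defect u (e : R) : R := \int[mu]_x (f (u x) - f (uavg P u e x)).

Lemma rint_defect u e : L2 mu u -> rint mu (fun x => f (u x) - f (uavg P u e x)).
Proof. by move=> lu; apply: rintB; apply: rint_f => //; exact: L2_uavg. Qed.

Definition rem_fluct u (e : R) (z : X * X) : R :=
  Rem (uavg P u e z.1) (u (z.1 - e *: z.2)).

Lemma Rint_fst (g : X -> R) : rint mu g -> rint mm (fun z => g z.1) /\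
  \int[mm]_z g z.1 = \int[mu]_x g x.
Proof.
move=> ig; have i1 := rint_cstP P 1; split.
  by have := rint_prod ig i1; congr (rint _ _); apply/funext => z; rewrite mulr1.
have := Rint_prod ig i1; rewrite Rint_cstP mulr1 => <-.
by apply: eq_Rintegral => z _; rewrite mulr1.
Qed.

Lemma fluct_orth u e g : L2 mu u -> L2 mu g ->
  ip mm (fluct P u e) (fun z => g z.1) = 0.
Proof.
move=> lu lg; have lU := L2_uavg P e lu; have lg' := L2_fst P lg.
rewrite (ipBl (L2_shear_sub P e lu) (L2_fst P lU) lg') ip_avg//; last exact: L2_shear_sub.
apply/eqP; rewrite subr_eq0; apply/eqP.
by have [_ E] := Rint_fst (L2_mul_integrable lU lg); exact: esym E.
Qed.

(** The term f'(u_e(x)) (u(x - e y) - u_e(x)) integrates to 0 by [fluct_orth], and the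
    shear turns the integral of f(u(x - e y)) into that of f(u). *)
Lemma defectE u (e : R) : L2 mu u -> rint mm (rem_fluct u e) /\
  defect u e = \int[mm]_z rem_fluct u e z.
Proof.
move=> lu; have lU := L2_uavg P e lu; have lF := L2_fluct P e lu.
have lf1 := L2_fst P (L2_f1 lU).
have [ifu Efu] := Rint_fst (rint_f lu); have [ifU EfU] := Rint_fst (rint_f lU).
have mfu : measurable_fun setT (fun z : X * X => (f \o u) z.1).
  by case/integrableP : ifu => /measurable_EFinP.
have ifs : rint mm (fun z => f (u (z.1 - e *: z.2))) := rint_shear e ifu.
have ip1 := L2_mul_integrable lF lf1.
have E : rem_fluct u e = (fun z => (f (u (z.1 - e *: z.2)) - f (uavg P u e z.1)) -
    fluct P u e z * f1 (uavg P u e z.1)).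
  by apply/funext => z; rewrite /rem_fluct /taylor_rem /fluct (mulrC (f1 _)).
have iB := rintB ifs ifU.
split; first by rewrite E; exact: (rintB iB ip1).
rewrite E RintegralB//.
rewrite [X in _ - X](fluct_orth e lu (L2_f1 lU)) subr0 RintegralB//.
rewrite /defect RintegralB//; [|exact: rint_f|exact: rint_f].
rewrite -Efu -EfU; congr (_ - _).
by rewrite -(Rintegral_shear P e mfu).
Qed.

(** This is where the strong convexity of f enters. *)
Lemma fluct_defect u (e : R) : L2 mu u ->
  2^-1 * c1 * sq mm (fluct P u e) <= defect u e.
Proof.
move=> lu; have [ir ->] := defectE e lu; have [_ iF] := L2_fluct P e lu.
rewrite /sq -RintegralZl//; apply: le_Rintegral => //; first exact: rintZ.
by move=> z _; exact: rem_ge.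
Qed.

Section gradient.
Variables (u : X -> R) (G : 'I_n -> X -> R).
Hypothesis lu : L2 mu u.
Hypothesis lG : forall i, L2 mu (G i).
Hypothesis wG : forall i, weak_partial u (G i) i.

Local Notation dd := (dir_deriv G).
Let ldd : L2 mm dd := L2_dir_deriv P2 lG.

Definition incr (e : R) (z : X * X) : R := u (z.1 - e *: z.2) - u z.1.
Definition incr_avg (e : R) (x : X) : R := uavg P u e x - u x.
Definition quot_err (e : R) (z : X * X) : R := e^-1 * incr e z + dd z.

Let lincr e : L2 mm (incr e).
Proof. by apply: L2B; [exact: L2_shear_sub|exact: L2_fst]. Qed.

Let lincr_avg e : L2 mu (incr_avg e).
Proof. by apply: L2B => //; exact: L2_uavg. Qed.

Let lquot_err e : L2 mm (quot_err e).
Proof. by apply: L2D => //; exact: L2Z. Qed.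

Lemma dir_deriv_dotv x y : dd (x, y) = dotv (\row_i G i x) y.
Proof. by apply: eq_bigr => i _; rewrite mxE. Qed.

(** Averaging over y kills the directional derivative, so the average of the error of
    the difference quotient is, up to the factor e, the increment of the average. *)
Lemma incr_avg_err (e : R) : e != 0 -> sq mu (incr_avg e) <= e ^+ 2 * sq mm (quot_err e).
Proof.
move=> e0; have [la sa ae1] := avg_L2 (lquot_err e).
have [_ _ ae2] := avg_L2 (lincr e).
have ea : {ae mu, forall x, incr_avg e x = e * avg P (quot_err e) x}.
  apply: filterS ae2 => x [ix _].
  have id : rint P (fun y => dd (x, y)).
    under eq_fun do rewrite dir_deriv_dotv.
    by have [ld1 ld2] := L2_dotv P2 (\row_i G i x); have [] := avg_sqr_le ld1 ld2.
  have -> : avg P (quot_err e) x = \int[P]_y (e^-1 * incr e (x, y) + dd (x, y)) by [].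
  rewrite RintegralD//; last exact: rintZ.
  rewrite [X in _ + X](_ : _ = 0) ?addr0; last first.
    by under eq_Rintegral do rewrite dir_deriv_dotv; exact: mean_dotv.
  rewrite RintegralZl// mulrA divff// mul1r.
  have iu : rint P (fun y => u (x - e *: y)).
    have := rintD ix (rint_cstP P (u x)); congr (rint _ _).
    by apply/funext => y; rewrite /incr/= subrK.
  rewrite /incr_avg /uavg /avg -[X in _ - X](Rint_cstP P) -RintegralB//.
  exact: rint_cstP.
rewrite (sq_ae_eq _ _ ea); [|by case: (lincr_avg e)|]; last first.
  by case: (L2Z e la).
by rewrite sqZ// ler_wpM2l// sqr_ge0.
Qed.

Definition scaled_fluct_err (e : R) (z : X * X) : R := e^-1 * fluct P u e z + dd z.

(** All three functions are expressed by the error of the difference quotients of u and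
    by the directional derivative. *)
Lemma fluct_small (r : R) : 0 < r -> exists2 d, 0 < d & forall e, 0 < e -> e < d ->
  [/\ sq mm (scaled_fluct_err e) <= r, sq mm (incr e) <= r &
    sq mm (fun z => incr_avg e z.1) <= r].
Proof.
move=> r0; have uG := weak_L2_differentiable lu lG wG.
have r4 : 0 < r / 4 by rewrite divr_gt0.
have [d0 d00 dP] := prod_quot_vanish P2 uG r4.
have s0 : 0 <= sq mm dd by exact: sq_ge0.
(* for e < d1 and e < 1, e^2 times the norm of the directional derivative is at most r /
   4 *)
pose d1 := (r / 2) / (2 * sq mm dd + 1).
have d10 : 0 < d1 by rewrite !divr_gt0// ltr_wpDl// mulr_ge0.
exists (Num.min d0 (Num.min d1 1)); first by rewrite !lt_min d00 d10 ltr01.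
move=> e e0; rewrite !lt_min => /and3P[ed0 ed1 e1].
have en0 : e != 0 by rewrite gt_eqF.
have Q4 : sq mm (quot_err e) < r / 4.
  have := dP (- e); rewrite oppr_eq0 en0 normrN gtr0_norm// => /(_ isT ed0).
  rewrite -sqN; congr (sq _ _ < _); apply/funext => z.
  by rewrite /quot_err /incr /prod_quot invrN scaleNr; ring.
have e21 : e ^+ 2 <= 1 by rewrite exprn_ile1// ltW.
have sA : sq mu (incr_avg e) <= e ^+ 2 * sq mm (quot_err e) by exact: incr_avg_err.
have q0 : 0 <= sq mm (quot_err e) by exact: sq_ge0.
split.
- rewrite (_ : scaled_fluct_err e = (fun z => quot_err e z - e^-1 * incr_avg e z.1)).
    apply: le_trans (sqB_le (lquot_err e) (L2Z _ (L2_fst P (lincr_avg e)))) _.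
    rewrite sqZ; last exact: L2_fst.
    rewrite sq_fst//; have : e^-1 ^+ 2 * sq mu (incr_avg e) <= sq mm (quot_err e).
      by rewrite exprVn mulrC ler_pdivrMr ?exprn_gt0// mulrC.
    by move: (e^-1 ^+ 2 * _) (sq mm (quot_err e)) Q4 => p q; exact: quarter_sum.
  apply/funext => z; rewrite /scaled_fluct_err /fluct /quot_err /incr /incr_avg; ring.
- rewrite (_ : incr e = (fun z => e * quot_err e z - e * dd z)).
    apply: le_trans (sqB_le (L2Z e (lquot_err e)) (L2Z e ldd)) _.
    rewrite !sqZ//.
    have h1 : e ^+ 2 * sq mm (quot_err e) <= r / 4.
      by apply: le_trans (ltW Q4); rewrite ler_piMl.
    have h2 : e ^+ 2 * sq mm dd <= r / 4.
      have hq : e ^+ 2 * sq mm dd <= e * sq mm dd by rewrite ler_wpM2r// expr2 ler_piMl// ltW.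
      move: ed1; rewrite ltr_pdivlMr; last by rewrite ltr_wpDl// mulr_ge0.
      by rewrite mulrDr mulr1 (mulrCA e) => hlt; exact: quarter_of_half hlt e0 hq.
    exact: quarter_sum2.
  by apply/funext => z; rewrite /quot_err; field.
- rewrite sq_fst//; apply: le_trans sA _; apply: (@le_trans _ _ (sq mm (quot_err e))).
    by rewrite ler_piMl.
  by apply: le_trans (ltW Q4) _; rewrite ler_pdivrMr// ler_peMr ?(ltW r0)// ler1n.
Qed.

Definition limit_density (z : X * X) : R := 2^-1 * f2 (u z.1) * dd z ^+ 2.

(** The intermediate points of the Lagrange form lie between a_k and b_k, hence tend to
    t. *)
Lemma rem_cvg (a b e : nat -> R) (t w : R) : (forall k, e k != 0) ->
  (b k - t) @[k --> \oo] --> 0 -> (a k - t) @[k --> \oo] --> 0 ->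
  ((e k)^-1 * (b k - a k) + w) @[k --> \oo] --> 0 ->
  ((e k) ^- 2 * Rem (a k) (b k)) @[k --> \oo] --> 2^-1 * f2 t * w ^+ 2.
Proof.
move=> e0 bt at_ bw.
have /choice[s sP] k := taylor_remE df df1 (a k) (b k).
have st : s k @[k --> \oo] --> t.
  have c1_ : (`|b k - t| + `|a k - t| + `|a k - t|) @[k --> \oo] --> `|0 : R| + `|0 : R| + `|0 : R|.
    by apply: cvgD; [apply: cvgD|]; apply: cvg_norm.
  rewrite normr0 !addr0 in c1_.
  suff : (s k - t) @[k --> \oo] --> 0.
    move=> h; rewrite (_ : s = (fun k => (s k - t) + t)); last first.
      by apply/funext => k; rewrite subrK.
    by rewrite -[X in _ --> X]add0r; apply: cvgD => //; exact: cvg_cst.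
  apply: norm_cvg0; apply: (squeeze_cvgr _ (cvg_cst 0) c1_).
  apply: nearW => k; rewrite normr_ge0/=; have [sa _] := sP k.
  have -> : s k - t = (s k - a k) + (a k - t) by ring.
  apply: le_trans (ler_normD _ _) _; rewrite lerD2r; apply: le_trans sa _.
  have -> : b k - a k = (b k - t) - (a k - t) by ring.
  exact: ler_normB.
have wk : ((e k)^-1 * (b k - a k)) @[k --> \oo] --> - w.
  rewrite (_ : (fun k => _) = (fun k => ((e k)^-1 * (b k - a k) + w) - w)); last first.
    by apply/funext => k; rewrite addrK.
  by rewrite -[X in _ --> X]sub0r; apply: cvgB => //; exact: cvg_cst.
have sf : f2 (s k) @[k --> \oo] --> f2 t by apply: (cvg_comp s f2 st); exact: f2_cont.
rewrite -(sqrrN w) (_ : (fun k => _) = (fun k => 2^-1 * f2 (s k) * ((e k)^-1 * (b k - a k)) ^+ 2)).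
  apply: cvgM; first by apply: cvgM; [exact: cvg_cst|exact: sf].
  by rewrite expr2; under eq_fun do rewrite expr2; exact: cvgM.
apply/funext => k; have [_ ->] := sP k; rewrite exprMn exprVn; ring.
Qed.

(** Otherwise there would be steps e_k with the rescaled defect bounded away from its
    limit, and with the errors of [fluct_small] below 8^-k. By [fast_cvg] the integrands
    then converge almost everywhere under an integrable bound, and dominated convergence
    gives a contradiction. *)
Theorem defect_cvg (r : R) : 0 < r -> exists2 d, 0 < d & forall e, 0 < e -> e < d ->
  `|e ^- 2 * defect u e - \int[mm]_z limit_density z| < r.
Proof.
move=> r0; apply: contrapT => /forall2NP nd.
(* the bounds 8^-k are those of fast convergence *)
have /choice[e eP] (k : nat) : exists e : R, [/\ 0 < e,
    r <= `|e ^- 2 * defect u e - \int[mm]_z limit_density z|,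
    sq mm (scaled_fluct_err e) <= 8^-1 ^+ k, sq mm (incr e) <= 8^-1 ^+ k &
    sq mm (fun z => incr_avg e z.1) <= 8^-1 ^+ k].
  have : 0 < 8^-1 ^+ k :> R by rewrite exprn_gt0.
  move=> /fluct_small[d d0 dP].
  have [//|/existsNP[e /not_implyP[e0 /not_implyP[ed /negP]]]] := nd d.
  by rewrite -leNgt => h; have [] := dP e e0 ed; exists e.
have e0 k : 0 < e k by case: (eP k).
have en0 k : e k != 0 by rewrite gt_eqF.
have lsf k : L2 mm (scaled_fluct_err (e k)).
  by apply: L2D => //; apply: L2Z; exact: L2_fluct.
have [|H1 [iH1 b1 c1_]] := fast_cvg lsf; first by move=> k; case: (eP k).
have [|H2 [iH2 b2 c2_]] := fast_cvg (fun k => lincr (e k)); first by move=> k; case: (eP k).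
have [|H3 [iH3 b3 c3_]] := fast_cvg (fun k => L2_fst P (lincr_avg (e k))).
  by move=> k; case: (eP k).
have iFk k : rint mm (fun z => e k ^- 2 * rem_fluct u (e k) z).
  by apply: rintZ; have [] := defectE (e k) lu.
have cF : (\int[mm]_z (e k ^- 2 * rem_fluct u (e k) z)) @[k --> \oo] -->
    \int[mm]_z limit_density z.
  apply: (Rint_dom_cvg (G := fun z => M * (H1 z + dd z ^+ 2))).
  - by move=> k; have /integrableP[/measurable_EFinP] := iFk k.
  - apply: measurable_funM.
      apply: measurable_funM => //; apply: measurableT_comp measurable_f2 _.
      by apply: measurableT_comp => //; case: lu.
    by apply: measurable_funX; case: ldd.
  - apply: filterS3 c1_ c2_ c3_ => z z1 z2 z3.
    by apply: (rem_cvg (e := e) en0 z2 z3); exact: z1.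
  - by apply: rintZ; apply: rintD => //; case: ldd.
  - apply: filterS b1 => z z1 k; have := z1 k; rewrite /scaled_fluct_err => hz.
    have e2 : 0 <= e k ^- 2 by rewrite invr_ge0 sqr_ge0.
    rewrite ger0_norm ?mulr_ge0 ?rem_ge0//.
    apply: le_trans (ler_wpM2l e2 (rem_le _ _)) _.
    set w := _ - _; have -> : e k ^- 2 * (2^-1 * M * w ^+ 2) =
       2^-1 * M * (((e k)^-1 * w + dd z) - dd z) ^+ 2.
      by rewrite addrK exprMn exprVn; ring.
    rewrite (mulrC 2^-1) -mulrA ler_wpM2l ?(ltW M_gt0)//.
    have := sqrrD_le2 ((e k)^-1 * w + dd z) (- dd z); rewrite sqrrN.
    have : ((e k)^-1 * w + dd z) ^+ 2 <= H1 z by [].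
    by move: ((_ + _) ^+ 2) ((_ - _) ^+ 2) => p q; lra.
move/cvgrPdist_lt : cF => /(_ r r0)[k _ /(_ k (leqnn _))] /=.
have [ir dE] := defectE (e k) lu.
rewrite RintegralZl// -dE distrC; have [_ + _ _ _] := eP k.
by move=> /le_lt_trans h /h; rewrite ltxx.
Qed.

(** Integration in y first turns the square of the directional derivative into the
    quadratic form of the second moments. *)
Lemma limit_densityE : rint mu (fun x => f2 (u x) *
    ((\row_i G i x) *m moments P *m (\row_i G i x)^T) ord0 ord0) /\
  \int[mm]_z limit_density z = 2^-1 * \int[mu]_x (f2 (u x) *
    ((\row_i G i x) *m moments P *m (\row_i G i x)^T) ord0 ord0).
Proof.
pose F := fun z : X * X => f2 (u z.1) * dd z ^+ 2.
have iF : rint mm F.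
  case: ldd => md id; apply: (rint_dom _ _ (rintZ M id)).
    apply: measurable_funM; last exact: measurable_funX.
    apply: measurableT_comp measurable_f2 _.
    by apply: measurableT_comp => //; case: lu.
  move=> z; rewrite ger0_norm; last by rewrite mulr_ge0// sqr_ge0.
  by rewrite ler_wpM2r// sqr_ge0.
have qE w : \int[P]_y (dotv w y ^+ 2) = (w *m moments P *m w^T) ord0 ord0.
  rewrite -/(sq P (dotv w)) -ipE {2}/dotv ip_sumr; [|by move=> i; exact: L2Z|exact: L2_dotv].
  rewrite mxE; apply: eq_bigr => i _; rewrite ipZr//; last exact: L2_dotv.
  by rewrite ip_dotv_coord// mulrC; congr (_ * _); rewrite mxE.
have FE x : \int[P]_y F (x, y) = f2 (u x) *
    ((\row_i G i x) *m moments P *m (\row_i G i x)^T) ord0 ord0.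
  rewrite -qE -RintegralZl//; last by case: (L2_dotv P2 (\row_i G i x)).
  by apply: eq_Rintegral => y _; rewrite /F dir_deriv_dotv.
have [_ i1 e1] := fubini1 iF.
have E : (fun x => f2 (u x) * ((\row_i G i x) *m moments P *m (\row_i G i x)^T) ord0 ord0) =
  (fun x => \int[P]_y F (x, y)) by apply/funext => x; rewrite FE.
split; first by rewrite E.
rewrite E -e1 -RintegralZl//.
by apply: eq_Rintegral => z _; rewrite mulrA.
Qed.

End gradient.

End energy.

(** * The probability measure of a kernel *)

Section kernel.
Context {R : realType} {n : nat}.
Local Notation X := 'rV[R]_n.
Local Notation mu := (@lebesgue_rV R n).
Variable phi : X -> R.
Hypothesis phi_L1 : phi \in Lfun mu 1%E.
Hypothesis phi_ge0 : {ae mu, forall y, 0 <= phi y}.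
Hypothesis phi_mass : (\int[mu]_y (phi y)%:E = 1)%E.
Hypothesis phi_mean : forall i : 'I_n, (\int[mu]_y (y ord0 i * phi y)%:E = 0)%E.
Hypothesis phi_moment2 : (\int[mu]_y (enorm y ^+ 2 * phi y)%:E < +oo)%E.

Let mphi : measurable_fun setT phi.
Proof. by move: phi_L1; rewrite inE => /andP[]; rewrite inE. Qed.

(** A density has to be nonnegative everywhere, whereas phi is so only almost
    everywhere. *)
Definition pos_kernel (y : X) : R := Num.max (phi y) 0.

Let mpos : measurable_fun setT pos_kernel.
Proof. exact: measurable_funrpos. Qed.

Let pos_ge0 y : 0 <= pos_kernel y.
Proof. by rewrite /pos_kernel le_max lexx orbT. Qed.

Lemma pos_kernelE : {ae mu, forall y, phi y = pos_kernel y}.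
Proof. by apply: filterS phi_ge0 => y y0; rewrite /pos_kernel; apply/esym/max_idPl. Qed.

Lemma integral_pos_kernel (h : X -> R) : measurable_fun setT h ->
  (\int[mu]_y (h y * phi y)%:E = \int[mu]_y (h y * pos_kernel y)%:E)%E.
Proof.
move=> mh; apply: ae_eq_integral => //.
- by apply/measurable_EFinP; exact: measurable_funM.
- by apply/measurable_EFinP; exact: measurable_funM.
- by apply: filterS pos_kernelE => y yE _; rewrite yE.
Qed.

Lemma pos_kernel_mass : (\int[mu]_y (pos_kernel y)%:E = 1)%E.
Proof.
rewrite -phi_mass; have := integral_pos_kernel (measurable_cst (1 : R)).
under eq_integral do rewrite mul1r; move=> ->.
by apply: eq_integral => y _; rewrite mul1r.
Qed.

Definition kernel_prob : probability X R := pdens mpos pos_ge0 pos_kernel_mass.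
Local Notation P := kernel_prob.

Lemma kernel_dominates : P `<< mu.
Proof. exact: (pdens_dominates mpos pos_ge0 pos_kernel_mass). Qed.

Lemma Rintegral_kernel (h : X -> R) : measurable_fun setT h ->
  \int[P]_y h y = \int[mu]_y (h y * phi y).
Proof.
move=> mh; rewrite [LHS](Rintegral_pdens mpos pos_ge0 pos_kernel_mass mh).
by congr fine; rewrite integral_pos_kernel.
Qed.

Lemma enorm_sqr (y : X) : enorm y ^+ 2 = \sum_i y ord0 i ^+ 2.
Proof. by rewrite sqr_sqrtr// sumr_ge0// => i _; rewrite sqr_ge0. Qed.

Lemma measurable_enorm_sqr : measurable_fun setT (fun y : X => enorm y ^+ 2).
Proof.
under eq_fun do rewrite enorm_sqr.
by apply: measurable_sum => i; apply: measurable_funX; exact: measurable_coord.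
Qed.

Lemma kernel_L2_coord i : L2 P (fun y : X => y ord0 i).
Proof.
have mc := @measurable_coord R n i.
split => //; apply: (rint_pdens mpos pos_ge0 pos_kernel_mass); first exact: measurable_funX.
apply: (rint_dom (m := mu) (G := fun y => enorm y ^+ 2 * pos_kernel y)).
- by apply: measurable_funM => //; exact: measurable_funX.
- move=> y; have p0 := pos_ge0 y.
  rewrite ger0_norm; last by rewrite mulr_ge0 ?sqr_ge0.
  apply: ler_wpM2r => //; rewrite enorm_sqr.
  by rewrite (bigD1 i)//= lerDl sumr_ge0// => j _; rewrite sqr_ge0.
- apply/integrableP; split.
    by apply/measurable_EFinP; apply: measurable_funM => //; exact: measurable_enorm_sqr.
  move: phi_moment2; rewrite integral_pos_kernel; last exact: measurable_enorm_sqr.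
  congr (_ < _)%E; apply: eq_integral => y _; congr EFin.
  by rewrite ger0_norm// mulr_ge0 ?sqr_ge0// pos_ge0.
Qed.

Lemma kernel_mean i : \int[P]_y (y ord0 i) = 0.
Proof.
by rewrite Rintegral_kernel; [rewrite /Rintegral phi_mean|exact: measurable_coord].
Qed.

Lemma kernel_moments : moments P = moment_matrix phi.
Proof.
apply/matrixP => i j; rewrite !mxE Rintegral_kernel.
  by apply: eq_Rintegral => y _; rewrite /tensor !mxE big_ord1 !mxE.
by apply: measurable_funM; exact: measurable_coord.
Qed.

(** The substitution of e y for y. *)
Lemma convolutionE (u : X -> R) (e : R) : measurable_fun setT u -> 0 < e ->
  convolution u (rescale phi e) = uavg P u e.
Proof.
move=> mu_ e0; apply/funext => x.
have mux : measurable_fun setT (fun y : X => u (x - e *: y)).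
  apply: measurableT_comp mu_ _; apply: measurable_rVD => //.
  by apply: measurable_rVN; apply: measurable_rVZ.
rewrite /uavg /avg Rintegral_kernel// /convolution; congr fine.
have ei0 : 0 < e^-1 by rewrite invr_gt0.
have mux' : measurable_fun setT (fun y : X => (u (x - e *: y) * phi y)%:E).
  by apply/measurable_EFinP; exact: measurable_funM.
have en0 : 0 < e ^- n by rewrite invr_gt0 exprn_gt0.
pose g := fun y : X => ((e ^- n)%:E * (u (x - e *: y) * phi y)%:E)%E.
rewrite (eq_integral (fun y : X => g (e^-1 *: y))) => [|y _]; last first.
  rewrite /g scalerA divff ?gt_eqF// scale1r /rescale -EFinM; congr EFin.
  by rewrite mulrCA.
have ein0 : 0 < e^-1 ^- n by rewrite invr_gt0 exprn_gt0.
rewrite (integral_scales ein0 _ (scales_boxes_scale ei0)); first last.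
- exact: emeasurable_funM.
- exact: measurable_rVZ.
rewrite gt0_integralZ// muleA -EFinM exprVn invrK divff ?mul1e// gt_eqF//.
by rewrite exprn_gt0.
Qed.

End kernel.

Section kernel_limit.
Context {R : realType} {n : nat}.
Local Notation X := 'rV[R]_n.
Local Notation mu := (@lebesgue_rV R n).
Variables (f : R -> R) (c1 : R) (phi u : X -> R).
Hypothesis f_C2 : C2 f.
Hypothesis f2_bounded : exists M : R, forall t, `|f^`(2)%classic t| <= M.
Hypothesis f0 : f 0 = 0.
Hypothesis f10 : f^`()%classic 0 = 0.
Hypothesis c1_gt0 : 0 < c1.
Hypothesis f2_ge : forall t, c1 <= f^`(2)%classic t.
Hypothesis phi_L1 : phi \in Lfun mu 1%E.
Hypothesis phi_ge0 : {ae mu, forall y, 0 <= phi y}.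
Hypothesis phi_mass : (\int[mu]_y (phi y)%:E = 1)%E.
Hypothesis phi_mean : forall i : 'I_n, (\int[mu]_y (y ord0 i * phi y)%:E = 0)%E.
Hypothesis phi_moment2 : (\int[mu]_y (enorm y ^+ 2 * phi y)%:E < +oo)%E.
Hypothesis u_L2 : u \in Lfun mu 2%:E.

Local Notation f1 := (f^`()%classic).
Local Notation f2 := (f^`(2)%classic).
Local Notation P := (kernel_prob phi_L1 phi_ge0 phi_mass).

Let df (t : R) : is_derive t 1 f (f1 t).
Proof. by case: f_C2 => d _ _; rewrite derive1E; apply: DeriveDef. Qed.

Let df1 (t : R) : is_derive t 1 f1 (f2 t).
Proof. by case: f_C2 => _ d _; rewrite derive1nS derive1n1 derive1E; apply: DeriveDef. Qed.

Let f2_cont : continuous f2. Proof. by case: f_C2. Qed.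

Let f2_le : exists M : R, forall t, f2 t <= M.
Proof. by case: f2_bounded => M fM; exists M => t; exact: le_trans (ler_norm _) (fM t). Qed.

Let lu : L2 mu u. Proof. exact/Lfun_L2. Qed.
Let P2 := kernel_L2_coord phi_L1 phi_ge0 phi_mass phi_moment2.
Let P1 := kernel_mean phi_L1 phi_ge0 phi_mass phi_mean.

Lemma rescaled_defectE (e : R) : 0 < e ->
  rescaled_defect f u phi e = (e ^- 2 * defect P f u e)%:E.
Proof.
move=> e0; have [M fM] := f2_le.
rewrite /rescaled_defect EFinM (convolutionE phi_L1 phi_ge0 phi_mass lu.1 e0).
congr (_ * _)%E; rewrite /defect fineK//; apply: integrable_fin_num => //.
exact: (rint_defect P df df1 f0 f10 c1_gt0 f2_ge fM e lu).
Qed.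

(** A finite lower limit gives arbitrarily small e at which the rescaled defect is below
    a fixed constant, and the defect controls the fluctuation. *)
Lemma liminf_fluct : (limf_einf (rescaled_defect f u phi) 0^'+ < +oo)%E ->
  exists C : R, forall d, 0 < d -> exists e, [/\ 0 < e, e < d &
    sq (mu \x P)%E (fluct P u e) <= C * e ^+ 2].
Proof.
have [M fM] := f2_le; rewrite limf_einfE => hlt.
have [C hC] : exists C : R, (ereal_sup [set ereal_inf [set rescaled_defect f u phi x | x in V]
    | V in 0^'+] <= C%:E)%E.
  move: hlt; case: (ereal_sup _) => [r| |] //= _; first by exists r.
  by exists 0; rewrite leNye.
exists (2 * (C + 1) / c1) => d d0; pose I0 : set R := `]0, d[%classic.
have hV : 0^'+ I0.
  near=> x; rewrite /I0/= in_itv/=; apply/andP; split; near: x.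
    exact: nbhs_right_gt.
  exact: nbhs_right_lt.
(* the infimum over ]0, d[ is at most C, so a value below C + 1 is attained there *)
have hI : (ereal_inf [set rescaled_defect f u phi x | x in I0] < (C + 1)%:E)%E.
  apply: le_lt_trans (le_trans _ hC) _; last by rewrite lte_fin ltrDl.
  by apply: ereal_sup_ubound; exists I0.
case/ereal_inf_lt : hI => v [e]; rewrite /I0/= in_itv/= => /andP[e0 ed] <- he.
exists e; split => //; move: he; rewrite rescaled_defectE// lte_fin.
rewrite mulrC ltr_pdivrMr ?exprn_gt0// => he.
have := fluct_defect P df df1 f0 f10 c1_gt0 f2_ge fM e lu.
move=> /le_lt_trans/(_ he)/ltW; set s := sq _ _.
move=> h; rewrite (_ : _ * e ^+ 2 = 2 * ((C + 1) * e ^+ 2) / c1); last by ring.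
rewrite ler_pdivlMr// (_ : s * c1 = 2 * (2^-1 * c1 * s)); last by field.
by rewrite ler_wpM2l.
Unshelve. all: by end_near. Qed.

Lemma W12_exists : (limf_einf (rescaled_defect f u phi) 0^'+ < +oo)%E -> W12 u.
Proof.
move=> /liminf_fluct[C hC].
have Pmu := kernel_dominates phi_L1 phi_ge0 phi_mass.
have [G [lG wG]] := fluct_bound_gradient P2 P1 Pmu lu hC.
exists (fun x => \row_i G i x); split => // [i|psi i tp].
  by under eq_fun do rewrite mxE; apply/Lfun_L2.
rewrite [LHS](wG i psi tp); congr (- _).
by apply: eq_Rintegral => x _; rewrite mxE.
Qed.

Section gradient.
Variable Du : X -> X.
Hypothesis uDu : W12_with_gradient u Du.

Definition energy : \bar R := (\int[mu]_x
  (f2 (u x) * (Du x *m moment_matrix phi *m (Du x)^T) ord0 ord0)%:E)%E.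

Theorem rescaled_defect_cvg :
  rescaled_defect f u phi eps @[eps --> 0^'+] --> ((2^-1)%:E * energy)%E.
Proof.
have [_ lDu wDu] := uDu; have [M fM] := f2_le.
pose G (i : 'I_n) (x : X) : R := Du x ord0 i.
have lG i : L2 mu (G i) by apply/Lfun_L2; exact: lDu.
have wG i : weak_partial u (G i) i by move=> psi tp; exact: wDu.
have DuE x : \row_i G i x = Du x by apply/rowP => i; rewrite mxE.
have [] := limit_densityE P2 f2_cont c1_gt0 f2_ge fM lu lG.
rewrite (kernel_moments phi_L1 phi_ge0 phi_mass).
rewrite (_ : (fun x => f2 (u x) * _) = (fun x => f2 (u x) *
  (Du x *m moment_matrix phi *m (Du x)^T) ord0 ord0)); last first.
  by apply/funext => x; rewrite DuE.
move=> iE LE.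
have EE : ((2^-1)%:E * energy = (\int[(mu \x P)%E]_z limit_density f2 u G z)%:E)%E.
  rewrite LE EFinM; congr (_ * _)%E; rewrite /energy -[LHS]fineK.
    by congr (fine _)%:E; apply: eq_integral => x _; rewrite DuE.
  exact: integrable_fin_num.
rewrite EE.
apply: cvg_trans (_ : (e ^- 2 * defect P f u e)%:E @[e --> 0^'+] --> _).
  apply: near_eq_cvg; near=> e; rewrite rescaled_defectE//; near: e; exact: nbhs_right_gt.
apply: cvg_EFin; first exact: nearW.
apply/cvgrPdist_lt => r r0.
have [d d0 dP] := defect_cvg P2 P1 df df1 f0 f10 f2_cont c1_gt0 f2_ge fM lu lG wG r0.
near=> e; rewrite /= distrC; apply: dP; near: e.
  exact: nbhs_right_gt.
exact: nbhs_right_lt.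
Unshelve. all: by end_near. Qed.

End gradient.

End kernel_limit.

(** * Polar coordinates *)

Section line.
Context {R : realType}.
Local Notation leb1 := (@lebesgue_measure R).

Lemma lebesgue_scale (c : R) : 0 < c -> forall A : set (measurableTypeR R), measurable A ->
  leb1 A = (c%:E * leb1 ((fun r : R => (c * r)%R) @^-1` A))%E.
Proof.
move=> c0; have mh : measurable_fun [set: measurableTypeR R]
    ((fun r => c * r) : measurableTypeR R -> measurableTypeR R) by exact: measurable_funM.
pose H1 := isMeasurableFun.Build _ _ _ _ _ mh.
pose hm : {mfun _ >-> _} := HB.pack (_ : measurableTypeR R -> measurableTypeR R) H1.
apply: (@lebesgue_measure_unique _ (mscale (NngNum (ltW c0)) (pushforward leb1 hm))).
move=> _ [[a b] /= ab <-]; rewrite /mscale/= /pushforward/=.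
rewrite (_ : _ @^-1` _ = `]c^-1 * a, c^-1 * b]%classic); last first.
  by apply/seteqP; split => r /=; rewrite !in_itv/= ltr_pdivrMl// ler_pdivlMl.
rewrite !lebesgue_measure_itv/= !lte_fin ltr_pM2l ?invr_gt0//.
case: ifP => _; last by rewrite mule0.
by rewrite -!EFinB -EFinM; congr EFin; field; rewrite gt_eqF.
Qed.

Lemma integral_monomial (m : nat) (c b : R) : 0 < b ->
  (\int[leb1]_(r in `]0%R, b[) (m.+1%:R * c * r ^+ m)%:E = (c * b ^+ m.+1)%:E)%E.
Proof.
move=> b0; pose F := fun r : R => c * r ^+ m.+1.
pose v := fun r : R => m.+1%:R * c * r ^+ m.
have dF (r : R) : is_derive r 1 F (v r).
  have := is_deriveZ c (is_deriveX m.+1 (is_derive_id r (1 : R))).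
  rewrite exprfctE; congr (is_derive _ _ _ _).
  by rewrite /v /GRing.scale/=; ring.
have cF : continuous F := is_derive_cont dF.
have cv : continuous v.
  move=> r; apply: cvgM; first exact: cvg_cst.
  exact: exprn_continuous.
have mv (i : interval R) : measurable_fun [set` i] (EFin \o v).
  by apply: measurable_funTS; apply/measurable_EFinP; exact: continuous_measurable_fun.
rewrite integral_itv_bndo_bndc; last exact: mv.
rewrite integral_itv_obnd_cbnd; last exact: mv.
rewrite (@continuous_FTC2 _ v F 0 b b0).
- by rewrite -EFinB /F expr0n mulr0 subr0.
- exact: continuous_subspaceT.
- split; first by move=> r _; case: (dF r).
    by apply: cvg_at_right_filter; exact: cF.
  by apply: cvg_at_left_filter; exact: cF.
- by move=> r _; rewrite derive1E; case: (dF r).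
Qed.

End line.

Section radial_law.
Context {R : realType} {n : nat}.
Hypothesis n_gt0 : (0 < n)%N.
Local Notation X := 'rV[R]_n.
Local Notation mu := (@lebesgue_rV R n).
Local Notation leb1 := (@lebesgue_measure R).
Local Notation omega := (@unit_ball_volume R n).

Lemma enorm_ge0 (y : X) : 0 <= enorm y. Proof. exact: sqrtr_ge0. Qed.

Lemma coord_le_enorm (y : X) i : `|y ord0 i| <= enorm y.
Proof.
rewrite -ler_sqr ?nnegrE ?enorm_ge0// real_normK ?num_real// enorm_sqr.
by rewrite (bigD1 i)//= lerDl sumr_ge0// => j _; rewrite sqr_ge0.
Qed.

Lemma enormZ (c : R) (y : X) : 0 <= c -> enorm (c *: y) = c * enorm y.
Proof.
move=> c0; rewrite /enorm (_ : \sum_i _ = c ^+ 2 * \sum_i y ord0 i ^+ 2).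
  by rewrite sqrtrM ?sqr_ge0// sqrtr_sqr ger0_norm.
by rewrite mulr_sumr; apply: eq_bigr => i _; rewrite mxE exprMn.
Qed.

Lemma measurable_enorm : measurable_fun setT (@enorm R n).
Proof.
have -> : @enorm R n = Num.sqrt \o (fun y => enorm y ^+ 2).
  by apply/funext => y /=; rewrite sqrtr_sqr ger0_norm// enorm_ge0.
apply: measurableT_comp; last exact: measurable_enorm_sqr.
exact: continuous_measurable_fun (@sqrt_continuous R).
Qed.

Lemma measurable_ball (b : R) : measurable [set y : X | enorm y < b].
Proof.
have := measurable_funTP measurable_enorm (measurable_itv `]-oo, b[).
by congr measurable; apply/seteqP; split => y /=; rewrite in_itv.
Qed.

Lemma unit_ball_lty : (mu [set y : X | (enorm y < 1)%R] < +oo)%E.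
Proof.
apply: le_lt_trans (lebesgue_obox_lty (const_mx (- 1)) (const_mx 1)).
apply: le_measure; rewrite ?inE; [exact: measurable_ball|exact: measurable_obox|].
by move=> y /= y1; apply/cubeP => i; exact: le_lt_trans (coord_le_enorm y i) y1.
Qed.

Lemma unit_ball_volume_ge0 : 0 <= omega.
Proof. exact/fine_ge0/measure_ge0. Qed.

Lemma ball_volume (b : R) : 0 < b -> mu [set y : X | enorm y < b] = (omega * b ^+ n)%:E.
Proof.
move=> b0; have bi0 : 0 < b^-1 by rewrite invr_gt0.
rewrite (_ : [set _ | _] = (fun y : X => b^-1 *: y) @^-1` [set y | enorm y < 1]).
  rewrite (scales_boxes_measure _ _ (scales_boxes_scale bi0)).
  - rewrite exprVn invrK mulrC EFinM; congr (_ * _)%E.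
    by rewrite /unit_ball_volume fineK// ge0_fin_numE// unit_ball_lty.
  - by rewrite invr_ge0 exprn_ge0// ltW.
  - exact: measurable_rVZ.
  - exact: measurable_ball.
apply/seteqP; split => y /=; rewrite enormZ ?(ltW bi0)// ltr_pdivrMl// mulr1//.
Qed.

(** The surface measure of the sphere of radius r is n omega r^(n-1); the value 0 for r
    <= 0 makes this a density on the whole line. *)
Definition radial_weight (r : R) : R := if 0 < r then n%:R * omega * r ^+ n.-1 else 0.

Lemma measurable_radial_weight : measurable_fun setT radial_weight.
Proof.
apply: measurable_fun_ifT => //; last first.
  by apply: measurable_funM => //; exact: measurable_funX.
exact: measurable_fun_ltr.
Qed.

Lemma radial_weight_ge0 r : 0 <= radial_weight r.
Proof.
rewrite /radial_weight; case: ltP => // r0.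
by rewrite !mulr_ge0// ?unit_ball_volume_ge0// exprn_ge0// ltW.
Qed.

(** Both sides are measures in A. On a half-line, the left side is the volume of a ball,
    known by scaling, and the right side is the integral of a monomial. *)
Lemma radial_law (A : set (measurableTypeR R)) : measurable A ->
  mu (@enorm R n @^-1` A) = (\int[leb1]_(r in A) (radial_weight r)%:E)%E.
Proof.
have me : measurable_fun setT (@enorm R n : _ -> measurableTypeR R) := measurable_enorm.
pose H1 := isMeasurableFun.Build _ _ _ _ _ me.
pose hm : {mfun _ >-> _} := HB.pack (_ : _ -> measurableTypeR R) H1.
have mball b : pushforward mu hm `]-oo, b[%classic = mu [set y : X | enorm y < b].
  by congr (mu _); apply/seteqP; split => y /=; rewrite in_itv.
suff H B : measurable B -> pushforward mu hm B =
    dens leb1 measurable_radial_weight radial_weight_ge0 B by exact: H.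
apply: (@measure_unique _ R (measurableTypeR R) (@RGenInftyO.G R) (fun k => `]-oo, k%:R[%classic)).
- exact: RGenInftyO.measurableE.
- move=> _ _ [a ->] [b ->]; exists (Num.min a b); apply/seteqP; split => r /=.
    by rewrite !in_itv/= lt_min => -[-> ->].
  by rewrite !in_itv/= lt_min => /andP.
- by move=> k; eexists.
- apply/seteqP; split => // r _; exists (Num.bound `|r|) => //=.
  by rewrite in_itv/=; apply: le_lt_trans (ler_norm r) _; exact: archi_boundP.
- move=> _ [b ->]; rewrite [LHS](mball b) /= /dens.
  have [b0|b0] := leP b 0.
    rewrite (_ : [set _ | _] = set0) ?measure0.
      rewrite integral0_eq// => r /=; rewrite in_itv/= => rb.
      by rewrite /radial_weight ltNge (ltW (lt_le_trans rb b0)).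
    by apply/seteqP; split => // y /= /lt_le_trans /(_ b0); rewrite ltNge enorm_ge0.
  rewrite ball_volume// -[in b ^+ n](prednK n_gt0) -integral_monomial// prednK//.
  rewrite [LHS]integral_mkcond [RHS]integral_mkcond; apply: eq_integral => r _.
  rewrite /patch !mem_setE/= !in_itv/= /radial_weight.
  by case: (ltP 0 r) => //= r0; case: ifP.
- move=> k; suff : (mu [set y : X | (enorm y < k%:R)%R] < +oo)%E by rewrite -mball.
  case: k => [|k].
    rewrite (_ : [set _ | _] = set0) ?measure0//.
    by apply/seteqP; split => // y /=; rewrite ltNge enorm_ge0.
  by rewrite ball_volume// ltry.
Qed.

Lemma ge0_integral_radial (h : R -> \bar R) : measurable_fun setT h ->
  (forall r, (0 <= h r)%E) ->
  (\int[mu]_y h (enorm y) = \int[leb1]_r (h r * (radial_weight r)%:E))%E.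
Proof.
move=> mh h0.
have me : measurable_fun setT (@enorm R n : _ -> measurableTypeR R) := measurable_enorm.
pose H1 := isMeasurableFun.Build _ _ _ _ _ me.
pose hm : {mfun _ >-> _} := HB.pack (_ : _ -> measurableTypeR R) H1.
rewrite -(ge0_integral_dens leb1 measurable_radial_weight radial_weight_ge0 mh h0).
rewrite -[LHS](@ge0_integral_pushforward _ _ _ _ R hm _ mu setT)//.
by apply: eq_measure_integral => A mA _; exact: radial_law.
Qed.

End radial_law.

(** * Radial kernels *)

Section lower_integral.
Context d (T : measurableType d) (R : realType) (m : {measure set T -> \bar R}).
Implicit Types F G : T -> \bar R.

Import HBNNSimple.

(** F and G are arbitrary functions, and their integrals are suprema over simple
    functions below them; setting such a simple function to 0 on N does not change its
    integral. *)
Lemma integral_le_off_null F G (N : set T) : measurable N -> m N = 0%E ->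
  (forall x, (0 <= F x)%E) -> (forall x, (0 <= G x)%E) ->
  (forall x, ~ N x -> (F x <= G x)%E) -> (\int[m]_x F x <= \int[m]_x G x)%E.
Proof.
move=> mN N0 F0 G0 FG; rewrite !ge0_integralTE//.
apply: ge_ereal_sup => _ [h /= hF <-].
have mC := measurableC mN.
have -> : sintegral m h = sintegral m (proj_nnsfun h mC).
  rewrite -mrestrict -integral_nnsfun// -setTD.
  rewrite -ge0_negligible_integral//.
  - by rewrite integral_nnsfun// patch_setT.
  - by apply/measurable_EFinP; exact: measurable_funP.
  - by move=> x _; rewrite lee_fin.
apply: ereal_sup_ubound; exists (proj_nnsfun h mC) => //= x.
rewrite mindicE; case: (boolP (x \in ~` N)) => [/set_mem xN|_]; last by rewrite mulr0.
by rewrite mulr1; apply: le_trans (hF x) _; exact: FG.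
Qed.

Lemma integral_eq_off_null F G (N : set T) : measurable N -> m N = 0%E ->
  (forall x, (0 <= F x)%E) -> (forall x, (0 <= G x)%E) ->
  (forall x, ~ N x -> F x = G x) -> (\int[m]_x F x = \int[m]_x G x)%E.
Proof.
move=> mN N0 F0 G0 FG; apply/eqP; rewrite eq_le.
by apply/andP; split; apply: (integral_le_off_null mN N0) => // x /FG ->.
Qed.

(** If both parts of F have infinite integral, the integral of F is oo - oo = -oo, whose
    finite part is 0 by convention. *)
Lemma odd_integral F : (\int[m]_x (- F x) = \int[m]_x F x)%E -> fine (\int[m]_x F x)%E = 0.
Proof.
rewrite integralE [in RHS]integralE [X in fine X = _]integralE.
under eq_integral do rewrite funeposN; under [X in (_ - X)%E = _]eq_integral do rewrite funenegN.
have := @integral_ge0 _ _ R m setT F^\+%E (fun x _ => funepos_ge0 F x).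
have := @integral_ge0 _ _ R m setT F^\-%E (fun x _ => funeneg_ge0 F x).
move: (\int[m]_x _)%E (\int[m]_x _)%E => [r| |] [s| |] //= _ _ [h].
by move: h; rewrite -[X in X = _]opprB => /eqP; rewrite eqNr => /eqP.
Qed.

End lower_integral.

Lemma fine_mulEFin (R : realType) (c : R) (x : \bar R) : 0 <= c ->
  fine (c%:E * x)%E = c * fine x.
Proof.
rewrite le_eqVlt => /predU1P[<-|c0]; first by rewrite mul0e mul0r.
case: x => [r| |] //=.
  by rewrite gt0_muley ?lte_fin// mulr0.
by rewrite gt0_muleNy ?lte_fin// mulr0.
Qed.

Section rays.
Context {R : realType} {n : nat}.
Hypothesis n_gt0 : (0 < n)%N.
Local Notation X := 'rV[R]_n.
Local Notation mu := (@lebesgue_rV R n).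
Local Notation leb1 := (@lebesgue_measure R).

Lemma ae_exists (A : X -> Prop) : {ae mu, forall y, A y} -> exists y, A y.
Proof.
move=> aeA; apply: contrapT => /forallNP nA.
have : mu.-negligible setT.
  by apply: negligibleS aeA => y _ /=; exact: nA.
move=> /(negligibleP _ measurableT) T0.
have mb := @measurable_obox R n 0 (const_mx 1).
have : (mu (obox (0%R : X) (const_mx 1%R)) <= mu setT)%E.
  by apply: le_measure => //; apply: mem_set.
rewrite T0 lebesgue_obox => [|i]; last by rewrite !mxE.
rewrite lee_fin leNgt; apply/negP; rewrite negbK; apply: prodr_gt0 => i _.
by rewrite !mxE subr0.
Qed.

(** Every dilate of N is null. By Tonelli, almost every half-line from the origin
    therefore meets N in a null set of radii. *)
Lemma ray_null (N : set X) : measurable N -> mu N = 0%E -> exists y0 : X,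
  [/\ 0 < enorm y0, measurable [set s : measurableTypeR R | 0 < s /\ N (s *: y0)] &
    leb1 [set s | 0 < s /\ N (s *: y0)] = 0%E].
Proof.
move=> mN N0.
pose E := [set z : X * measurableTypeR R | 0 < z.2 /\ N (z.2 *: z.1)].
have mE : measurable E.
  apply: measurableI.
    have := measurable_funTP (@measurable_snd _ _ X (measurableTypeR R)) (measurable_itv `]0, +oo[).
    by congr measurable; apply/seteqP; split => z /=; rewrite in_itv/= andbT.
  apply: (measurable_funTP _ mN); apply: measurable_rVZ; first exact: measurable_fst.
  exact: measurable_snd.
have mS (y : X) : measurable [set s : measurableTypeR R | 0 < s /\ N (s *: y)].
  by have := measurable_funTP (measurable_pair1 y) mE.
have F0 : (\int[mu]_y \int[leb1]_s (\1_E (y, s))%:E = 0)%E.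
  have := @fubini_tonelli _ _ _ _ _ (@leb R n) leb1 (EFin \o \1_E).
  move=> ->; first last.
  - by move=> z; rewrite lee_fin.
  - by apply/measurable_EFinP; exact: measurable_indic.
  rewrite integral0_eq// => s _.
  have [s0|s0] := ltP 0 s; last first.
    rewrite integral0_eq// => y _ /=; rewrite indicE memNset// => -[/=].
    by rewrite ltNge s0.
  rewrite (eq_integral (fun y : X => (\1_N (s *: y))%:E)) => [|y _]; last first.
    rewrite /= !indicE; have [h|h] := pselect (N (s *: y)); first by rewrite !mem_set.
    by rewrite !memNset// => -[].
  have sn0 : 0 < s ^- n by rewrite invr_gt0 exprn_gt0.
  rewrite (integral_scales sn0 _ (scales_boxes_scale s0) (g := fun y => (\1_N y)%:E)).
  - by rewrite integral_indic// setIT N0 mule0.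
  - exact: measurable_rVZ.
  - by apply/measurable_EFinP; exact: measurable_indic.
have [y0 [y1 y2]] : exists y0 : X, 0 < enorm y0 /\ leb1 [set s | 0 < s /\ N (s *: y0)] = 0%E.
  apply: ae_exists.
  have ae1 : {ae mu, forall y : X, 0 < enorm y}.
    have [|M [mM M0 sM]] := @hyperplane_null R n (basis_rV (Ordinal n_gt0)).
      apply/eqP => /rowP/(_ (Ordinal n_gt0)); rewrite !mxE !eqxx/= => /eqP.
      by rewrite oner_eq0.
    exists M; split => // y /= ny; apply: sM => /=; rewrite /dotv big1// => i _.
    have y0 : enorm y = 0.
      by apply/eqP; rewrite eq_le enorm_ge0 andbT leNgt; apply/negP.
    have := coord_le_enorm y i; rewrite y0 normr_le0 => /eqP ->.
    by rewrite mulr0.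
  have ae2 : {ae mu, forall y : X, leb1 [set s | 0 < s /\ N (s *: y)] = 0%E}.
    have IE (y : X) : (\int[leb1]_s (\1_E (y, s))%:E)%E = leb1 [set s | 0 < s /\ N (s *: y)].
      have := @integral_indic _ _ R leb1 setT measurableT _ (mS y).
      by rewrite setIT.
    have mI : measurable_fun setT (fun y : X => \int[leb1]_s (\1_E (y, s))%:E)%E.
      apply: (@measurable_fun_fubini_tonelli_F _ _ _ _ _ leb1 (EFin \o \1_E)).
        by apply/measurable_EFinP; exact: measurable_indic.
      by move=> z; rewrite lee_fin.
    have : (\int[mu]_y `|\int[leb1]_s (\1_E (y, s))%:E| = 0)%E.
      rewrite -F0; apply: eq_integral => y _; rewrite gee0_abs//.
      by rewrite IE measure_ge0.
    move=> /(ae_eq_integral_abs _ measurableT mI).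
    by apply: filterS => y /(_ I); rewrite /= IE.
  by apply: filterS2 ae1 ae2.
by exists y0; split.
Qed.

(** Along a generic half-line, phi is a Borel function of the radius and agrees with
    phit at almost every radius. Taking the positive part keeps it nonnegative at the
    exceptional radii. *)
Lemma radial_profile (phi : X -> R) (phit : R -> R) : measurable_fun setT phi ->
  (forall r, 0 <= r -> 0 <= phit r) -> {ae mu, forall y, phi y = phit (enorm y)} ->
  exists g : R -> R, [/\ measurable_fun setT g, forall r, 0 <= g r &
    exists2 N : set (measurableTypeR R), measurable N /\ leb1 N = 0%E &
      forall r, 0 < r -> ~ N r -> phit r = g r].
Proof.
move=> mphi phit0 [N [mN N0 sN]].
have [y0 [y0_gt0 mS S0]] := ray_null mN N0.
set S := [set s | _] in mS S0; set rho := enorm y0 in y0_gt0.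
have ri0 : 0 < rho^-1 by rewrite invr_gt0.
exists (fun r => Num.max (phi ((rho^-1 * r) *: y0)) 0); split.
- apply: measurable_funrpos; apply: measurableT_comp mphi _.
  by apply: measurable_rVZ => //; exact: measurable_funM.
- by move=> r; rewrite le_max lexx orbT.
- exists ((fun r => rho^-1 * r) @^-1` S : set (measurableTypeR R)).
    split; first by apply: measurable_funTP mS; exact: measurable_funM.
    have := lebesgue_scale ri0 mS; rewrite S0 => /esym/eqP.
    by rewrite mule_eq0 eqe gt_eqF//= => /eqP.
  move=> r r0 nS; have sr0 : 0 < rho^-1 * r by rewrite mulr_gt0.
  have -> : phi ((rho^-1 * r) *: y0) = phit (enorm ((rho^-1 * r) *: y0)).
    apply: contrapT => h; apply: nS; split => //; exact: sN.
  rewrite enormZ ?(ltW sr0)// -/rho mulrAC mulVf ?gt_eqF// mul1r.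
  by apply/esym/max_idPl; apply: phit0; exact: ltW.
Qed.

Lemma null_radii (N : set (measurableTypeR R)) : measurable N -> leb1 N = 0%E ->
  {ae mu, forall y, 0 < enorm y /\ ~ N (enorm y)}.
Proof.
move=> mN N0; pose Z : set (measurableTypeR R) := `]-oo, 0]%classic.
have mZ : measurable Z by exact: measurable_itv.
have me : measurable_fun setT (@enorm R n : _ -> measurableTypeR R) := measurable_enorm.
have E1 : mu (@enorm R n @^-1` N) = 0%E.
  rewrite radial_law// null_set_integral//.
  by apply: measurable_funTS; apply/measurable_EFinP; exact: measurable_radial_weight.
have E2 : mu (@enorm R n @^-1` Z) = 0%E.
  rewrite radial_law// integral0_eq// => r; rewrite /Z/= in_itv/= => r0.
  by rewrite /radial_weight ltNge r0.
exists ((@enorm R n @^-1` N) `|` (@enorm R n @^-1` Z)); split.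
- by apply: measurableU; apply: measurable_funTP.
- by rewrite null_set_setU//; apply: measurable_funTP.
- move=> y /= h; have [ny|ny] := pselect (N (enorm y)); [by left|right].
  by rewrite /Z/= in_itv/= leNgt; apply/negP => y1; apply: h.
Qed.

End rays.

Section radial_moments.
Context {R : realType} {n : nat}.
Hypothesis n_gt0 : (0 < n)%N.
Local Notation X := 'rV[R]_n.
Local Notation mu := (@lebesgue_rV R n).
Local Notation leb1 := (@lebesgue_measure R).
Local Notation omega := (@unit_ball_volume R n).

Section profile.
Variable g : R -> R.
Hypotheses (mg : measurable_fun setT g) (g0 : forall r, 0 <= g r).

Let mG : measurable_fun setT (fun y : X => g (enorm y)).
Proof. exact: measurableT_comp mg measurable_enorm. Qed.

Let mF i j : measurable_fun setT (fun y : X => (y ord0 i * y ord0 j * g (enorm y))%:E).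
Proof.
apply/measurable_EFinP; apply: measurable_funM => //.
by apply: measurable_funM; exact: measurable_coord.
Qed.

Lemma enorm_reflect i (y : X) : enorm (reflect_coord i y) = enorm y.
Proof.
congr (Num.sqrt _); apply: eq_bigr => j _; rewrite mxE.
by case: eqP => _; rewrite ?sqrrN.
Qed.

Lemma enorm_col_perm (s : {perm 'I_n}) (y : X) : enorm (col_perm s y) = enorm y.
Proof.
congr (Num.sqrt _); rewrite [RHS](reindex_inj (@perm_inj _ s)).
by apply: eq_bigr => j _; rewrite mxE.
Qed.

(** The reflection of the i-th coordinate changes the sign of the integrand. *)
Lemma radial_moment_off i j : i != j ->
  fine (\int[mu]_y (y ord0 i * y ord0 j * g (enorm y))%:E)%E = 0.
Proof.
move=> ij; apply: odd_integral.
have := integral_scales ltr01 (measurable_reflect i) (scales_boxes_reflect i) (mF i j).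
rewrite mul1e => <-; apply: eq_integral => y _.
by rewrite enorm_reflect !mxE eqxx eq_sym (negbTE ij) !mulNr.
Qed.

(** Exchange the two coordinates. *)
Lemma radial_moment_diag i j :
  (\int[mu]_y (y ord0 i * y ord0 i * g (enorm y))%:E =
   \int[mu]_y (y ord0 j * y ord0 j * g (enorm y))%:E)%E.
Proof.
have := integral_scales ltr01 (measurable_col_perm (tperm i j))
  (scales_boxes_swap (tperm i j)) (mF i i).
rewrite mul1e => <-; apply: eq_integral => y _.
by rewrite enorm_col_perm !mxE tpermL.
Qed.

(** The n diagonal moments are equal and add up to the integral of |y|^2 g(|y|), which
    in polar coordinates is n omega times the integral of r^(n+1) g(r). The factors n
    cancel. *)
Lemma radial_second_moment i :
  (\int[mu]_y (y ord0 i * y ord0 i * g (enorm y))%:E =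
   omega%:E * \int[leb1]_(r in `[0%R, +oo[) (r ^+ n.+1 * g r)%:E)%E.
Proof.
set J := (LHS); set K := (\int[leb1]_(r in _) _)%E.
have nJ : (\int[mu]_y (enorm y ^+ 2 * g (enorm y))%:E = n%:R%:E * J)%E.
  rewrite (eq_integral (fun y : X => \sum_i (y ord0 i * y ord0 i * g (enorm y))%:E)%E).
    rewrite ge0_integral_sum//; last first.
      by move=> k y _; rewrite lee_fin mulr_ge0// -expr2 sqr_ge0.
    rewrite (eq_bigr (fun=> J)) => [|k _]; last exact: radial_moment_diag.
    rewrite (eq_bigr (fun=> 1%:E * J)%E) => [|k _]; last by rewrite mul1e.
    by rewrite -ge0_sume_distrl// sumEFin sumr_const card_ord.
  move=> y _; rewrite sumEFin; congr EFin; rewrite enorm_sqr mulr_suml.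
  by apply: eq_bigr => k _; rewrite expr2.
have nK : (\int[mu]_y (enorm y ^+ 2 * g (enorm y))%:E = n%:R%:E * (omega%:E * K))%E.
  rewrite (ge0_integral_radial n_gt0 (h := fun r => (r ^+ 2 * g r)%:E)); first last.
  - by move=> r; rewrite lee_fin mulr_ge0// sqr_ge0.
  - by apply/measurable_EFinP; apply: measurable_funM => //; exact: measurable_funX.
  rewrite muleA -EFinM -ge0_integralZl//; first last.
  - by rewrite lee_fin mulr_ge0// unit_ball_volume_ge0.
  - move=> r; rewrite /= in_itv/= andbT => r0.
    by rewrite lee_fin mulr_ge0// exprn_ge0.
  - apply: measurable_funTS; apply/measurable_EFinP.
    by apply: measurable_funM => //; exact: measurable_funX.
  have powE (t : R) : t ^+ n.+1 = t ^+ 2 * t ^+ n.-1 by rewrite -exprD add2n prednK.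
  rewrite [RHS]integral_mkcond; apply: eq_integral => r _.
  rewrite /patch mem_setE/= in_itv/= andbT /radial_weight.
  (* at r = 0 the two integrands agree because n + 1 > 0 *)
  case: ltgtP => [r0|r0|<-].
  - rewrite -EFinM -EFinM; congr EFin.
    by rewrite (powE r); ring.
  - by rewrite mule0.
  - by rewrite mule0 expr0n mul0r mule0.
have n0 : n%:R != 0 :> R by rewrite pnatr_eq0 -lt0n.
rewrite nJ in nK; move: nK => /(congr1 (fun x => (n%:R^-1)%:E * x)%E).
by rewrite !muleA -!EFinM mulVf// mul1r mul1e.
Qed.

End profile.

Theorem radial_moment_matrix (phi : X -> R) (phit : R -> R) : measurable_fun setT phi ->
  (forall r, 0 <= r -> 0 <= phit r) -> {ae mu, forall y, phi y = phit (enorm y)} ->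
  moment_matrix phi = (radial_constant (n := n) phit)%:M.
Proof.
move=> mphi phit0 phiE.
have [g [mg g0 [N [mN N0] gE]]] := radial_profile n_gt0 mphi phit0 phiE.
have phig : {ae mu, forall y, phi y = g (enorm y)}.
  apply: filterS2 phiE (null_radii n_gt0 mN N0) => y -> [y0 yN]; exact: gE.
have cE : radial_constant (n := n) phit =
    omega * fine (\int[leb1]_(r in `[0%R, +oo[) (r ^+ n.+1 * g r)%:E)%E.
  congr (_ * fine _); rewrite integral_mkcond [RHS]integral_mkcond.
  apply: (integral_eq_off_null mN N0).
  - move=> r; rewrite /patch mem_setE/= in_itv/= andbT; case: ifP => // r0.
    by rewrite lee_fin mulr_ge0 ?exprn_ge0 ?phit0.
  - move=> r; rewrite /patch mem_setE/= in_itv/= andbT; case: ifP => // r0.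
    by rewrite lee_fin mulr_ge0 ?exprn_ge0.
  - move=> r rN; rewrite /patch mem_setE/= in_itv/= andbT; case: ltgtP => // [r0|<-].
      by rewrite gE.
    by rewrite expr0n !mul0r.
apply/matrixP => i j; rewrite !mxE.
have -> : \int[mu]_y (tensor y y i j * phi y) =
    fine (\int[mu]_y (y ord0 i * y ord0 j * g (enorm y))%:E)%E.
  congr fine; apply: ae_eq_integral => //.
  - apply/measurable_EFinP; apply: measurable_funM => //.
    under eq_fun do rewrite /tensor !mxE big_ord1 !mxE.
    by apply: measurable_funM; exact: measurable_coord.
  - apply/measurable_EFinP; apply: measurable_funM.
      by apply: measurable_funM; exact: measurable_coord.
    exact: measurableT_comp mg measurable_enorm.
  - apply: filterS phig => y -> _; congr EFin.
    by rewrite /tensor !mxE big_ord1 !mxE.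
have [<-|ij] := eqVneq i j; last by rewrite mulr0n radial_moment_off.
rewrite mulr1n radial_second_moment// cE fine_mulEFin//.
exact: unit_ball_volume_ge0.
Qed.

End radial_moments.

Lemma energy_scalar {R : realType} {n : nat} (f : R -> R) (a : R)
    (phi u : 'rV[R]_n -> R) (Du : 'rV[R]_n -> 'rV[R]_n) :
  measurable_fun setT (f^`(2)%classic \o u) ->
  (forall i, measurable_fun setT (fun x => Du x ord0 i)) ->
  (forall t, 0 <= f^`(2)%classic t) -> 0 <= a -> moment_matrix phi = a%:M ->
  energy f phi u Du =
    (a%:E * \int[lebesgue_rV n]_x (f^`(2)%classic (u x) * enorm (Du x) ^+ 2)%:E)%E.
Proof.
move=> mf2 mDu f2_ge0 a0 phia; rewrite -ge0_integralZl//.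
- apply: eq_integral => x _; rewrite -EFinM; congr EFin.
  rewrite phia mul_mx_scalar -scalemxAl !mxE enorm_sqr.
  under [in LHS]eq_bigr do rewrite mxE -expr2.
  by ring.
- apply/measurable_EFinP; apply: measurable_funM => //.
  under eq_fun do rewrite enorm_sqr.
  by apply: measurable_sum => i; apply: measurable_funX.
- by move=> x _; rewrite lee_fin mulr_ge0// sqr_ge0.
Qed.

Theorem theorem1p2 (R : realType) (n : nat) (n_gt0 : (0 < n)%N)
    (f : R -> R) (c1 : R) (phi u : 'rV[R]_n -> R)
    (f_C2 : C2 f) (f2_bounded : exists M : R, forall t, `|f^`(2)%classic t| <= M)
    (f0 : f 0 = 0) (f10 : f^`()%classic 0 = 0)
    (c1_gt0 : 0 < c1) (f2_ge : forall t, c1 <= f^`(2)%classic t)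
    (phi_L1 : phi \in Lfun (lebesgue_rV n) 1%E)
    (phi_ge0 : {ae lebesgue_rV n, forall y, 0 <= phi y})
    (phi_mass : (\int[lebesgue_rV n]_y (phi y)%:E = 1)%E)
    (phi_mean : forall i : 'I_n,
      (\int[lebesgue_rV n]_y (y ord0 i * phi y)%:E = 0)%E)
    (phi_moment2 :
      (\int[lebesgue_rV n]_y (enorm y ^+ 2 * phi y)%:E < +oo)%E)
    (u_L2 : u \in Lfun (lebesgue_rV n) 2%:E)
    (liminf_finite : (limf_einf (rescaled_defect f u phi) 0^'+ < +oo)%E) :
  W12 u /\
  forall Du : 'rV[R]_n -> 'rV[R]_n, W12_with_gradient u Du ->
    (rescaled_defect f u phi eps @[eps --> 0^'+] -->
      ((2^-1)%:E * \int[lebesgue_rV n]_x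
        (f^`(2)%classic (u x) *
         (Du x *m moment_matrix phi *m (Du x)^T) ord0 ord0)%:E)%E) /\
    (forall phit : R -> R, (forall r, 0 <= r -> 0 <= phit r) ->
      {ae lebesgue_rV n, forall y, phi y = phit (enorm y)} ->
      rescaled_defect f u phi eps @[eps --> 0^'+] -->
        ((2^-1 * radial_constant (n := n) phit)%:E * \int[lebesgue_rV n]_x
          (f^`(2)%classic (u x) * enorm (Du x) ^+ 2)%:E)%E).
Proof.
split; first exact: (W12_exists f_C2 f2_bounded f0 f10 c1_gt0 f2_ge phi_L1 phi_ge0
  phi_mass phi_mean phi_moment2 u_L2).
move=> Du uDu; have cvg := rescaled_defect_cvg f_C2 f2_bounded f0 f10 c1_gt0 f2_ge
  phi_L1 phi_ge0 phi_mass phi_mean phi_moment2 u_L2 uDu.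
split; first exact: cvg.
move=> phit phit0 phiE.
have mphi : measurable_fun setT phi by move: phi_L1; rewrite inE => /andP[]; rewrite inE.
have phia := radial_moment_matrix n_gt0 mphi phit0 phiE.
have [_ lDu _] := uDu; have [mu_ _] := (Lfun_L2 _ _).1 u_L2.
have a0 : 0 <= radial_constant (n := n) phit.
  apply: mulr_ge0; first exact: unit_ball_volume_ge0.
  apply: Rintegral_ge0 => r; rewrite /= in_itv/= andbT => r0.
  by rewrite mulr_ge0 ?exprn_ge0 ?phit0.
move: cvg; rewrite (energy_scalar _ _ _ a0 phia) ?EFinM ?muleA//.
- case: f_C2 => _ _ f2_cont.
  exact: measurableT_comp (continuous_measurable_fun f2_cont) mu_.
- by move=> i; have [] := (Lfun_L2 _ _).1 (lDu i).
- by move=> t; exact: le_trans (ltW c1_gt0) (f2_ge t).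
Qed.
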